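(* Every discrete and proper Iwasawa continued fraction algorithm is convergent. Moreover, if it is complete, then it is ergodic.
   Context: **Spaces.** $k$ is $\mathbb R$, $\mathbb C$ or the quaternions, $n\ge1$; $\mathrm{Im}(k)\subset k$ is the set of purely imaginary elements; $\|\cdot\|$ is the standard norm; $p/q:=pq^{-1}$. The Iwasawa inversion space $\mathbb X=\mathbb X^n_k$ is $k^n\times\mathrm{Im}(k)$ with group law $(z,t)*(z',t')=(z+z',t+t'+2\,\mathrm{Im}\langle z,z'\rangle)$, $\langle z,z'\rangle=\sum_i\overline{z_i}z'_i$. The same formula defines a group law on $k^n\times k$, with gauge $|(z,w)|=\big\|\|z\|^2+|\mathrm{Re}\,w|+\mathrm{Im}\,w\big\|^{1/2}$ and $d((z,w),(z',w'))=|(-z,-w)*(z',w')|$; restricted to $\mathbb X$, $d$ is the Cygan metric. $\mathbb H=\mathbb H^{n+1}_k=\{(z,w)\in k^n\times k:\mathrm{Re}\,w>0\}$, $\partial\mathbb H=\mathbb X$. Let $\phi(z,w)=(1,\sqrt2 z,w+\|z\|^2)\in k^{n+2}$, $\infty$ correspond to $(0,0,1)$, and $J=\begin{bmatrix}0&0&-1\\0&\mathrm{id}_n&0\\-1&0&0\end{bmatrix}$. Via $\phi$, the projective unitary group $G=\mathbb PU(J)$ acts on $\mathbb H$ and on $\mathbb X\cup\{\infty\}$ (its elements are the Möbius transformations); $\mathbb H$ has the $G$-invariant Riemannian metric $d_{\mathbb H}$. $\mathrm{Isom}(\mathbb X)$ denotes the isometries of $(\mathbb X,d)$ that are restrictions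 of elements of $\mathrm{Stab}_G(\infty)$, viewed as a subgroup of $G$. Measure on $\mathbb X$ is Haar (Lebesgue) measure. An inversion is a Möbius transformation $\iota:\mathbb X\setminus\{0\}\to\mathbb X\setminus\{0\}$ exchanging $0$ and $\infty$ with $|\iota h|=1/|h|$ and $d(\iota h,\iota h')=\frac{d(h,h')}{|h||h'|}$ for all $h\in(\mathbb H\cup\mathbb X)\setminus\{0\}$, $h'\in\mathbb X\setminus\{0\}$. **Iwasawa CF algorithm.** Data: $k,n,\mathbb X$; an inversion $\iota$; a lattice $\mathcal Z\subset\mathrm{Isom}(\mathbb X)$ (discrete subgroup with finite-measure quotient); a fundamental domain $K\subset\mathbb X$ (measurable, $\mathbb X=\bigcup_{a\in\mathcal Z}aK$, and $K\cap\bigcup_{a\in\mathcal Z\setminus\{\mathrm{id}\}}aK$ has measure $0$); and a rounding mapping $[\cdot]:\mathbb X\to\mathcal Z$ with $[y]^{-1}(y)\in K$ for all $y$. The modular group is $\mathcal M=\langle\iota,\mathcal Z\rangle\subset G$. The shift map is $T:K\to K$, $T(0)=0$ if $0\in K$, $T(x)=[\iota(x)]^{-1}(\iota(x))$ otherwise. For $x\in K$: $x_0=x$, digits $a_{i+1}=[\iota(x_i)]$, $x_{i+1}=T(x_i)$, stopping if some $x_i=0$; $M_0=\mathrm{id}$, $M_{i+1}=M_i\iota^{-1}a_{i+1}$; convergents $M_i(0)$. **Properties.** *Discrete*: $\mathcal M$ is a discrete subgroup of $G$. *Proper*: $\mathrm{rad}(K)=\sup\{|x|:x\in K\}<1$.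 *Complete*: $\mathrm{Stab}_{\mathcal M}(\infty)=\mathcal Z$. *Convergent*: for almost every $x\in K$ the convergents converge to $x$ (finite expansions count as convergent). *Ergodic*: for every measurable $B\subset K$, $\mu(T^{-1}B\,\triangle\,B)=0$ implies $\mu(B)=0$ or $\mu(K\setminus B)=0$ ($\mu$ Lebesgue measure; $T$ need not preserve $\mu$). *)

(* Defs.v *)
From HB Require Import structures.
From mathcomp Require Import all_boot all_order all_algebra.
From mathcomp Require Import ring complex.
From mathcomp Require Import all_classical all_reals all_analysis.

Set Implicit Arguments.
Unset Strict Implicit.
Unset Printing Implicit Defensive.

Import Order.TTheory GRing.Theory Num.Theory.

Local Open Scope classical_set_scope.
Local Open Scope ring_scope.

Record quaternion (R : Type) : Type := Quaternion { qa : R; qb : R; qc : R; qd : R }.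

Section QuaternionRing.
Variable R : realType.
Local Notation Q := (quaternion R).
Implicit Types x y z : Q.

Definition quat_to_tuple x := (qa x, qb x, qc x, qd x).
Definition tuple_to_quat (t : R * R * R * R) : Q :=
  let: (a, b, c, d) := t in Quaternion a b c d.
Lemma quat_to_tupleK : cancel quat_to_tuple tuple_to_quat.
Proof. by case. Qed.

HB.instance Definition _ := Choice.copy Q (can_type quat_to_tupleK).

Definition quat_add x y :=
  Quaternion (qa x + qa y) (qb x + qb y) (qc x + qc y) (qd x + qd y).
Definition quat_opp x := Quaternion (- qa x) (- qb x) (- qc x) (- qd x).
Definition quat_mul x y := Quaternion
  (qa x * qa y - qb x * qb y - qc x * qc y - qd x * qd y)
  (qa x * qb y + qb x * qa y + qc x * qd y - qd x * qc y)
  (qa x * qc y - qb x * qd y + qc x * qa y + qd x * qb y)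
  (qa x * qd y + qb x * qc y - qc x * qb y + qd x * qa y).
Definition quat_conj x := Quaternion (qa x) (- qb x) (- qc x) (- qd x).
Definition quat_sqnorm x := qa x ^+ 2 + qb x ^+ 2 + qc x ^+ 2 + qd x ^+ 2.
Definition quat_real (r : R) : Q := Quaternion r 0 0 0.
Definition quat_inv x := quat_mul (quat_conj x) (quat_real (quat_sqnorm x)^-1).

Lemma quat_addA : associative quat_add.
Proof. by case=> ? ? ? ? [? ? ? ?] [? ? ? ?]; congr Quaternion => /=; ring. Qed.
Lemma quat_addC : commutative quat_add.
Proof. by case=> ? ? ? ? [? ? ? ?]; congr Quaternion => /=; ring. Qed.
Lemma quat_add0 : left_id (quat_real 0) quat_add.
Proof. by case=> ? ? ? ?; congr Quaternion => /=; ring. Qed.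
Lemma quat_addN : left_inverse (quat_real 0) quat_opp quat_add.
Proof. by case=> ? ? ? ?; congr Quaternion => /=; ring. Qed.

HB.instance Definition _ :=
  GRing.isZmodule.Build Q quat_addA quat_addC quat_add0 quat_addN.

Lemma quat_mulA : associative quat_mul.
Proof. by case=> ? ? ? ? [? ? ? ?] [? ? ? ?]; congr Quaternion => /=; ring. Qed.
Lemma quat_mul1l : left_id (quat_real 1) quat_mul.
Proof. by case=> ? ? ? ?; congr Quaternion => /=; ring. Qed.
Lemma quat_mul1r : right_id (quat_real 1) quat_mul.
Proof. by case=> ? ? ? ?; congr Quaternion => /=; ring. Qed.
Lemma quat_mulDl : left_distributive quat_mul +%R.
Proof. by case=> ? ? ? ? [? ? ? ?] [? ? ? ?]; congr Quaternion => /=; ring. Qed.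
Lemma quat_mulDr : right_distributive quat_mul +%R.
Proof. by case=> ? ? ? ? [? ? ? ?] [? ? ? ?]; congr Quaternion => /=; ring. Qed.
Lemma quat_one_neq0 : quat_real 1 != 0.
Proof. by apply/eqP => -[] /eqP; rewrite oner_eq0. Qed.

HB.instance Definition _ := GRing.Zmodule_isNzRing.Build Q
  quat_mulA quat_mul1l quat_mul1r quat_mulDl quat_mulDr quat_one_neq0.

Lemma quat_sqnorm_eq0 x : (quat_sqnorm x == 0) = (x == 0).
Proof.
apply/idP/eqP => [|->]; last by rewrite /quat_sqnorm /= !expr0n /= !addr0.
case: x => a b c d; rewrite /quat_sqnorm /=.
rewrite !paddr_eq0 ?addr_ge0 ?sqr_ge0// !sqrf_eq0.
by move=> /andP[/andP[/andP[/eqP-> /eqP->] /eqP->] /eqP->].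
Qed.

Lemma quat_mulVx : {in [pred x | x != 0], left_inverse 1 quat_inv *%R}.
Proof.
move=> x; rewrite inE -quat_sqnorm_eq0.
case: x => a b c d; rewrite /quat_sqnorm /= => h.
by congr Quaternion; rewrite /= /quat_sqnorm /=; first [by field | by ring].
Qed.
Lemma quat_mulxV : {in [pred x | x != 0], right_inverse 1 quat_inv *%R}.
Proof.
move=> x; rewrite inE -quat_sqnorm_eq0.
case: x => a b c d; rewrite /quat_sqnorm /= => h.
by congr Quaternion; rewrite /= /quat_sqnorm /=; first [by field | by ring].
Qed.
Lemma quat_unitP x y : y * x = 1 /\ x * y = 1 -> x != 0.
Proof.
by move=> [+ _]; apply: contra_eqN => /eqP->; rewrite mulr0 eq_sym oner_eq0.
Qed.
Lemma quat_inv_out : {in [predC [pred x | x != 0]], quat_inv =1 id}.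
Proof.
move=> x; rewrite !inE negbK => /eqP->; rewrite /quat_inv.
by congr Quaternion => /=; ring.
Qed.

HB.instance Definition _ := GRing.NzRing_hasMulInverse.Build Q
  quat_mulVx quat_mulxV quat_unitP quat_inv_out.

End QuaternionRing.

(* The three choices of the division algebra [k]. *)
Inductive scalars := RealScalars | ComplexScalars | QuaternionScalars.

Definition scal (R : realType) (s : scalars) : unitRingType :=
  match s with
  | RealScalars => R
  | ComplexScalars => R[i]
  | QuaternionScalars => quaternion R
  end.

Section Scalars.
Variables (R : realType) (s : scalars).
Local Notation k := (scal R s).

Definition kcoords : k -> seq R :=
  match s return scal R s -> seq R with
  | RealScalars => fun x => [:: x]
  | ComplexScalars => fun x => [:: complex.Re x; complex.Im x]
  | QuaternionScalars => fun x => [:: qa x; qb x; qc x; qd x]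
  end.

Definition kdim : nat :=
  match s with RealScalars => 1 | ComplexScalars => 2 | QuaternionScalars => 4 end.

Definition kconj : k -> k :=
  match s return scal R s -> scal R s with
  | RealScalars => id
  | ComplexScalars => @conjc R
  | QuaternionScalars => @quat_conj R
  end.

Definition kreal : R -> k :=
  match s return R -> scal R s with
  | RealScalars => id
  | ComplexScalars => fun r => r%:C%C
  | QuaternionScalars => @quat_real R
  end.

Definition kre (x : k) : R := (kcoords x)`_0.
Definition kim (x : k) : k := x - kreal (kre x).
Definition knorm (x : k) : R := Num.sqrt (kre (kconj x * x)).

End Scalars.
Arguments kdim s : clear implicits.
Arguments kreal {R} s r.

Section ScalarsTheory.
Variables (R : realType) (s : scalars).
Local Notation k := (scal R s).
Implicit Types x y : k.

Lemma scal_unitE x : (x \is a GRing.unit) = (x != 0).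
Proof. by case: s x => x //; rewrite unitfE. Qed.

Lemma kconjD x y : kconj (x + y) = kconj x + kconj y.
Proof.
case: s x y => [//|[a b] [c d]|[a b ? ?] [c d ? ?]] /=.
- by congr Complex; ring.
- by congr Quaternion => /=; ring.
Qed.

Lemma kconjM x y : kconj (x * y) = kconj y * kconj x.
Proof.
case: s x y => [x y|[a b] [c d]|[a b ? ?] [c d ? ?]] /=.
- by rewrite mulrC.
- by congr Complex; ring.
- by congr Quaternion => /=; ring.
Qed.

Lemma kconjK : involutive (@kconj R s).
Proof.
case: s => [x|[a b]|[a b c d]] //=.
- by rewrite opprK.
- by congr Quaternion; rewrite /= opprK.
Qed.

Lemma kconj0 : kconj 0 = 0 :> k.
Proof. by apply: (addIr (kconj 0)); rewrite -kconjD !add0r. Qed.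

Lemma kconj1 : kconj 1 = 1 :> k.
Proof. by have := kconjM (kconj (1 : k)) 1; rewrite mulr1 kconjK mulr1. Qed.

Lemma kconjN x : kconj (- x) = - kconj x.
Proof. by apply: (addIr (kconj x)); rewrite -kconjD !addNr kconj0. Qed.

Lemma kconj_sum I (r : seq I) (P : pred I) (F : I -> k) :
  kconj (\sum_(i <- r | P i) F i) = \sum_(i <- r | P i) kconj (F i).
Proof. exact: (big_morph (@kconj R s) kconjD kconj0). Qed.

End ScalarsTheory.

Definition ctrmx (R : realType) (s : scalars) (m n : nat)
  (A : 'M[scal R s]_(m, n)) : 'M[scal R s]_(n, m) := map_mx (@kconj R s) A^T.

Section CtrmxTheory.
Variables (R : realType) (s : scalars).
Local Notation k := (scal R s).

Lemma ctrmxM m n p (A : 'M[k]_(m, n)) (B : 'M[k]_(n, p)) :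
  ctrmx (A *m B) = ctrmx B *m ctrmx A.
Proof.
apply/matrixP => i j; rewrite !mxE kconj_sum.
by apply: eq_bigr => l _; rewrite !mxE kconjM.
Qed.

Lemma ctrmxK m n (A : 'M[k]_(m, n)) : ctrmx (ctrmx A) = A.
Proof. by apply/matrixP => i j; rewrite !mxE kconjK. Qed.

Lemma ctrmx1 n : ctrmx 1%:M = 1%:M :> 'M[k]_n.
Proof.
apply/matrixP => i j; rewrite !mxE eq_sym.
by case: (_ == _); rewrite ?kconj1 ?kconj0.
Qed.

End CtrmxTheory.

Section UnitaryGroup.
Variables (R : realType) (s : scalars) (n : nat).
Local Notation k := (scal R s).
Local Notation mat := 'M[k]_(1 + n + 1).

Definition formJ : mat :=
  block_mx (block_mx 0 0 0 1%:M) (col_mx (- 1%:M) 0) (row_mx (- 1%:M) 0) 0.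

Definition unitaryJ (A : mat) : Prop :=
  (exists B : mat, A *m B = 1%:M /\ B *m A = 1%:M) /\
  ctrmx A *m formJ *m A = formJ.

Lemma ctrmx_formJ : ctrmx formJ = formJ.
Proof.
rewrite /ctrmx /formJ !(tr_block_mx, tr_col_mx, tr_row_mx, map_block_mx).
rewrite !(map_col_mx, map_row_mx, map_block_mx) !(trmx0, trmx1, linearN).
have E0 m p : map_mx (@kconj R s) (0 : 'M[k]_(m, p)) = 0.
  by apply/matrixP => i j; rewrite !mxE kconj0.
have E1 m : map_mx (@kconj R s) (1%:M : 'M[k]_m) = 1%:M.
  by rewrite -[RHS](ctrmx1 R s) /ctrmx trmx1.
have EN m : map_mx (@kconj R s) (- 1%:M : 'M[k]_m) = - 1%:M.
  by rewrite -{2}E1; apply/matrixP => i j; rewrite !mxE kconjN.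
by rewrite /= !trmx1 !E0 !E1 !EN.
Qed.

Lemma formJ_sqr : formJ *m formJ = 1%:M.
Proof.
rewrite /formJ mulmx_block mulmx_block !mul_col_row mul_block_col ?mul_col_mx.
rewrite !mul_row_block !mul_row_col.
rewrite !(mulmx0, mul0mx, mulNmx, mulmxN, mul1mx, mulmx1, opprK, addr0, add0r).
rewrite ?oppr0 ?row_mx0 ?col_mx0 add_block_mx ?addr0 ?add0r.
by rewrite -scalar_mx_block -scalar_mx_block.
Qed.

Lemma unitaryJ1 : unitaryJ 1%:M.
Proof. by split; [exists 1%:M; rewrite mulmx1|rewrite ctrmx1 mul1mx mulmx1]. Qed.

Lemma unitaryJM A B : unitaryJ A -> unitaryJ B -> unitaryJ (A *m B).
Proof.
move=> [[A' [AA' A'A]] HA] [[B' [BB' B'B]] HB]; split.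
  exists (B' *m A'); split.
    by rewrite -mulmxA (mulmxA B) BB' mul1mx.
  by rewrite -mulmxA (mulmxA A') A'A mul1mx.
by rewrite ctrmxM !mulmxA -(mulmxA (ctrmx B)) -(mulmxA (ctrmx B)) HA.
Qed.

Definition unitaryJ_inv (A : mat) : mat := formJ *m ctrmx A *m formJ.

Lemma unitaryJ_mulV A : unitaryJ A -> unitaryJ_inv A *m A = 1%:M.
Proof.
by move=> [_ HA]; rewrite /unitaryJ_inv -!mulmxA (mulmxA (ctrmx A)) HA formJ_sqr.
Qed.

Lemma unitaryJ_mulrV A : unitaryJ A -> A *m unitaryJ_inv A = 1%:M.
Proof.
move=> uA; have := unitaryJ_mulV uA; case: uA => [[B [AB BA]] HA] VA.
suff -> : unitaryJ_inv A = B by [].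
by rewrite -[LHS]mulmx1 -AB mulmxA VA mul1mx.
Qed.

Lemma unitaryJV A : unitaryJ A -> unitaryJ (unitaryJ_inv A).
Proof.
move=> uA; split.
  by exists A; split; [exact: unitaryJ_mulV|exact: unitaryJ_mulrV].
rewrite {1}/unitaryJ_inv !ctrmxM !ctrmx_formJ ctrmxK.
rewrite -(mulmxA _ _ formJ) -(mulmxA _ _ formJ) formJ_sqr mulmx1.
by rewrite -(mulmxA formJ A) unitaryJ_mulrV// mulmx1.
Qed.

Definition unitary : Type := {A : mat | `[< unitaryJ A >]}.
HB.instance Definition _ := Choice.on unitary.

Definition mx_of (A : unitary) : mat := val A.
Lemma mx_ofP A : unitaryJ (mx_of A). Proof. by case: A => A uA; exact/asboolP. Qed.
Lemma mx_of_inj : injective mx_of. Proof. exact: val_inj. Qed.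

Definition unitary_of (A : mat) (uA : unitaryJ A) : unitary :=
  exist _ A (asboolT uA).

Definition unitary_one := unitary_of unitaryJ1.
Definition unitary_mul (A B : unitary) := unitary_of (unitaryJM (mx_ofP A) (mx_ofP B)).
Definition unitary_inv (A : unitary) := unitary_of (unitaryJV (mx_ofP A)).

Fact unitary_mulA : associative unitary_mul.
Proof. by move=> A B C; apply: mx_of_inj; rewrite /mx_of/= mulmxA. Qed.
Fact unitary_mul1 : left_id unitary_one unitary_mul.
Proof. by move=> A; apply: mx_of_inj; rewrite /mx_of/= mul1mx. Qed.
Fact unitary_mulr1 : right_id unitary_one unitary_mul.
Proof. by move=> A; apply: mx_of_inj; rewrite /mx_of/= mulmx1. Qed.
Fact unitary_mulV : left_inverse unitary_one unitary_inv unitary_mul.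
Proof.
by move=> A; apply: mx_of_inj; rewrite /mx_of/= unitaryJ_mulV//; exact: mx_ofP.
Qed.
Fact unitary_mulrV : right_inverse unitary_one unitary_inv unitary_mul.
Proof.
by move=> A; apply: mx_of_inj; rewrite /mx_of/= unitaryJ_mulrV//; exact: mx_ofP.
Qed.

HB.instance Definition _ := isGroup.Build unitary unitary_mulA unitary_mul1
  unitary_mulr1 unitary_mulV unitary_mulrV.

(* [k^(n+2)] is a right vector space over [k], so the matrices that act
   trivially on its projective space are the scalar matrices with a central
   entry. *)
Definition central (c : k) : Prop := forall x : k, c * x = x * c.

Definition proportional (A B : unitary) : bool :=
  `[< exists c : k, [/\ c != 0, central c & mx_of B = c *: mx_of A] >].

Fact proportional_refl : reflexive proportional.
Proof.
move=> A; apply/asboolP; exists 1; split; [exact: oner_neq0| |by rewrite scale1r].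
by move=> x; rewrite mul1r mulr1.
Qed.

Lemma centralV (c : k) : c != 0 -> central c -> central c^-1.
Proof.
rewrite -scal_unitE => uc cc x; apply: (mulrI uc).
by rewrite mulrA divrr// mul1r mulrA cc -mulrA divrr// mulr1.
Qed.

Fact proportional_symS A B : proportional A B -> proportional B A.
Proof.
move=> /asboolP[c [c0 cc E]]; apply/asboolP; exists c^-1; split.
- by rewrite invr_eq0.
- exact: centralV.
- by rewrite E scalerA mulVr ?scale1r// scal_unitE.
Qed.

Fact proportional_sym : symmetric proportional.
Proof. by move=> A B; apply/idP/idP; exact: proportional_symS. Qed.

Fact proportional_trans : transitive proportional.
Proof.
move=> B A C /asboolP[c [c0 cc E]] /asboolP[d [d0 dc F]]; apply/asboolP.
exists (d * c); split; last by rewrite F E scalerA.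
- by rewrite -scal_unitE unitrMr scal_unitE.
- by move=> x; rewrite -mulrA cc mulrA dc mulrA.
Qed.

Canonical proportional_equiv :=
  EquivRel proportional proportional_refl proportional_sym proportional_trans.

Definition PU : Type := {eq_quot proportional}%qT.
HB.instance Definition _ := Choice.on PU.
HB.instance Definition _ := EqQuotient.on PU.

Definition proj (A : unitary) : PU := (\pi_PU A)%qT.

Lemma projP A B : proj A = proj B <-> proportional A B.
Proof. by split => [/eqmodP//|/eqmodP]. Qed.

Definition PU_one : PU := proj 1%g.
Definition PU_mul (g h : PU) : PU := proj (repr g * repr h)%g.
Definition PU_inv (g : PU) : PU := proj (repr g)^-1%g.

Lemma proj_repr (g : PU) : proj (repr g) = g. Proof. exact: reprK. Qed.

Lemma proportionalM A A' B B' :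
  proportional A A' -> proportional B B' -> proportional (A * B)%g (A' * B')%g.
Proof.
move=> /asboolP[c [c0 cc E]] /asboolP[d [d0 dc F]]; apply/asboolP.
exists (c * d); split.
- by rewrite -scal_unitE unitrMr scal_unitE.
- by move=> x; rewrite -mulrA dc mulrA cc mulrA.
rewrite {1}/mx_of /= E F -scalerA -scalemxAl; congr (_ *: _).
apply/matrixP => i j; rewrite !mxE mulr_sumr; apply: eq_bigr => l _.
by rewrite !mxE !mulrA dc.
Qed.

Lemma proj_mul A B : PU_mul (proj A) (proj B) = proj (A * B)%g.
Proof. by apply/projP; apply: proportionalM; apply/projP; exact: proj_repr. Qed.

Lemma proportionalV A A' : proportional A A' -> proportional A^-1%g A'^-1%g.
Proof.
move=> AA'; apply: proportional_symS.
have := proportionalM (proportional_refl A^-1%g)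
  (proportionalM AA' (proportional_refl A'^-1%g)).
by rewrite mulgV mulg1 mulgA mulVg mul1g.
Qed.

Lemma proj_inv A : PU_inv (proj A) = proj A^-1%g.
Proof. by apply/projP; apply: proportionalV; apply/projP; exact: proj_repr. Qed.

Fact PU_mulA : associative PU_mul.
Proof.
by move=> f g h; rewrite -(proj_repr f) -(proj_repr g) -(proj_repr h) !proj_mul mulgA.
Qed.
Fact PU_mul1 : left_id PU_one PU_mul.
Proof. by move=> g; rewrite -(proj_repr g) proj_mul mul1g. Qed.
Fact PU_mulr1 : right_id PU_one PU_mul.
Proof. by move=> g; rewrite -(proj_repr g) proj_mul mulg1. Qed.
Fact PU_mulV : left_inverse PU_one PU_inv PU_mul.
Proof. by move=> g; rewrite -(proj_repr g) proj_inv proj_mul mulVg. Qed.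
Fact PU_mulrV : right_inverse PU_one PU_inv PU_mul.
Proof. by move=> g; rewrite -(proj_repr g) proj_inv proj_mul mulgV. Qed.

HB.instance Definition _ :=
  isGroup.Build PU PU_mulA PU_mul1 PU_mulr1 PU_mulV PU_mulrV.

Definition subgroup (H : set PU) : Prop :=
  H 1%g /\ forall g h, H g -> H h -> H (g * h^-1)%g.

(* The quotient map from the unitary group is open, so [H] is discrete in the
   quotient topology if and only if the image of some neighbourhood of the
   identity matrix meets [H] in the identity only. *)
Definition discrete (H : set PU) : Prop :=
  exists2 e : R, 0 < e & forall A : unitary,
    (forall i j, knorm (mx_of A i j - (1%:M : mat) i j) < e) ->
    H (proj A) -> proj A = 1%g.

End UnitaryGroup.
Arguments PU R s n : clear implicits.
Arguments subgroup {R s n} H.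
Arguments discrete {R s n} H.

Section Iwasawa.
Variables (R : realType) (s : scalars) (n : nat).
Local Notation k := (scal R s).
Local Notation G := (PU R s n).
Local Notation pt := ('cV[k]_n * k)%type.
Implicit Types (p q : pt) (g : G).

Definition sesqui (z z' : 'cV[k]_n) : k := \sum_i kconj (z i 0) * z' i 0.

Definition vsqnorm (z : 'cV[k]_n) : R := \sum_i knorm (z i 0) ^+ 2.

Definition hmul p q : pt := (p.1 + q.1, p.2 + q.2 + kim (sesqui p.1 q.1) *+ 2).

Definition gauge p : R :=
  Num.sqrt (knorm (kreal s (vsqnorm p.1 + `|kre p.2|) + kim p.2)).

Definition dist p q : R := gauge (hmul (- p) q).

Definition halfspace : set pt := [set p | 0 < kre p.2].
(* The space X, as the subset of [k^n * k] where it is the boundary of the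
   half-space. *)
Definition boundary : set pt := [set p | kre p.2 = 0].

(* [None] is the point at infinity. *)
Definition phi (p : option pt) : 'cV[k]_(1 + n + 1) :=
  match p with
  | Some (z, w) =>
      col_mx (col_mx 1%:M (\col_i (kreal s (Num.sqrt 2) * z i 0)))
             (w + kreal s (vsqnorm z))%:M
  | None => col_mx 0 1%:M
  end.

(* The point represented by the right line spanned by [v], see [phiK]. *)
Definition dehom (v : 'cV[k]_(1 + n + 1)) : option pt :=
  let v0 := usubmx (usubmx v) 0 0 in
  let z := \col_i (kreal s (Num.sqrt 2)^-1 * (dsubmx (usubmx v) i 0 / v0)) in
  if v0 == 0 then None
  else Some (z, dsubmx v 0 0 / v0 - kreal s (vsqnorm z)).

Definition rscale (v : 'cV[k]_(1 + n + 1)) (c : k) : 'cV[k]_(1 + n + 1) :=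
  \col_i (v i 0 * c).

Definition act g (p : option pt) : option pt := dehom (mx_of (repr g) *m phi p).

Definition finpt (p : option pt) : pt := odflt 0 p.

Definition act_image g (A : set pt) : set pt :=
  [set q | exists2 p, A p & act g (Some p) = Some q].

(* Coordinate 0 is the real part, which vanishes on the boundary. *)
Definition box (a b : pt) : set pt := [set p | boundary p /\
  (forall (i : 'I_n) (l : 'I_(kdim s)),
     (kcoords (a.1 i 0))`_l <= (kcoords (p.1 i 0))`_l <= (kcoords (b.1 i 0))`_l) /\
  (forall l : 'I_(kdim s), (0 < l)%N ->
     (kcoords a.2)`_l <= (kcoords p.2)`_l <= (kcoords b.2)`_l)].

Definition box_volume (a b : pt) : R :=
  (\prod_(i < n) \prod_(l < kdim s)
     Num.max 0 ((kcoords (b.1 i 0))`_l - (kcoords (a.1 i 0))`_l)) *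
  \prod_(l < kdim s | (0 < l)%N)
     Num.max 0 ((kcoords b.2)`_l - (kcoords a.2)`_l).

(* Lebesgue outer measure of the subsets of the boundary; a set that is not
   contained in the boundary has no cover by boxes, hence measure +oo. *)
Definition leb (A : set pt) : \bar R := ereal_inf
  [set m | exists a b : nat -> pt, A `<=` \bigcup_i box (a i) (b i) /\
     m = (\sum_(i <oo) (box_volume (a i) (b i))%:E)%E].

Definition lmeasurable (A : set pt) : Prop :=
  A `<=` boundary /\ leb.-caratheodory A.

Definition is_inversion (iota : G) : Prop :=
  [/\ act iota (Some 0) = None, act iota None = Some 0 &
  forall h, (halfspace `|` boundary) h -> h != 0 ->
    exists2 q, act iota (Some h) = Some q &
    gauge q = (gauge h)^-1 /\
    forall h', boundary h' -> h' != 0 ->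
      exists2 q', act iota (Some h') = Some q' &
      dist q q' = dist h h' / (gauge h * gauge h')].

Definition isom : set G := [set g | act g None = None /\
  forall p q, boundary p -> boundary q ->
    dist (finpt (act g (Some p))) (finpt (act g (Some q))) = dist p q].

Definition fundamental_domain (Z : set G) (K : set pt) : Prop :=
  [/\ lmeasurable K, boundary = \bigcup_(a in Z) act_image a K &
  leb (K `&` \bigcup_(a in Z `\ 1%g) act_image a K) = 0%E].

Definition lattice (Z : set G) : Prop :=
  [/\ subgroup Z, Z `<=` isom, discrete Z &
  exists2 F, fundamental_domain Z F & (leb F < +oo)%E].

Record iwasawa_cf := IwasawaCF {
  cf_inv : G;
  cf_lattice : set G;
  cf_domain : set pt;
  cf_round : pt -> G;
  cf_invP : is_inversion cf_inv;
  cf_latticeP : lattice cf_lattice;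
  cf_domainP : fundamental_domain cf_lattice cf_domain;
  cf_roundP : forall y, boundary y -> cf_lattice (cf_round y) /\
    exists2 x, cf_domain x & act (cf_round y)^-1%g (Some y) = Some x }.

Section Algorithm.
Variable C : iwasawa_cf.
Local Notation iota := (cf_inv C).
Local Notation Z := (cf_lattice C).
Local Notation K := (cf_domain C).

Definition modular_group : set G := smallest subgroup ([set iota] `|` Z).

(* Only the restriction to [K] is meaningful. *)
Definition cf_digit (x : pt) : G := cf_round C (finpt (act iota (Some x))).

Definition cf_shift (x : pt) : pt :=
  if x == 0 then 0
  else finpt (act (cf_digit x)^-1%g (act iota (Some x))).

(* [cf_mx x i] is M_i, meaningful as long as the expansion of [x] has not
   stopped before step [i]. *)
Fixpoint cf_mx (x : pt) (i : nat) : G :=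
  match i with
  | 0 => 1%g
  | j.+1 => (cf_mx x j * iota^-1 * cf_digit (iter j cf_shift x))%g
  end.

Definition cf_convergent (x : pt) (i : nat) : option pt :=
  act (cf_mx x i) (Some 0).

Definition cf_finite (x : pt) : Prop := exists i, iter i cf_shift x = 0.

Definition cf_converges (x : pt) : Prop := cf_finite x \/
  forall e : R, 0 < e -> \forall i \near \oo,
    exists2 q, cf_convergent x i = Some q & dist q x < e.

Definition cf_discrete : Prop := discrete modular_group.

Definition cf_proper : Prop :=
  (ereal_sup [set (gauge x)%:E | x in K] < 1%:E)%E.

Definition cf_complete : Prop :=
  modular_group `&` [set g | act g None = None] = Z.

Definition cf_is_convergent : Prop :=
  leb (K `&` [set x | ~ cf_converges x]) = 0%E.

Definition cf_ergodic : Prop :=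
  forall B, B `<=` K -> lmeasurable B ->
    leb ((K `&` cf_shift @^-1` B) `+` B) = 0%E ->
    leb B = 0%E \/ leb (K `\` B) = 0%E.

End Algorithm.

Lemma kreal_central (r : R) (x : k) : kreal s r * x = x * kreal s r.
Proof.
case: s x => [x|[a b]|[a b c d]] /=; first exact: mulrC.
- by congr Complex; ring.
- by congr Quaternion => /=; ring.
Qed.

Lemma krealM (r r' : R) : kreal s (r * r') = kreal s r * kreal s r'.
Proof.
case: s => //=; first by congr Complex; ring.
by congr Quaternion => /=; ring.
Qed.

Lemma kreal1 : kreal s 1 = 1 :> k.
Proof. by case: s. Qed.

Lemma phiK (p : pt) (c : k) : c != 0 -> dehom (rscale (phi (Some p)) c) = Some p.
Proof.
case: p => z w c0; rewrite /dehom.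
have sq2 : kreal s (Num.sqrt 2)^-1 * kreal s (Num.sqrt 2) = 1 :> k.
  by rewrite -krealM mulVf ?kreal1// sqrtr_eq0 -ltNge ltr0n.
have -> : usubmx (usubmx (rscale (phi (Some (z, w))) c)) 0 0 = c.
  by rewrite 3!mxE /= !col_mxEu mxE eqxx mul1r.
have -> : dsubmx (rscale (phi (Some (z, w))) c) 0 0 =
    (w + kreal s (vsqnorm z)) * c.
  by rewrite 2!mxE /= col_mxEd mxE eqxx mulr1n.
rewrite (negbTE c0).
set z' := \col_i _; have -> : z' = z.
  apply/matrixP => i j; rewrite 4!mxE (ord1 j) /= col_mxEu col_mxEd mxE.
  by rewrite -!mulrA divrr ?scal_unitE// mulr1 mulrA sq2 mul1r.
by rewrite mulrK ?scal_unitE// addrK.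
Qed.

Lemma dehomZ (c : k) v : c != 0 -> central c -> dehom (c *: v) = dehom v.
Proof.
move=> c0 cc; rewrite /dehom.
have -> : usubmx (usubmx (c *: v)) 0 0 = c * usubmx (usubmx v) 0 0.
  by rewrite !mxE.
set v0 := usubmx (usubmx v) 0 0.
have [->|v0N] := eqVneq v0 0; first by rewrite mulr0 eqxx.
have cv0 : c * v0 != 0 by rewrite -scal_unitE unitrMr scal_unitE.
have E x : c * x / (c * v0) = x / v0.
  by rewrite invrM ?scal_unitE// mulrA -(mulrA c) cc mulrK ?scal_unitE.
rewrite (negbTE cv0).
have Ez : \col_i (kreal s (Num.sqrt 2)^-1 *
      (dsubmx (usubmx (c *: v)) i 0 / (c * v0))) =
    \col_i (kreal s (Num.sqrt 2)^-1 * (dsubmx (usubmx v) i 0 / v0)).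
  by apply/matrixP => i j; rewrite !mxE E.
by rewrite Ez [dsubmx (c *: v) 0 0]mxE [(c *: v) _ _]mxE E [in RHS]mxE.
Qed.

Lemma act_proj (A : unitary R s n) (p : option pt) :
  act (proj A) p = dehom (mx_of A *m phi p).
Proof.
rewrite /act; have /projP := proj_repr (proj A).
move=> /proportional_symS/asboolP[c [c0 cc ->]].
by rewrite -scalemxAl dehomZ.
Qed.

End Iwasawa.

(* Main.v *)
(* The pairing [nn p q = |<phi p, phi q>|] equals [dist p q ^ 2] at finite
   boundary points, is 1 if exactly one of the points is infinity, and is
   covariant under the group with the multiplicative cocycle [jac]. For a cusp
   [g oo] of the modular group, [jac g None] is thus the denominator of the
   cusp. By discreteness the denominators are bounded below: otherwise
   conjugating a suitable element of the infinite lattice would produce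
   elements arbitrarily close to the identity. As
   [dist x (M_i oo) ^ 2 * jac M_i oo] is the square of [|x_0| ... |x_(i-1)|],
   which is at most [rad(K) ^ i], the convergents converge at every point.

   For ergodicity, the recursion [hn_cf_step] yields Diophantine estimates:
   cusps that are close to [x] relative to their denominators are convergents
   of [x] (Legendre), and [dist x (M_i oo) * jac M_i oo] is bounded (Dirichlet),
   which makes badly approximable points a null set. Hence outside a null set
   and by completeness, points of [K] in the same orbit of the modular group
   have the same tail (Serret), so that membership in an invariant set [B]
   depends on the orbit only. If [B] is not null, the branches of the iterates
   of the shift at a density point of [B] have bounded distortion on a ball of
   fixed radius, and a pigeonhole argument gives a ball in which the orbit of
   [K \ B] is null. That ball contains a cusp, so it contains the image of a
   translate of [K] by an element of the modular group, and [K \ B] is null. *)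

From HB Require Import structures.
From mathcomp Require Import all_boot all_order all_algebra.
From mathcomp Require Import ring lra complex.
From mathcomp Require Import all_classical all_reals all_analysis measurable_realfun.
Require Import Defs.

Set Implicit Arguments.
Unset Strict Implicit.
Unset Printing Implicit Defensive.

Import Order.TTheory GRing.Theory Num.Theory.
Import numFieldNormedType.Exports.

Local Open Scope classical_set_scope.
Local Open Scope ring_scope.

(** * Norm and metric *)

Section ScalarNorm.
Variables (R : realType) (s : scalars).
Local Notation k := (scal R s).
Implicit Types (x y : k) (r : R).

(** Scalars may fail to commute, so vectors are scaled on the right and the action is measured by
    norms of scalars; [nn] and [jac] are real-valued, and the dynamics is governed by real
    inequalities between them. The obstacle to a lower bound for denominators is rotation:
    conjugation by an element with a small denominator shrinks the translation part of a lattice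
    element but only conjugates its rotation. The element to be conjugated is therefore a quotient
    of two lattice elements with nearly equal rotations, and an infinite lattice provides a
    nontrivial one. No invariant measure is at hand, so ergodicity rests on orbits of the modular
    group. As the group is countable, a null set can be enlarged to a null union of orbits; this is
    how invariance of [B] up to a null set becomes exact off such a union. Compactness enters as
    finite colourings. One Vitali covering lemma for the Cygan metric yields a porosity criterion
    and Lipschitz bounds for the measure; porosity gives both density points and nullity of the
    badly approximable points. *)

Lemma kcoordsD x y l :
  (kcoords (x + y))`_l = (kcoords x)`_l + (kcoords y)`_l.
Proof.
by case: s x y => [x y|[a b] [c d]|[a b c d] [e f g h]];
  case: l => [|[|[|[|l]]]] //=; rewrite ?nth_nil ?addr0.
Qed.

Lemma kcoordsN x l : (kcoords (- x))`_l = - (kcoords x)`_l.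
Proof.
by case: s x => [x|[a b]|[a b c d]]; case: l => [|[|[|[|l]]]] //=;
  rewrite ?nth_nil ?oppr0.
Qed.

Lemma kcoords0 l : (kcoords (0 : k))`_l = 0.
Proof. by case: s => [||]; case: l => [|[|[|[|l]]]] //=; rewrite ?nth_nil. Qed.

Lemma kcoordsB x y l :
  (kcoords (x - y))`_l = (kcoords x)`_l - (kcoords y)`_l.
Proof. by rewrite kcoordsD kcoordsN. Qed.

Lemma size_kcoords x : size (kcoords x) = kdim s.
Proof. by case: s x. Qed.

Lemma kcoords_inj : injective (@kcoords R s).
Proof. by case: s => [x y [] //|[a b] [c d] [-> ->]|[a b c d] [e f g h] [-> -> -> ->]]. Qed.

Lemma kcoordsP x y :
  (forall l : 'I_(kdim s), (kcoords x)`_l = (kcoords y)`_l) -> x = y.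
Proof.
move=> H; apply: kcoords_inj; apply: (@eq_from_nth _ 0).
  by rewrite !size_kcoords.
by move=> l; rewrite size_kcoords => hl; exact: (H (Ordinal hl)).
Qed.

Lemma kreD x y : kre (x + y) = kre x + kre y. Proof. exact: kcoordsD. Qed.
Lemma kreN x : kre (- x) = - kre x. Proof. exact: kcoordsN. Qed.
Lemma kre0 : kre (0 : k) = 0. Proof. exact: kcoords0. Qed.
Lemma kreB x y : kre (x - y) = kre x - kre y. Proof. exact: kcoordsB. Qed.

Lemma kre_kreal r : kre (kreal s r) = r. Proof. by case: s. Qed.

Lemma krealD r r' : kreal s (r + r') = kreal s r + kreal s r'.
Proof. by case: s => //=; [congr Complex|congr Quaternion]; rewrite /= ?addr0. Qed.

Lemma kreal0 : kreal s 0 = 0 :> k. Proof. by case: s. Qed.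

Lemma krealN r : kreal s (- r) = - kreal s r.
Proof. by apply: (addIr (kreal s r)); rewrite -krealD !addNr kreal0. Qed.

Lemma kconj_kreal r : kconj (kreal s r) = kreal s r.
Proof. by case: s => //=; [congr Complex|congr Quaternion]; rewrite /= ?oppr0. Qed.

Lemma kre_conj x : kre (kconj x) = kre x.
Proof. by case: s x => [//|[]|[]]. Qed.

Lemma kreM_comm x y : kre (x * y) = kre (y * x).
Proof.
case: s x y => [x y|[a b] [c d]|[a b c d] [e f g h]]; rewrite /kre /=.
- by rewrite mulrC.
- by ring.
- by ring.
Qed.

Lemma kim_conj x : kconj x = x - kim x *+ 2.
Proof.
case: s x => [x|[a b]|[a b c d]]; rewrite /kim /kre /=.
- by rewrite subrr mul0rn subr0.
- by congr Complex => /=; rewrite ?mulr2n /=; ring.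
- by congr Quaternion => /=; rewrite ?mulr2n /=; ring.
Qed.

Lemma kre_kim x : kre (kim x) = 0.
Proof. by rewrite /kim kreB kre_kreal subrr. Qed.

Lemma kre_kimE x : x = kreal s (kre x) + kim x.
Proof. by rewrite /kim addrC subrK. Qed.

Lemma kimE x : kre x = 0 -> kim x = x.
Proof. by rewrite /kim => ->; rewrite kreal0 subr0. Qed.

Lemma kimN x : kim (- x) = - kim x.
Proof. by rewrite /kim kreN krealN opprD. Qed.

Lemma kimD x y : kim (x + y) = kim x + kim y.
Proof. by rewrite /kim kreD krealD opprD addrACA. Qed.

Lemma kconj_im x : kre x = 0 -> kconj x = - x.
Proof. by move=> h; rewrite kim_conj kimE// mulr2n opprD addrA subrr sub0r. Qed.

Lemma ksq_coords x : kre (kconj x * x) = \sum_(l < kdim s) (kcoords x)`_l ^+ 2.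
Proof.
case: s x => [x|[a b]|[a b c d]]; rewrite /kre /= !big_ord_recr big_ord0 /=.
- by ring.
- by ring.
- by ring.
Qed.

Lemma ksq_ge0 x : 0 <= kre (kconj x * x).
Proof. by rewrite ksq_coords sumr_ge0// => l _; exact: sqr_ge0. Qed.

Lemma knorm_sqr x : knorm x ^+ 2 = kre (kconj x * x).
Proof. by rewrite sqr_sqrtr// ksq_ge0. Qed.

Lemma knorm_coords x : knorm x ^+ 2 = \sum_(l < kdim s) (kcoords x)`_l ^+ 2.
Proof. by rewrite knorm_sqr ksq_coords. Qed.

Lemma kconj_mul x : kconj x * x = kreal s (knorm x ^+ 2).
Proof.
rewrite knorm_sqr.
case: s x => [x|[a b]|[a b c d]]; rewrite /kre //=.
- by congr Complex; rewrite /=; ring.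
- by congr Quaternion; rewrite /=; ring.
Qed.

Lemma knorm_ge0 x : 0 <= knorm x. Proof. exact: sqrtr_ge0. Qed.

Lemma knormM x y : knorm (x * y) = knorm x * knorm y.
Proof.
rewrite -[RHS]ger0_norm ?mulr_ge0 ?knorm_ge0// -sqrtr_sqr; congr Num.sqrt.
rewrite exprMn (knorm_sqr y) kconjM mulrA -(mulrA (kconj y)) kconj_mul.
rewrite -kreal_central -mulrA [in LHS]kconj_mul -krealM kre_kreal.
by rewrite (knorm_sqr y).
Qed.

Lemma knormN x : knorm (- x) = knorm x.
Proof. by rewrite /knorm kconjN mulrNN. Qed.

Lemma knorm_conj x : knorm (kconj x) = knorm x.
Proof. by rewrite /knorm kconjK kreM_comm. Qed.

Lemma knorm_kreal r : knorm (kreal s r) = `|r|.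
Proof. by rewrite /knorm kconj_kreal -krealM kre_kreal -expr2 sqrtr_sqr. Qed.

Lemma knorm1 : knorm (1 : k) = 1. Proof. by rewrite -kreal1 knorm_kreal normr1. Qed.
Lemma knorm0 : knorm (0 : k) = 0. Proof. by rewrite -kreal0 knorm_kreal normr0. Qed.

Lemma knorm_coord x l : `|(kcoords x)`_l| <= knorm x.
Proof.
rewrite -ler_sqr ?nnegrE ?normr_ge0 ?knorm_ge0// real_normK ?num_real//.
have [hl|hl] := ltnP l (kdim s); last first.
  by rewrite nth_default ?size_kcoords// expr0n sqr_ge0.
rewrite knorm_coords (bigD1 (Ordinal hl))//= lerDl sumr_ge0// => i _.
exact: sqr_ge0.
Qed.

(** The factor 2 is the square root of the largest dimension, 4, of the scalars. *)
Lemma knorm_le_coords x B :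
  (forall l : 'I_(kdim s), `|(kcoords x)`_l| <= B) -> knorm x <= 2 * B.
Proof.
move=> H; have B0 : 0 <= B.
  suff j : 'I_(kdim s) by exact: le_trans (H j).
  by case: (s) => /=; exists 0%N.
rewrite -ler_sqr ?nnegrE ?knorm_ge0 ?mulr_ge0// knorm_coords.
apply: (@le_trans _ _ (\sum_(l < kdim s) B ^+ 2)).
  apply: ler_sum => l _; rewrite -[leLHS]real_normK ?num_real//.
  by rewrite ler_sqr ?nnegrE ?normr_ge0.
rewrite sumr_const card_ord exprMn -[X in X <= _]mulr_natl ler_wpM2r ?sqr_ge0//.
by rewrite -natrX ler_nat; case: (s).
Qed.

Lemma knorm_eq0 x : (knorm x == 0) = (x == 0).
Proof.
apply/eqP/eqP => [h|->]; last exact: knorm0.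
apply: kcoordsP => l; rewrite kcoords0; apply/eqP; rewrite -normr_le0.
by have := knorm_coord x l; rewrite h.
Qed.

Lemma knorm_gt0 x : (0 < knorm x) = (x != 0).
Proof. by rewrite lt_def knorm_eq0 knorm_ge0 andbT. Qed.

(** Cauchy-Schwarz comes from multiplicativity: [kre (kconj x * y)] is a coordinate of a product of
    norm [knorm x * knorm y]. *)
Lemma ler_knormD x y : knorm (x + y) <= knorm x + knorm y.
Proof.
rewrite -ler_sqr ?nnegrE ?addr_ge0 ?knorm_ge0//.
rewrite knorm_sqr kconjD mulrDl !mulrDr !kreD -!knorm_sqr.
have -> : kre (kconj y * x) = kre (kconj x * y).
  by rewrite -kre_conj kconjM kconjK.
have : kre (kconj x * y) <= knorm x * knorm y.
  rewrite -(knorm_conj x) -knormM.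
  exact: le_trans (ler_norm _) (knorm_coord _ 0).
rewrite !expr2; lra.
Qed.

Lemma ler_knormB x y : knorm (x - y) <= knorm x + knorm y.
Proof. by rewrite -(knormN y) ler_knormD. Qed.

Lemma ler_knorm_sum I (r : seq I) (P : pred I) (F : I -> k) :
  knorm (\sum_(i <- r | P i) F i) <= \sum_(i <- r | P i) knorm (F i).
Proof.
elim/big_ind2: _ => [|x a y b xa yb|//]; first by rewrite knorm0.
exact: le_trans (ler_knormD _ _) (lerD xa yb).
Qed.

Lemma kunit x : x != 0 -> x \is a GRing.unit. Proof. by rewrite scal_unitE. Qed.

End ScalarNorm.

(** * The Heisenberg group law and the Cygan metric *)

Section Heisenberg.
Variables (R : realType) (s : scalars) (n : nat).
Local Notation k := (scal R s).
Local Notation pt := ('cV[k]_n * k)%type.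
Implicit Types (p q : pt) (z : 'cV[k]_n).

Lemma sesquiDl z1 z2 z : sesqui (z1 + z2) z = sesqui z1 z + sesqui z2 z.
Proof.
by rewrite /sesqui -big_split; apply: eq_bigr => i _; rewrite mxE kconjD mulrDl.
Qed.

Lemma sesquiDr z1 z2 z : sesqui z (z1 + z2) = sesqui z z1 + sesqui z z2.
Proof.
by rewrite /sesqui -big_split; apply: eq_bigr => i _; rewrite mxE mulrDr.
Qed.

Lemma sesquiNl z z' : sesqui (- z) z' = - sesqui z z'.
Proof.
by rewrite /sesqui -sumrN; apply: eq_bigr => i _; rewrite mxE kconjN mulNr.
Qed.

Lemma sesquiNr z z' : sesqui z (- z') = - sesqui z z'.
Proof. by rewrite /sesqui -sumrN; apply: eq_bigr => i _; rewrite mxE mulrN. Qed.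
Lemma sesqui_conj z z' : kconj (sesqui z z') = sesqui z' z.
Proof.
by rewrite /sesqui kconj_sum; apply: eq_bigr => i _; rewrite kconjM kconjK.
Qed.

Lemma kreal_sum I (r : seq I) (P : pred I) (F : I -> R) :
  kreal s (\sum_(i <- r | P i) F i) = \sum_(i <- r | P i) kreal s (F i).
Proof. exact: (big_morph (kreal s) (krealD s) (kreal0 R s)). Qed.

Lemma sesqui_vsqnorm z : sesqui z z = kreal s (vsqnorm z).
Proof.
by rewrite /sesqui /vsqnorm kreal_sum; apply: eq_bigr => i _; rewrite kconj_mul.
Qed.

Lemma vsqnorm_ge0 z : 0 <= vsqnorm z.
Proof. by apply: sumr_ge0 => i _; exact: sqr_ge0. Qed.

Lemma vsqnorm_eq0 z : (vsqnorm z == 0) = (z == 0).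
Proof.
apply/eqP/eqP => [|->]; last first.
  by rewrite /vsqnorm big1// => i _; rewrite mxE knorm0 expr0n.
move/psumr_eq0P => H; apply/matrixP => i j; rewrite (ord1 j) mxE.
have /eqP := H (fun i _ => sqr_ge0 _) i isT.
by rewrite sqrf_eq0 knorm_eq0 => /eqP.
Qed.

Lemma vsqnorm0 : vsqnorm (0 : 'cV[k]_n) = 0.
Proof. by apply/eqP; rewrite vsqnorm_eq0. Qed.

Lemma vsqnormN z : vsqnorm (- z) = vsqnorm z.
Proof. by apply: eq_bigr => i _; rewrite mxE knormN. Qed.

(** Lagrange's identity: the defect is half the sum of the squares of all 2 by 2 minors. *)
Lemma sum_cauchy_schwarz (F H : 'I_n -> R) :
  (\sum_i F i * H i) ^+ 2 <= (\sum_i F i ^+ 2) * (\sum_i H i ^+ 2).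
Proof.
have E : (\sum_i F i ^+ 2) * (\sum_i H i ^+ 2) - (\sum_i F i * H i) ^+ 2 =
    2^-1 * \sum_i \sum_j (F i * H j - F j * H i) ^+ 2.
  have -> : \sum_i \sum_j (F i * H j - F j * H i) ^+ 2 =
      \sum_i \sum_j (F i ^+ 2 * H j ^+ 2) + \sum_i \sum_j (F j ^+ 2 * H i ^+ 2)
      - 2 * \sum_i \sum_j (F i * H i) * (F j * H j).
    rewrite -big_split/= mulr_sumr -sumrB; apply: eq_bigr => i _.
    rewrite -big_split/= mulr_sumr -sumrB; apply: eq_bigr => j _; ring.
  rewrite [X in _ + X - _]exchange_big/= expr2 !big_distrlr/=.
  by field.
by rewrite -subr_ge0 E mulr_ge0 ?invr_ge0// sumr_ge0// => i _;
   rewrite sumr_ge0// => j _; exact: sqr_ge0.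
Qed.

Lemma sesqui_le z z' :
  knorm (sesqui z z') <= Num.sqrt (vsqnorm z) * Num.sqrt (vsqnorm z').
Proof.
apply: le_trans (ler_knorm_sum _ _ _) _.
rewrite -ler_sqr ?nnegrE ?mulr_ge0 ?sqrtr_ge0 ?sumr_ge0//; last first.
  by move=> i _; exact: knorm_ge0.
rewrite exprMn !sqr_sqrtr ?vsqnorm_ge0//.
under eq_bigr do rewrite knormM knorm_conj.
exact: sum_cauchy_schwarz.
Qed.

Lemma vsqnormD z z' :
  vsqnorm (z + z') = vsqnorm z + vsqnorm z' + kre (sesqui z z') *+ 2.
Proof.
rewrite -[LHS](kre_kreal s) -sesqui_vsqnorm sesquiDl !sesquiDr !kreD.
rewrite !sesqui_vsqnorm !kre_kreal -(sesqui_conj z) kre_conj mulr2n; ring.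
Qed.

Lemma hmulA : associative (@hmul R s n).
Proof.
move=> [z1 w1] [z2 w2] [z3 w3]; rewrite /hmul /=; congr (_, _).
  by rewrite addrA.
rewrite sesquiDl sesquiDr !kimD.
move: (kim (sesqui z1 z2)) (kim (sesqui z1 z3)) (kim (sesqui z2 z3)) => a b c.
rewrite !mulrnDl; move: (a *+ 2) (b *+ 2) (c *+ 2) => {}a {}b {}c.
rewrite -!addrA; do 2 congr (_ + _).
by rewrite [RHS]addrCA; congr (_ + _); rewrite [LHS]addrC -addrA.
Qed.

Lemma hmul0p p : hmul 0 p = p.
Proof.
case: p => z w; rewrite /hmul /= !add0r -(addNr z) sesquiDl sesquiNl addNr.
by rewrite kimE ?kre0// mul0rn addr0.
Qed.

Lemma kim_sesqui_self z : kim (sesqui z z) = 0.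
Proof. by rewrite sesqui_vsqnorm /kim kre_kreal subrr. Qed.

Lemma kim0 : kim (0 : k) = 0. Proof. by rewrite kimE ?kre0. Qed.

Lemma hmulNp p : hmul (- p) p = 0.
Proof.
case: p => z w; rewrite /hmul /= !addNr sesquiNl kimN kim_sesqui_self.
by rewrite oppr0 mul0rn addr0.
Qed.

Lemma hmulpN p : hmul p (- p) = 0.
Proof. by have := hmulNp (- p); rewrite opprK. Qed.

Lemma hmulKp p q : hmul (- p) (hmul p q) = q.
Proof. by rewrite hmulA hmulNp hmul0p. Qed.
Lemma hmulpK p q : hmul p (hmul (- p) q) = q.
Proof. by rewrite hmulA hmulpN hmul0p. Qed.

Lemma kim_sesquiC z z' : kim (sesqui z' z) = - kim (sesqui z z').
Proof.
rewrite -sesqui_conj kim_conj kimD kimN mulr2n kimD.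
by rewrite (kimE (kre_kim _)) opprD addrA subrr sub0r.
Qed.

Lemma hmulN p q : - hmul p q = hmul (- q) (- p).
Proof.
have E (a c : 'cV[k]_n) (b d : k) : a = c -> b = d -> (a, b) = (c, d).
  by move=> -> ->.
case: p q => [z w] [z' w']; apply: E => /=; first by rewrite opprD addrC.
rewrite sesquiNl sesquiNr opprK (kim_sesquiC z z') mulNrn.
move: (kim (sesqui z z')) => a.
by rewrite opprD [- (w + w')]opprD [- w - w']addrC.
Qed.

Lemma boundary_hmul p q : boundary p -> boundary q -> boundary (hmul p q).
Proof.
case: p q => z w [z' w']; rewrite /boundary /hmul /= => hw hw'.
rewrite (kreD (w + w')) (kreD w) hw hw' mulr2n kreD.
by rewrite kre_kim !addr0.
Qed.

Lemma boundaryN p : boundary p -> boundary (- p).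
Proof. by rewrite /boundary /= kreN => ->; rewrite oppr0. Qed.

Lemma boundary0 : boundary (0 : pt). Proof. exact: kre0. Qed.

Lemma gauge_boundary p : boundary p ->
  gauge p ^+ 2 = knorm (kreal s (vsqnorm p.1) + p.2).
Proof.
move=> hp; rewrite /gauge sqr_sqrtr ?knorm_ge0//.
by rewrite (hp : kre p.2 = 0) normr0 addr0 kimE.
Qed.

Lemma gauge_ge0 p : 0 <= gauge p. Proof. exact: sqrtr_ge0. Qed.

Lemma knorm_imD (r : R) (w : k) : kre w = 0 ->
  knorm (kreal s r + w) ^+ 2 = r ^+ 2 + knorm w ^+ 2.
Proof.
move=> h; rewrite !knorm_sqr kconjD kconj_kreal mulrDl !mulrDr !kreD.
rewrite (kconj_im h) -krealM kre_kreal !mulNr !kreN -kreal_central.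
by ring.
Qed.

Lemma gauge_boundary4 p : boundary p ->
  gauge p ^+ 4 = vsqnorm p.1 ^+ 2 + knorm p.2 ^+ 2.
Proof.
by move=> hp; rewrite -[4%N]/(2 * 2)%N exprM gauge_boundary// knorm_imD.
Qed.

Lemma vsqnorm_le_gauge p : boundary p -> Num.sqrt (vsqnorm p.1) <= gauge p.
Proof.
move=> hp; rewrite -ler_sqr ?nnegrE ?sqrtr_ge0//.
rewrite (sqr_sqrtr (vsqnorm_ge0 _)) -ler_sqr ?nnegrE ?sqr_ge0 ?vsqnorm_ge0//.
by rewrite -(exprM _ 2 2) gauge_boundary4// lerDl sqr_ge0.
Qed.

(** On the boundary the squared gauge is the norm of the scalar ‖z‖² + w. For a product, twice the
    real part of [sesqui] from the squared norm and twice its imaginary part from the group law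
    combine to twice [sesqui], which Cauchy-Schwarz bounds by the mixed term of the square. *)
Lemma gauge_hmul p q : boundary p -> boundary q ->
  gauge (hmul p q) <= gauge p + gauge q.
Proof.
move=> hp hq; rewrite -ler_sqr ?nnegrE ?addr_ge0 ?gauge_ge0//.
rewrite gauge_boundary; last exact: boundary_hmul.
have -> : kreal s (vsqnorm (hmul p q).1) + (hmul p q).2 =
    (kreal s (vsqnorm p.1) + p.2) + (kreal s (vsqnorm q.1) + q.2)
      + sesqui p.1 q.1 *+ 2.
  case: p q hp hq => [z w] [z' w'] _ _ /=; rewrite vsqnormD.
  have -> : kreal s (vsqnorm z + vsqnorm z' + kre (sesqui z z') *+ 2) =
      kreal s (vsqnorm z) + kreal s (vsqnorm z') + kreal s (kre (sesqui z z')) *+ 2.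
    by rewrite mulr2n !krealD -mulr2n.
  rewrite addrACA [X in X + _ = _]addrACA; congr (_ + _).
  by rewrite -mulrnDl -kre_kimE.
apply: le_trans (ler_knormD _ _) _.
have h2 : knorm (sesqui p.1 q.1 *+ 2) <= gauge p * gauge q *+ 2.
  rewrite mulr2n; apply: le_trans (ler_knormD _ _) _.
  rewrite -mulr2n lerMn2r /=; apply: le_trans (sesqui_le _ _) _.
  by apply: ler_pM; rewrite ?sqrtr_ge0 ?vsqnorm_le_gauge.
have := ler_knormD (kreal s (vsqnorm p.1) + p.2) (kreal s (vsqnorm q.1) + q.2).
rewrite -!gauge_boundary// => h1; rewrite sqrrD.
move: (gauge p ^+ 2) (gauge q ^+ 2) (gauge p * gauge q *+ 2) h1 h2 => A B D.
lra.
Qed.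

Lemma dist_ge0 p q : 0 <= dist p q. Proof. exact: gauge_ge0. Qed.

Lemma gaugeN p : boundary p -> gauge (- p) = gauge p.
Proof.
move=> hp; apply: (@pexpIrn _ 4) => //; rewrite ?nnegrE ?gauge_ge0//.
rewrite !gauge_boundary4//; last exact: boundaryN.
by rewrite /= vsqnormN knormN.
Qed.

Lemma dist0 p : dist 0 p = gauge p.
Proof. by rewrite /dist oppr0 hmul0p. Qed.

Lemma dist_triangle p q r : boundary p -> boundary q -> boundary r ->
  dist p r <= dist p q + dist q r.
Proof.
move=> hp hq hr; rewrite /dist.
have -> : hmul (- p) r = hmul (hmul (- p) q) (hmul (- q) r).
  by rewrite -hmulA hmulpK.
by apply: gauge_hmul; apply: boundary_hmul => //; exact: boundaryN.
Qed.

Lemma distC p q : boundary p -> boundary q -> dist p q = dist q p.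
Proof.
move=> hp hq; rewrite -[RHS]gaugeN; last first.
  by apply: boundary_hmul => //; exact: boundaryN.
by rewrite hmulN opprK.
Qed.

Lemma gauge_eq0 p : boundary p -> gauge p = 0 -> p = 0.
Proof.
move=> hp h; have := gauge_boundary4 hp; rewrite h expr0n /= => /esym/eqP.
rewrite paddr_eq0 ?sqr_ge0// !sqrf_eq0 vsqnorm_eq0 knorm_eq0.
by case: p {hp h} => z w /andP[/= /eqP-> /eqP->].
Qed.

End Heisenberg.

Lemma nn_aux (V : zmodType) (r i A B w w' : V) :
  - (r + i - (w' + B) - (- w + A)) = A + B - r + (- w + w' - i).
Proof. by rewrite !opprD !opprK (AC (2*2*2) ((6*4*1)*(5*3*2)))/=. Qed.

(** * The Hermitian form and the action *)

Section Form.
Variables (R : realType) (s : scalars) (n : nat).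
Local Notation k := (scal R s).
Local Notation pt := ('cV[k]_n * k)%type.
Local Notation vec := 'cV[k]_(1 + n + 1).
Local Notation mat := 'M[k]_(1 + n + 1).
Implicit Types (p q : option pt) (u v : vec) (z : 'cV[k]_n) (a c d : k).

Definition bd p : Prop := if p is Some p' then boundary p' else True.

Definition hform u v : k := (ctrmx u *m formJ R s n *m v) 0 0.

Definition hvec a z c : vec := col_mx (col_mx a%:M z) c%:M.

Lemma hvecE v : v = hvec (usubmx (usubmx v) 0 0) (dsubmx (usubmx v)) (dsubmx v 0 0).
Proof.
rewrite /hvec -[LHS]vsubmxK -[in LHS](vsubmxK (usubmx v)).
by congr (col_mx (col_mx _ _) _); apply/matrixP => i j;
  rewrite !ord1 !mxE eqxx mulr1n.
Qed.

Lemma hvec_rs a z c d :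
  hvec a z c *m d%:M = hvec (a * d) (z *m d%:M) (c * d).
Proof. by rewrite /hvec !mul_col_mx !scalar_mxM. Qed.

Lemma formJ_hvec a z c : formJ R s n *m hvec a z c = hvec (- c) z (- a).
Proof.
rewrite /formJ /hvec mul_block_col mul_block_col mul_row_col mul_col_mx.
rewrite !mul0mx !mul1mx !mulNmx !mul1mx !addr0 ?add0r add_col_mx add0r addr0.
by congr (col_mx (col_mx _ _) _); rewrite ?addr0; apply/matrixP => i j;
  rewrite !mxE; case: (_ == _); rewrite ?mulr1n ?mulr0n ?oppr0.
Qed.

Lemma hform_hvec a z c a' z' c' :
  hform (hvec a z c) (hvec a' z' c') =
  sesqui z z' - kconj a * c' - kconj c * a'.
Proof.
rewrite /hform -mulmxA formJ_hvec /hvec /ctrmx !tr_col_mx !map_row_mx.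
rewrite !mul_row_col !mxE !big_ord_recl !big_ord0 !mxE !eqxx !mulr1n !addr0.
rewrite !mulrN [X in X - _]addrC; congr (_ - _ - _).
by apply: eq_bigr => i _; rewrite !mxE.
Qed.

Lemma phi_fin (z : 'cV[k]_n) (w : k) :
  phi (Some (z, w)) = hvec 1 (\col_i (kreal s (Num.sqrt 2) * z i 0))
                            (w + kreal s (vsqnorm z)).
Proof. by []. Qed.

Lemma phi_None : phi None = hvec 0 0 1 :> vec.
Proof.
rewrite /phi /hvec; congr col_mx.
by rewrite -col_mx0; congr col_mx; apply/matrixP => i j; rewrite !mxE mul0rn.
Qed.

Lemma hformC u v : hform v u = kconj (hform u v).
Proof.
rewrite (hvecE u) (hvecE v) !hform_hvec.
move: (usubmx (usubmx u) 0 0) (dsubmx (usubmx u)) (dsubmx u 0 0) => a z c.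
move: (usubmx (usubmx v) 0 0) (dsubmx (usubmx v)) (dsubmx v 0 0) => a' z' c'.
by rewrite !kconjD !kconjN !kconjM !kconjK sesqui_conj addrAC.
Qed.

Lemma hformM A u v : unitaryJ A -> hform (A *m u) (A *m v) = hform u v.
Proof.
move=> [_ HA]; rewrite /hform ctrmxM.
have -> : ctrmx u *m ctrmx A *m formJ R s n *m (A *m v) =
    ctrmx u *m (ctrmx A *m formJ R s n *m A) *m v by rewrite !mulmxA.
by rewrite HA.
Qed.

Lemma hform_rsr u v c : hform u (v *m c%:M) = hform u v * c.
Proof.
rewrite /hform mulmxA mxE big_ord_recl big_ord0 addr0.
by congr (_ * _); rewrite mxE eqxx mulr1n.
Qed.

Lemma hform_rsl u v c : hform (u *m c%:M) v = kconj c * hform u v.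
Proof. by rewrite hformC hform_rsr kconjM -hformC. Qed.

Lemma kreal2M c : kreal s 2 * c = c *+ 2.
Proof. by rewrite (krealD s 1 1) kreal1 mulrDl !mul1r. Qed.

Lemma hform_phi (z z' : 'cV[k]_n) (w w' : k) :
  hform (phi (Some (z, w))) (phi (Some (z', w'))) =
  sesqui z z' *+ 2 - (w' + kreal s (vsqnorm z')) - (kconj w + kreal s (vsqnorm z)).
Proof.
rewrite !phi_fin hform_hvec kconj1 mul1r mulr1 kconjD kconj_kreal.
congr (_ - _ - _); rewrite /sesqui -sumrMnl; apply: eq_bigr => i _; rewrite !mxE.
rewrite kconjM kconj_kreal -mulrA (mulrA (kreal _ _)) -krealM -expr2.
by rewrite sqr_sqrtr ?ler0n// kreal2M mulrnAr.
Qed.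

Definition nn p q : R := knorm (hform (phi p) (phi q)).

Lemma nnC p q : nn p q = nn q p.
Proof. by rewrite /nn hformC knorm_conj. Qed.

Lemma nn_ge0 p q : 0 <= nn p q. Proof. exact: knorm_ge0. Qed.

Lemma nn_fin (p q : pt) : boundary p -> boundary q ->
  nn (Some p) (Some q) = dist p q ^+ 2.
Proof.
case: p q => [z w] [z' w'] hp hq; rewrite /nn hform_phi /dist gauge_boundary; last first.
  by apply: boundary_hmul => //; exact: boundaryN.
rewrite (kconj_im hp) /=.
have E1 : kreal s (vsqnorm (- z + z')) = kreal s (vsqnorm z)
    + kreal s (vsqnorm z') - kreal s (kre (sesqui z z')) *+ 2.
  rewrite vsqnormD vsqnormN sesquiNl kreN mulNrn krealD krealD krealN.
  by congr (_ - _); rewrite mulr2n krealD.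
rewrite E1 sesquiNl kimN [in LHS](kre_kimE (sesqui z z')) mulrnDl mulNrn.
rewrite -knormN; congr knorm; exact: nn_aux.
Qed.

Lemma nn_None_fin (p : pt) : nn None (Some p) = 1.
Proof.
case: p => z w; rewrite /nn phi_None phi_fin hform_hvec kconj0 kconj1 mul0r subr0.
rewrite mulr1 /sesqui big1 ?sub0r ?knormN ?knorm1// => i _.
by rewrite mxE kconj0 mul0r.
Qed.

Lemma nn_None : nn None None = 0.
Proof.
rewrite /nn phi_None hform_hvec kconj0 kconj1 mul0r subr0 mulr0 subr0.
by rewrite /sesqui big1 ?knorm0// => i _; rewrite mxE kconj0 mul0r.
Qed.

Lemma nn_self p : bd p -> nn p p = 0.
Proof.
case: p => [p hp|_]; last exact: nn_None.
by rewrite nn_fin// /dist hmulNp -dist0 /dist hmulNp /gauge !vsqnorm0 kre0 normr0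
  addr0 kreal0 kim0 addr0 knorm0 sqrtr0 expr0n.
Qed.

Lemma phi_neq0 p : phi p != 0 :> vec.
Proof.
apply/eqP => h; case: p h => [[z w]|] h.
  have := nn_None_fin (z, w); rewrite /nn h /hform mulmx0 mxE knorm0 => /eqP.
  by rewrite eq_sym oner_eq0.
have := nn_None_fin 0; rewrite nnC /nn h /hform mulmx0 mxE knorm0 => /eqP.
by rewrite eq_sym oner_eq0.
Qed.

Lemma bd_null p : bd p -> hform (phi p) (phi p) = 0.
Proof. by move=> /nn_self/eqP; rewrite knorm_eq0 => /eqP. Qed.

(** This is why unitary matrices preserve the boundary together with infinity. Either the first
    coordinate vanishes, and nullity kills the middle block, or it can be normalised to 1. *)
Lemma null_phi v : v != 0 -> hform v v = 0 ->
  exists p c, [/\ bd p, c != 0 & v = phi p *m c%:M].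
Proof.
rewrite (hvecE v); move: (usubmx _ 0 0) (dsubmx (usubmx v)) (dsubmx v 0 0).
move=> a z c v0 hv; have [a0|a0] := eqVneq a 0.
  move: hv v0; rewrite a0 hform_hvec kconj0 mul0r mulr0 !subr0 sesqui_vsqnorm.
  move=> /(congr1 (@kre R s)); rewrite kre_kreal kre0 => /eqP.
  rewrite vsqnorm_eq0 => /eqP-> hv; exists None, c; split=> //.
    apply: contra_neq hv => ->.
    by rewrite /hvec !raddf0 !col_mx0.
  by rewrite phi_None hvec_rs !mul0r mul1r mul0mx.
have ua := kunit a0; set z1 := z *m (a^-1)%:M; set c1 := c / a.
have Ev : hvec a z c = hvec 1 z1 c1 *m a%:M.
  by rewrite hvec_rs mul1r /z1 /c1 divrK// -mulmxA -scalar_mxM mulVr// mulmx1.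
have hv1 : hform (hvec 1 z1 c1) (hvec 1 z1 c1) = 0.
  move: hv; rewrite Ev hform_rsl hform_rsr => /eqP.
  rewrite -knorm_eq0 !knormM !mulf_eq0 !knorm_eq0 -(knorm_eq0 (kconj a)).
  by rewrite knorm_conj knorm_eq0 (negbTE a0) orbF => /= /eqP.
pose z2 := \col_i (kreal s (Num.sqrt 2)^-1 * z1 i 0).
have sq2 : kreal s (Num.sqrt 2) * kreal s (Num.sqrt 2)^-1 = 1 :> k.
  by rewrite -krealM divff ?kreal1// sqrtr_eq0 -ltNge ltr0n.
have Ez : \col_i (kreal s (Num.sqrt 2) * z2 i 0) = z1.
  by apply/matrixP => i j; rewrite !mxE (ord1 j) mulrA sq2 mul1r.
have Evs : kre c1 = vsqnorm z2.
  have : vsqnorm z1 = 2 * vsqnorm z2.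
    rewrite /vsqnorm mulr_sumr; apply: eq_bigr => i _; rewrite -Ez mxE knormM.
    by rewrite knorm_kreal exprMn ger0_norm ?sqrtr_ge0// sqr_sqrtr.
  move: hv1; rewrite hform_hvec kconj1 mul1r mulr1 sesqui_vsqnorm.
  move=> /(congr1 (@kre R s)); rewrite !kreB kre_conj kre_kreal kre0; lra.
exists (Some (z2, c1 - kreal s (vsqnorm z2))), a; split=> //.
  by rewrite /= /boundary /= kreB kre_kreal Evs subrr.
by rewrite Ev phi_fin Ez subrK.
Qed.

Lemma dehom_phi p c : c != 0 -> dehom (phi p *m c%:M) = p.
Proof.
move=> c0; case: p => [[z w]|].
  rewrite -[RHS](phiK (z, w) c0); congr dehom; apply/matrixP => i j.
  rewrite (ord1 j) [RHS]mxE [LHS]mxE big_ord_recl big_ord0 addr0.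
  by congr (_ * _); rewrite mxE eqxx mulr1n.
rewrite phi_None hvec_rs !mul0r mul0mx /dehom.
by rewrite /hvec !col_mxKu mxE eqxx mul0rn eqxx.
Qed.

End Form.

(** * The projective action and its cocycle *)

Section Action.
Variables (R : realType) (s : scalars) (n : nat).
Local Notation k := (scal R s).
Local Notation G := (PU R s n).
Local Notation pt := ('cV[k]_n * k)%type.
Local Notation vec := 'cV[k]_(1 + n + 1).
Implicit Types (p q : option pt) (g h : G) (A B : unitary R s n) (c d : k).

Lemma scale_central d (v : vec) : central d -> d *: v = v *m d%:M.
Proof.
move=> cd; apply/matrixP => i j; rewrite (ord1 j) !mxE big_ord_recl big_ord0.
by rewrite addr0 mxE eqxx mulr1n cd.
Qed.

(** Makes [jac] independent of the representing matrix. The pairing of the lifts of infinity and 0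
    has norm 1 and is preserved by both matrices, while the factor [d] multiplies it by the square
    of [knorm d]. *)
Lemma proportional_norm A B d : d != 0 -> central d ->
  mx_of B = d *: mx_of A -> knorm d = 1.
Proof.
move=> d0 cd E.
have := hformM (phi None) (phi (Some 0)) (mx_ofP B).
rewrite E -!scalemxAl !scale_central// hform_rsl hform_rsr hformM; last exact: mx_ofP.
move=> /(congr1 (@knorm R s)); rewrite !knormM -/(nn _ _) nn_None_fin mul1r.
by rewrite knorm_conj -expr2 => /eqP; rewrite sqrp_eq1 ?knorm_ge0// => /eqP.
Qed.

(* The factor [c] in [A phi(p) = phi(A p) c]. *)
Definition jac g p : R :=
  let v := mx_of (repr g) *m phi p in
  if act g p is None then knorm (dsubmx v 0 0)
  else knorm (usubmx (usubmx v) 0 0).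

Lemma jac_proj A p q c : c != 0 -> mx_of A *m phi p = phi q *m c%:M ->
  act (proj A) p = q /\ jac (proj A) p = knorm c.
Proof.
move=> c0 E; have Eq : act (proj A) p = q by rewrite act_proj E dehom_phi.
split=> //; rewrite /jac Eq.
have /projP := proj_repr (proj A).
move=> /proportional_symS/asboolP[d [d0 cd Ed]].
have nd := proportional_norm d0 cd Ed.
rewrite Ed -scalemxAl E scale_central// -mulmxA -scalar_mxM.
rewrite -[RHS]mulr1 -nd -knormM.
case: q {E Eq} => [[z w]|].
  by rewrite phi_fin hvec_rs /hvec !col_mxKu mxE eqxx mulr1n mul1r.
by rewrite phi_None hvec_rs /hvec col_mxKd mxE eqxx mulr1n mul1r.
Qed.

Lemma act_phi A p : bd p -> exists c, [/\ c != 0, bd (act (proj A) p),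
  jac (proj A) p = knorm c & mx_of A *m phi p = phi (act (proj A) p) *m c%:M].
Proof.
move=> bp; have v0 : mx_of A *m phi p != 0.
  apply/eqP => h; have /eqP := phi_neq0 p; apply.
  have [[B [_ BA]] _] := mx_ofP A.
  by rewrite -[LHS]mul1mx -BA -mulmxA h mulmx0.
have [|q [c [bq c0 E]]] := null_phi v0.
  by rewrite hformM ?bd_null//; exact: mx_ofP.
by exists c; have [-> ->] := jac_proj c0 E.
Qed.

Lemma act_repr g p : bd p -> exists c, [/\ c != 0, bd (act g p),
  jac g p = knorm c & mx_of (repr g) *m phi p = phi (act g p) *m c%:M].
Proof. by move=> /(act_phi (repr g)); rewrite proj_repr. Qed.

Lemma bd_act g p : bd p -> bd (act g p).
Proof. by move=> /(act_repr g)[c []]. Qed.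

Lemma jac_gt0 g p : bd p -> 0 < jac g p.
Proof. by move=> /(act_repr g)[c [c0 _ -> _]]; rewrite knorm_gt0. Qed.

Lemma actM_jacM g h p : bd p ->
  act (g * h)%g p = act g (act h p) /\
  jac (g * h)%g p = jac g (act h p) * jac h p.
Proof.
move=> bp; have [c [c0 bq -> E]] := act_repr h bp.
have [d [d0 _ -> F]] := act_repr g bq.
rewrite -{1 3}(proj_repr g) -{1 3}(proj_repr h) [(_ * _)%g]proj_mul -knormM.
apply: jac_proj; first by rewrite -scal_unitE unitrMr !kunit.
by rewrite {1}/mx_of /= -mulmxA E mulmxA F -mulmxA -scalar_mxM.
Qed.

Lemma actM g h p : bd p -> act (g * h)%g p = act g (act h p).
Proof. by move=> /(actM_jacM g h)[]. Qed.

Lemma jacM g h p : bd p -> jac (g * h)%g p = jac g (act h p) * jac h p.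
Proof. by move=> /(actM_jacM g h)[]. Qed.

Lemma act1_jac1 p : act (1%g : G) p = p /\ jac (1%g : G) p = 1.
Proof.
rewrite -(knorm1 R s); apply: (@jac_proj 1%g); first exact: oner_neq0.
by rewrite /mx_of /= mul1mx mulmx1.
Qed.

Lemma act1 p : act (1%g : G) p = p. Proof. by have [] := act1_jac1 p. Qed.
Lemma jac1 p : jac (1%g : G) p = 1. Proof. by have [] := act1_jac1 p. Qed.

Lemma actK g p : bd p -> act g^-1%g (act g p) = p.
Proof. by move=> bp; rewrite -actM// mulVg act1. Qed.
Lemma actVK g p : bd p -> act g (act g^-1%g p) = p.
Proof. by move=> bp; rewrite -actM// mulgV act1. Qed.

Lemma jacV g p : bd p -> jac g^-1%g (act g p) = (jac g p)^-1.
Proof.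
move=> bp; have := jacM g^-1%g g bp; rewrite mulVg jac1 => h.
by apply: (mulIf (lt0r_neq0 (jac_gt0 g bp))); rewrite -h mulVf ?lt0r_neq0 ?jac_gt0.
Qed.

Lemma nn_act g p q : bd p -> bd q ->
  nn (act g p) (act g q) * jac g p * jac g q = nn p q.
Proof.
move=> bp bq; have [c [c0 _ -> E]] := act_repr g bp.
have [d [d0 _ -> F]] := act_repr g bq.
rewrite /nn -[in RHS](hformM _ _ (mx_ofP (repr g))) E F hform_rsl hform_rsr.
by rewrite !knormM knorm_conj mulrA [knorm c * _]mulrC.
Qed.

Lemma act_inj g p q : bd p -> bd q -> act g p = act g q -> p = q.
Proof. by move=> bp bq h; rewrite -(actK g bp) h actK. Qed.

End Action.

(** * Discreteness and denominators *)

Section MatrixBound.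
Variables (R : realType) (s : scalars).
Local Notation k := (scal R s).

Definition mbound m p (e : R) (X : 'M[k]_(m, p)) : Prop :=
  forall i j, knorm (X i j) <= e.

Lemma mboundW m p (e e' : R) (X : 'M[k]_(m, p)) :
  e <= e' -> mbound e X -> mbound e' X.
Proof. by move=> ee H i j; exact: le_trans (H i j) ee. Qed.

Lemma mbound_mul m p q (a b : R) (X : 'M[k]_(m, p)) (Y : 'M[k]_(p, q)) :
  mbound a X -> mbound b Y -> mbound (p%:R * (a * b)) (X *m Y).
Proof.
move=> HX HY i j; rewrite mxE; apply: le_trans (ler_knorm_sum _ _ _) _.
rewrite mulr_natl -[p in leRHS]card_ord -sumr_const; apply: ler_sum => l _.
by rewrite knormM ler_pM ?knorm_ge0.
Qed.

Lemma mbound_opp m p (e : R) (X : 'M[k]_(m, p)) : mbound e X -> mbound e (- X).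
Proof. by move=> H i j; rewrite mxE knormN. Qed.

Lemma mbound_ctrmx m p (e : R) (X : 'M[k]_(m, p)) : mbound e X -> mbound e (ctrmx X).
Proof. by move=> H i j; rewrite !mxE knorm_conj. Qed.

Lemma mbound0 m p (e : R) : 0 <= e -> mbound e (0 : 'M[k]_(m, p)).
Proof. by move=> e0 i j; rewrite mxE knorm0. Qed.

Lemma mbound1 m : mbound 1 (1%:M : 'M[k]_m).
Proof.
by move=> i j; rewrite !mxE; case: (_ == _); rewrite /= ?mulr1n ?mulr0n ?knorm1 ?knorm0.
Qed.

Lemma mbound_scalar (c : k) (e : R) : knorm c <= e -> mbound e (c%:M : 'M[k]_1).
Proof. by move=> ce i j; rewrite !ord1 mxE eqxx mulr1n. Qed.

Lemma mbound_ex m p (X : 'M[k]_(m, p)) : exists2 e, 0 <= e & mbound e X.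
Proof.
exists (\sum_i \sum_j knorm (X i j)).
  by apply: sumr_ge0 => i _; apply: sumr_ge0 => j _; exact: knorm_ge0.
move=> i j; rewrite (bigD1 i)//= (bigD1 j)//= -addrA lerDl addr_ge0//.
  by apply: sumr_ge0 => l _; exact: knorm_ge0.
by apply: sumr_ge0 => l _; apply: sumr_ge0 => ? _; exact: knorm_ge0.
Qed.

(** Total boundedness in a form ready for the pigeonhole principle. Real coordinates are rounded to
    a grid of mesh [e / 2], because [knorm_le_coords] loses a factor 2. *)
Lemma grid_colouring m p (B e : R) : 0 < e ->
  exists (F : finType) (col : 'M[k]_(m, p) -> F), forall X Y,
    mbound B X -> mbound B Y -> col X = col Y -> mbound e (X - Y).
Proof.
move=> e0; pose f (t : R) := Num.truncn ((t + B) / (e / 2)).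
pose N := Num.truncn ((B + B) / (e / 2)).
exists {ffun 'I_m * 'I_p * 'I_(kdim s) -> 'I_N.+1}.
exists (fun X : 'M[k]_(m, p) => [ffun u : 'I_m * 'I_p * 'I_(kdim s) => inord (f (kcoords (X u.1.1 u.1.2))`_(u.2))]).
move=> X Y HX HY /ffunP E i j; rewrite !mxE.
have -> : e = 2 * (e / 2) by rewrite mulrC divfK.
apply: knorm_le_coords => l; rewrite kcoordsB.
have e20 : 0 < e / 2 by rewrite divr_gt0.
have fN (Z : 'M[k]_(m, p)) : mbound B Z ->
    [/\ (f ((kcoords (Z i j))`_l)%R < N.+1)%N,
      (f (kcoords (Z i j))`_l)%:R <= ((kcoords (Z i j))`_l + B) / (e / 2) &
      ((kcoords (Z i j))`_l + B) / (e / 2) < (f (kcoords (Z i j))`_l).+1%:R].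
  move=> HZ; have := le_trans (knorm_coord (Z i j) l) (HZ i j).
  rewrite ler_norml => /andP[h1 h2].
  have h0 : 0 <= ((kcoords (Z i j))`_l + B) / (e / 2).
    by rewrite divr_ge0 ?(ltW e20)//; lra.
  split.
  - by rewrite ltnS; apply: le_truncn; rewrite ler_pM2r ?invr_gt0// lerD2r.
  - by rewrite truncn_le.
  - exact: truncnS_gt.
have [x1 x2 x3] := fN _ HX; have [y1 y2 y3] := fN _ HY.
have /(congr1 (@nat_of_ord _)) := E (i, j, l).
rewrite !ffunE /= !inordK// => Ef; rewrite {}Ef in x2 x3.
rewrite -natr1 in x3; rewrite -natr1 in y3.
have h : `|((kcoords (X i j))`_l + B) / (e / 2) -
    ((kcoords (Y i j))`_l + B) / (e / 2)| <= 1.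
  by rewrite ler_norml; lra.
move: h; rewrite -mulrBl normrM (gtr0_norm (_ : 0 < (e / 2)^-1)) ?invr_gt0//.
by rewrite ler_pdivrMr// mul1r opprD addrACA subrr addr0.
Qed.

End MatrixBound.

Lemma pigeonhole (T : choiceType) (F : finType) (S : set T) (f : T -> F) :
  infinite_set S -> exists x y, [/\ S x, S y, x <> y & f x = f y].
Proof.
move=> iS; apply: contrapT => H; apply: iS.
have fi : {in S &, injective f}.
  move=> x y /set_mem Sx /set_mem Sy E; apply: contrapT => xy.
  by apply: H; exists x, y.
rewrite -(eq_finite_set (inj_card_eq fi)).
exact: (@sub_finite_set _ _ setT).
Qed.

(** * Block matrices for the splitting 1 + n + 1 *)

Section Blocks.
Variables (R : realType) (s : scalars) (n : nat).
Local Notation k := (scal R s).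
Local Notation mat := 'M[k]_(1 + n + 1).

Definition b3 (a : 'M[k]_1) (x : 'rV[k]_n) (b : 'M[k]_1)
    (v : 'cV[k]_n) (W : 'M[k]_n) (y : 'cV[k]_n)
    (c : 'M[k]_1) (z : 'rV[k]_n) (d : 'M[k]_1) : mat :=
  block_mx (block_mx a x v W) (col_mx b y) (row_mx c z) d.

Lemma b3E (X : mat) : exists a x b v W y c z d, X = b3 a x b v W y c z d.
Proof.
rewrite -[X]submxK -[ulsubmx X]submxK -(vsubmxK (ursubmx X)) -(hsubmxK (dlsubmx X)).
by do 9 eexists.
Qed.

Lemma b3_inj a x b v W y c z d a' x' b' v' W' y' c' z' d' :
  b3 a x b v W y c z d = b3 a' x' b' v' W' y' c' z' d' ->
  [/\ a = a', x = x' & b = b'] /\ [/\ v = v', W = W' & y = y'] /\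
  [/\ c = c', z = z' & d = d'].
Proof.
by move=> /eq_block_mx[/eq_block_mx[-> -> -> ->] /eq_col_mx[-> ->]
  /eq_row_mx[-> ->] ->].
Qed.

Lemma b3M a x b v W y c z d a' x' b' v' W' y' c' z' d' :
  b3 a x b v W y c z d *m b3 a' x' b' v' W' y' c' z' d' =
  b3 (a *m a' + x *m v' + b *m c') (a *m x' + x *m W' + b *m z')
       (a *m b' + x *m y' + b *m d')
     (v *m a' + W *m v' + y *m c') (v *m x' + W *m W' + y *m z')
       (v *m b' + W *m y' + y *m d')
     (c *m a' + z *m v' + d *m c') (c *m x' + z *m W' + d *m z')
       (c *m b' + z *m y' + d *m d').
Proof.
rewrite /b3 mulmx_block mulmx_block mul_col_row mul_block_col mul_col_mx.
by rewrite mul_row_block mul_mx_row mul_row_col add_block_mx add_col_mx add_row_mx.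
Qed.

Lemma b3_ctrmx a x b v W y c z d : ctrmx (b3 a x b v W y c z d) =
  b3 (ctrmx a) (ctrmx v) (ctrmx c) (ctrmx x) (ctrmx W) (ctrmx z)
     (ctrmx b) (ctrmx y) (ctrmx d).
Proof.
by rewrite /ctrmx /b3 !(tr_block_mx, tr_col_mx, tr_row_mx, map_block_mx)
  !(map_row_mx, map_col_mx).
Qed.

Lemma b3_formJ : formJ R s n = b3 0 0 (- 1%:M) 0 1%:M 0 (- 1%:M) 0 0.
Proof. by []. Qed.

Lemma b3_1 : 1%:M = b3 1%:M 0 0 0 1%:M 0 0 0 1%:M.
Proof. by rewrite /b3 row_mx0 col_mx0 -!scalar_mx_block. Qed.

Lemma b3B a x b v W y c z d a' x' b' v' W' y' c' z' d' :
  b3 a x b v W y c z d - b3 a' x' b' v' W' y' c' z' d' =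
  b3 (a - a') (x - x') (b - b') (v - v') (W - W') (y - y')
     (c - c') (z - z') (d - d').
Proof.
rewrite /b3 opp_block_mx opp_block_mx opp_col_mx opp_row_mx.
by rewrite !add_block_mx add_col_mx add_row_mx.
Qed.

Lemma b3_mbound (e : R) a x b v W y c z d :
  mbound e a -> mbound e x -> mbound e b -> mbound e v -> mbound e W ->
  mbound e y -> mbound e c -> mbound e z -> mbound e d ->
  mbound e (b3 a x b v W y c z d).
Proof.
move=> ha hx hb hv hW hy hc hz hd i j; rewrite /b3.
case: (split_ordP i) => {}i ->; case: (split_ordP j) => {}j ->.
- rewrite block_mxEul.
  by case: (split_ordP i) => {}i ->; case: (split_ordP j) => {}j ->;
    rewrite ?block_mxEul ?block_mxEur ?block_mxEdl ?block_mxEdr.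
- rewrite block_mxEur.
  by case: (split_ordP i) => {}i ->; rewrite ?col_mxEu ?col_mxEd.
- rewrite block_mxEdl.
  by case: (split_ordP j) => {}j ->; rewrite ?row_mxEl ?row_mxEr.
- by rewrite block_mxEdr.
Qed.

Lemma b3_mboundE (e : R) a x b v W y c z d :
  mbound e (b3 a x b v W y c z d) ->
  [/\ mbound e a, mbound e x & mbound e b] /\
  [/\ mbound e v, mbound e W & mbound e y] /\
  [/\ mbound e c, mbound e z & mbound e d].
Proof.
move=> H; do !split.
- by move=> i j; have := H (lshift 1 (lshift n i)) (lshift 1 (lshift n j));
    rewrite /b3 !block_mxEul.
- by move=> i j; have := H (lshift 1 (lshift n i)) (lshift 1 (rshift 1 j));
    rewrite /b3 block_mxEul block_mxEur.
- by move=> i j; have := H (lshift 1 (lshift n i)) (rshift (1 + n) j);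
    rewrite /b3 block_mxEur col_mxEu.
- by move=> i j; have := H (lshift 1 (rshift 1 i)) (lshift 1 (lshift n j));
    rewrite /b3 block_mxEul block_mxEdl.
- by move=> i j; have := H (lshift 1 (rshift 1 i)) (lshift 1 (rshift 1 j));
    rewrite /b3 block_mxEul block_mxEdr.
- by move=> i j; have := H (lshift 1 (rshift 1 i)) (rshift (1 + n) j);
    rewrite /b3 block_mxEur col_mxEd.
- by move=> i j; have := H (rshift (1 + n) i) (lshift 1 (lshift n j));
    rewrite /b3 block_mxEdl row_mxEl.
- by move=> i j; have := H (rshift (1 + n) i) (lshift 1 (rshift 1 j));
    rewrite /b3 block_mxEdl row_mxEr.
- by move=> i j; have := H (rshift (1 + n) i) (rshift (1 + n) j);
    rewrite /b3 block_mxEdr.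
Qed.

Lemma b3_hvec a x b v W y c z d (a' : k) z' (c' : k) :
  b3 a x b v W y c z d *m hvec a' z' c' =
  col_mx (col_mx (a *m a'%:M + x *m z' + b *m c'%:M)
                 (v *m a'%:M + W *m z' + y *m c'%:M))
         (c *m a'%:M + z *m z' + d *m c'%:M).
Proof.
rewrite /b3 /hvec mul_block_col mul_block_col mul_row_col mul_col_mx add_col_mx.
by [].
Qed.

End Blocks.

(** * Translations and stabilisers as block matrices *)

Section Denominators.
Variables (R : realType) (s : scalars) (n : nat).
Local Notation k := (scal R s).
Local Notation G := (PU R s n).
Local Notation pt := ('cV[k]_n * k)%type.
Local Notation mat := 'M[k]_(1 + n + 1).
Implicit Types (g h : G) (A H D : unitary R s n).

Local Notation simpM := (mulmx0, mul0mx, mulmx1, mul1mx, addr0, add0r, mulNmx, mulmxN,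
  oppr0, opprK).

Lemma ctrmx0 m p : ctrmx (0 : 'M[k]_(m, p)) = 0.
Proof. by apply/matrixP => i j; rewrite !mxE kconj0. Qed.

Lemma ctrmx_scalar (c : k) : ctrmx (c%:M : 'M[k]_1) = (kconj c)%:M.
Proof. by apply/matrixP => i j; rewrite !ord1 !mxE !eqxx !mulr1n. Qed.

Lemma mx_of_inv A : mx_of A^-1%g = formJ R s n *m ctrmx (mx_of A) *m formJ R s n.
Proof. by []. Qed.

Lemma mx_of_mul A B : mx_of (A * B)%g = mx_of A *m mx_of B. Proof. by []. Qed.

Lemma b3_inv A a x b v W y c z d : mx_of A = b3 a x b v W y c z d ->
  mx_of A^-1%g = b3 (ctrmx d) (- ctrmx y) (ctrmx b)
                    (- ctrmx z) (ctrmx W) (- ctrmx x)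
                    (ctrmx c) (- ctrmx v) (ctrmx a).
Proof.
by move=> E; rewrite mx_of_inv E b3_ctrmx b3_formJ !b3M !simpM.
Qed.

(** Matrix of the left translation by [p] in the Heisenberg group. *)
Definition tau_mx (p : pt) : mat :=
  let z := \col_i (kreal s (Num.sqrt 2) * p.1 i 0) in
  b3 1%:M 0 0 z 1%:M 0 (p.2 + kreal s (vsqnorm p.1))%:M (ctrmx z) 1%:M.

Lemma tau_mx_unitary (p : pt) : boundary p -> unitaryJ (tau_mx p).
Proof.
case: p => z0 w0 hp; rewrite /tau_mx /=; set z := \col_i _; set c := w0 + _.
(* Nullity of the lift of [p], which is what makes the matrix unitary. *)
have hz : ctrmx z *m z = c%:M + ctrmx (c%:M : 'M[k]_1).
  have /eqP := bd_null (hp : bd (Some (z0, w0))); rewrite phi_fin -/z -/c hform_hvec.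
  rewrite kconj1 mul1r mulr1 -addrA -opprD subr_eq0 => /eqP E.
  apply/matrixP => i j; rewrite !ord1 ctrmx_scalar [LHS]mxE [RHS]mxE.
  rewrite [X in _ = X + _]mxE [X in _ = _ + X]mxE eqxx !mulr1n -E.
  by apply: eq_bigr => l _; rewrite !mxE.
have inv : b3 1%:M 0 0 (- z) 1%:M 0 (ctrmx (c%:M : 'M[k]_1)) (- ctrmx z) 1%:M *m
   b3 1%:M 0 0 z 1%:M 0 c%:M (ctrmx z) 1%:M = 1%:M.
  rewrite b3M !simpM b3_1 hz; congr b3; rewrite ?addNr//.
  by rewrite opprD addrCA subrr addr0 addNr.
have inv' : b3 1%:M 0 0 z 1%:M 0 c%:M (ctrmx z) 1%:M *m
   b3 1%:M 0 0 (- z) 1%:M 0 (ctrmx (c%:M : 'M[k]_1)) (- ctrmx z) 1%:M = 1%:M.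
  rewrite b3M !simpM b3_1 hz; congr b3; rewrite ?subrr//.
  by rewrite opprD addrA subrr add0r addNr.
split; first by eexists; split; [exact: inv'|exact: inv].
rewrite b3_ctrmx b3_formJ !b3M ctrmx0 ctrmx1 !simpM ctrmxK ctrmx1 !simpM hz.
congr b3; rewrite ?subrr ?addNr// ?ctrmx0 ?simpM//.
by rewrite addrCA addNr addr0 subrr.
Qed.

Definition tau (p : pt) (hp : boundary p) : unitary R s n :=
  unitary_of (tau_mx_unitary hp).

Lemma tau_None (p : pt) (hp : boundary p) : mx_of (tau hp) *m phi None = phi None.
Proof.
rewrite phi_None /mx_of /= /tau_mx b3_hvec raddf0 !simpM.
by rewrite /hvec !raddf0.
Qed.

Lemma phi_0 : phi (Some (0 : pt)) = hvec 1 0 0 :> 'cV[k]_(1 + n + 1).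
Proof.
rewrite -[Some _]/(Some ((0, 0) : pt)) phi_fin vsqnorm0 kreal0 addr0; congr hvec.
by apply/matrixP => i j; rewrite !mxE mulr0.
Qed.

Lemma tau_0 (p : pt) (hp : boundary p) : mx_of (tau hp) *m phi (Some 0) = phi (Some p).
Proof.
case: p hp => z w hp; rewrite phi_0.
have -> : mx_of (tau hp) = tau_mx (z, w) by [].
by rewrite /tau_mx b3_hvec !raddf0 !simpM phi_fin.
Qed.

Lemma tau_bound (p : pt) (hp : boundary p) : gauge p <= 1 ->
  mbound 2 (mx_of (tau hp)) /\ mbound 2 (mx_of (tau hp)^-1%g).
Proof.
move=> p1; have p0 := gauge_ge0 p.
have hz i : knorm (kreal s (Num.sqrt 2) * p.1 i 0) <= 2.
  rewrite knormM knorm_kreal ger0_norm ?sqrtr_ge0//.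
  have h1 : Num.sqrt 2 <= 2 :> R.
    rewrite -[leRHS](@ger0_norm _ 2)// -sqrtr_sqr ler_sqrt ?exprn_gt0//.
    by rewrite expr2; lra.
  have h2 : knorm (p.1 i 0) <= 1.
    apply: le_trans p1; apply: le_trans (vsqnorm_le_gauge hp).
    rewrite -[leLHS]ger0_norm ?knorm_ge0// -sqrtr_sqr ler_wsqrtr//.
    by rewrite /vsqnorm (bigD1 i)//= lerDl sumr_ge0// => j _; exact: sqr_ge0.
  rewrite -[leRHS]mulr1; by apply: ler_pM; rewrite ?sqrtr_ge0 ?knorm_ge0.
have hc : knorm (p.2 + kreal s (vsqnorm p.1)) <= 2.
  by rewrite addrC -gauge_boundary//; apply: (@le_trans _ _ 1); rewrite ?exprn_ile1 ?ler1n.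
have b1 m : mbound (2 : R) (1%:M : 'M[k]_m).
  by apply: mboundW (@mbound1 _ _ _); rewrite ler1n.
have b0 m q : mbound (2 : R) (0 : 'M[k]_(m, q)) by apply: mbound0.
have bz : mbound 2 (\col_i (kreal s (Num.sqrt 2) * p.1 i 0)) by move=> i j; rewrite mxE.
have E : mx_of (tau hp) = tau_mx p by [].
have bt m l (X : 'M[k]_(m, l)) : mbound 2 X -> mbound 2 (ctrmx X).
  exact: mbound_ctrmx.
have bN m l (X : 'M[k]_(m, l)) : mbound 2 X -> mbound 2 (- ctrmx X).
  by move=> /bt; exact: mbound_opp.
have bc := mbound_scalar hc.
rewrite (b3_inv E) E; split.
  exact: (b3_mbound (b1 _) (b0 _ _) (b0 _ _) bz (b1 _) (b0 _ _) bc (bt _ _ _ bz) (b1 _)).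
exact: (b3_mbound (bt _ _ _ (b1 _)) (bN _ _ _ (b0 _ _)) (bt _ _ _ (b0 _ _))
  (bN _ _ _ (bt _ _ _ bz)) (bt _ _ _ (b1 _)) (bN _ _ _ (b0 _ _))
  (bt _ _ _ bc) (bN _ _ _ bz) (bt _ _ _ (b1 _))).
Qed.

Lemma scalar_mx_eq0 m (c : k) (X : 'M[k]_(1, m)) : c != 0 ->
  c%:M *m X = 0 -> X = 0.
Proof.
move=> c0 E; rewrite -[X]mul1mx -(mulVr (kunit c0)) scalar_mxM -mulmxA E mulmx0 //.
Qed.

Lemma mx_of_mulV A : mx_of A *m mx_of A^-1%g = 1%:M.
Proof. by rewrite -mx_of_mul mulgV. Qed.

(** Fixing infinity determines the last column, and preservation of the form then forces the first
    row to vanish off the diagonal. [W] is a rotation; [v], [c] and [y] carry the translation. *)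
Lemma unitary_lower H (u : k) : u != 0 -> mx_of H *m phi None = phi None *m u%:M ->
  exists a v W c y, mx_of H = b3 a 0 0 v W 0 c y u%:M /\
    [/\ ctrmx u%:M *m a = 1%:M, a *m ctrmx u%:M = 1%:M,
        ctrmx W *m W = 1%:M & W *m ctrmx W = 1%:M].
Proof.
move=> u0; have [a [x [b [v [W [y [c [z [d E]]]]]]]]] := b3E (mx_of H).
have := mx_of_mulV H; rewrite (b3_inv E).
rewrite E phi_None b3_hvec !raddf0 !simpM hvec_rs !mul0r mul1r mul0mx /hvec raddf0.
move=> HV /eq_col_mx[/eq_col_mx[b0 y0] du].
have [_ HJ] := mx_ofP H; move: HJ.
rewrite E b0 y0 du b3_ctrmx b3_formJ !b3M !ctrmx0 !simpM.
move=> /b3_inj[_ [[_ eW _] [ed ex _]]].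
have x0 : x = 0.
  move/eqP: ex; rewrite ctrmx_scalar oppr_eq0 => /eqP; apply: scalar_mx_eq0.
  by rewrite -knorm_eq0 knorm_conj knorm_eq0.
exists a, v, W, c, z; rewrite x0; split=> //.
move: HV; rewrite x0 b0 y0 du b3M !ctrmx0 !simpM b3_1 => /b3_inj[[ea _ _] [[_ eW' _] _]].
split=> //; first by apply: oppr_inj.
by move: eW; rewrite x0 ctrmx0 !simpM.
Qed.

(** An element exchanging 0 and infinity is an inversion composed with a dilation and a rotation.
    Its denominator is [knorm b], and [knorm c] is the reciprocal. *)
Lemma unitary_antidiagonal D (b c : k) : b != 0 -> c != 0 ->
  mx_of D *m phi None = phi (Some 0) *m b%:M ->
  mx_of D *m phi (Some 0) = phi None *m c%:M ->
  exists U, mx_of D = b3 0 0 b%:M 0 U 0 c%:M 0 0 /\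
    [/\ ctrmx U *m U = 1%:M, U *m ctrmx U = 1%:M,
        (b%:M : 'M[k]_1) *m ctrmx c%:M = 1%:M &
        (c%:M : 'M[k]_1) *m ctrmx b%:M = 1%:M].
Proof.
move=> b0 c0; have [a [x [b' [v [U [y [c' [z [d E]]]]]]]]] := b3E (mx_of D).
have := mx_of_mulV D; rewrite (b3_inv E).
rewrite E phi_None phi_0 !b3_hvec !raddf0 !simpM !hvec_rs !mul0r !mul1r mul0mx /hvec !raddf0.
move=> DV /eq_col_mx[/eq_col_mx[eb ey] ed] /eq_col_mx[/eq_col_mx[ea ev] ec].
have [_ DJ] := mx_ofP D; move: DJ DV.
rewrite E ea eb ec ed ev ey b3_ctrmx b3_formJ !b3M ?ctrmx0 ?simpM ?ctrmx0 ?simpM.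
move=> /b3_inj[[_ ex _] [[_ eU _] [_ ez _]]].
have kc0 (e : k) : e != 0 -> kconj e != 0.
  by rewrite -!knorm_eq0 knorm_conj.
have x0 : x = 0.
  by move/eqP: ex; rewrite ctrmx_scalar oppr_eq0 => /eqP; apply: scalar_mx_eq0; exact: kc0.
have z0 : z = 0.
  by move/eqP: ez; rewrite ctrmx_scalar oppr_eq0 => /eqP; apply: scalar_mx_eq0; exact: kc0.
rewrite x0 z0 ctrmx0 !simpM b3_1 => /b3_inj[[e1 _ _] [[_ e2 _] [_ _ e3]]].
exists U; split=> //; split=> //.
by move: eU; rewrite x0 z0 ctrmx0 !simpM.
Qed.

Lemma orthogonal_mbound (U : 'M[k]_n) : ctrmx U *m U = 1%:M -> mbound 1 U.
Proof.
move=> E i j; have : (ctrmx U *m U) j j = 1 by rewrite E mxE eqxx.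
rewrite mxE; under eq_bigr do rewrite !mxE kconj_mul.
move=> /(congr1 (@kre R s)); rewrite -kreal_sum kre_kreal -kreal1 kre_kreal => h.
rewrite -(@ler_pXn2r _ 2) ?nnegrE ?knorm_ge0// expr1n -h (bigD1 i)//=.
by rewrite lerDl sumr_ge0// => l _; exact: sqr_ge0.
Qed.

End Denominators.

(** * Isometries fixing infinity *)

Section Isometries.
Variables (R : realType) (s : scalars) (n : nat).
Hypothesis n_gt0 : (0 < n)%N.
Local Notation k := (scal R s).
Local Notation G := (PU R s n).
Local Notation pt := ('cV[k]_n * k)%type.
Implicit Types (g h a b : G) (p q : pt).

Lemma subgroupV (H : set G) g : subgroup H -> H g -> H g^-1%g.
Proof. by move=> [H1 HV] Hg; rewrite -[X in H X]mul1g; exact: HV. Qed.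

Lemma subgroupM (H : set G) g h : subgroup H -> H g -> H h -> H (g * h)%g.
Proof.
by move=> sH Hg Hh; rewrite -[h]invgK; apply: sH.2 => //; exact: subgroupV.
Qed.

Lemma far_point (r : R) : 0 <= r -> exists p, boundary p /\ r <= gauge p.
Proof.
move=> r0; pose p : pt := (const_mx (kreal s r), 0).
have bp : boundary p by rewrite /boundary /= kre0.
exists p; split=> //; apply: le_trans (vsqnorm_le_gauge bp).
rewrite -[leLHS]ger0_norm// -sqrtr_sqr ler_wsqrtr//.
rewrite /vsqnorm (bigD1 (Ordinal n_gt0))//= mxE knorm_kreal real_normK ?num_real//.
by rewrite lerDl sumr_ge0// => j _; exact: sqr_ge0.
Qed.

Lemma act_stab_fin g p : act g None = None -> boundary p ->
  exists2 q, boundary q & act g (Some p) = Some q.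
Proof.
move=> g0 bp; have := bd_act g (bp : bd (Some p)).
case E : (act g (Some p)) => [q|] /= hq; first by exists q.
by have := @act_inj _ _ _ g (Some p) None bp I; rewrite E g0 => /(_ erefl).
Qed.

Lemma act_stabV g : act g None = None -> act g^-1%g None = None.
Proof. by move=> g0; rewrite -{1}g0 actK. Qed.

(** Pairing with infinity shows that [jac] takes the same value at all finite points, inverse to the
    value at infinity; preserving one nonzero distance makes this value 1. *)
Lemma isom_jac g : isom g -> jac g None = 1 /\
  forall p, boundary p -> jac g (Some p) = 1.
Proof.
move=> [g0 gd].
have jp p : boundary p -> jac g (Some p) = (jac g None)^-1.
  move=> bp; have [q bq E] := act_stab_fin g0 bp.
  have := @nn_act _ _ _ g (Some p) None bp I.
  rewrite E g0 nnC !nn_None_fin nnC nn_None_fin mul1r => h.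
  by apply: (mulIf (lt0r_neq0 (@jac_gt0 _ _ _ g None I)));
     rewrite h mulVf ?lt0r_neq0 ?jac_gt0.
have [p [bp p1]] := far_point (ler01 : 0 <= 1 :> R).
have b0 : boundary (0 : pt) := boundary0 _ _ _.
have [q bq Eq] := act_stab_fin g0 bp; have [q0 bq0 Eq0] := act_stab_fin g0 b0.
have := @nn_act _ _ _ g (Some 0) (Some p) b0 bp.
have := gd _ _ b0 bp; rewrite Eq Eq0 /= => dE.
rewrite !nn_fin// dE dist0 !jp// -mulrA => E.
have : (jac g None)^-1 * (jac g None)^-1 = 1.
  by apply: (mulfI (_ : gauge p ^+ 2 != 0)); rewrite ?E ?mulr1// expf_neq0 ?gt_eqF// (lt_le_trans ltr01).
rewrite -expr2 => /eqP; rewrite sqrp_eq1 ?invr_ge0 ?ltW ?jac_gt0// invr_eq1 => /eqP E1.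
by split=> // r /jp ->; rewrite E1 invr1.
Qed.

(** Finitely many isometries move the bounded set [K] only within a bounded region, whereas the
    boundary is unbounded. *)
Lemma isom_infinite (Z : set G) (K : set pt) :
  subgroup Z -> Z `<=` @isom R s n -> (forall p, K p -> boundary p /\ gauge p <= 1) ->
  @boundary R s n `<=` \bigcup_(a in Z) act_image a K -> infinite_set Z.
Proof.
move=> sZ iZ bK cov /finite_seqP[S ZS].
pose B := \sum_(a <- S) gauge (finpt (act a (Some 0))) + 2.
have B0 : 0 <= B by rewrite addr_ge0// sumr_ge0// => a _; exact: gauge_ge0.
have [p [bp]] := far_point B0.
have [a Za [x Kx Ea]] := cov _ bp; have [bx x1] := bK _ Kx.
have [a0 ad] := iZ _ Za.
have b0 : boundary (0 : pt) := boundary0 _ _ _.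
have [q bq Eq] := act_stab_fin a0 b0.
have := ad _ _ b0 bx; rewrite Ea Eq /= dist0 => E.
have := dist_triangle b0 bq bp; rewrite !dist0 E.
have : gauge q <= \sum_(a <- S) gauge (finpt (act a (Some 0))).
  have aS : a \in S by move: Za; rewrite ZS.
  rewrite (big_rem a)//= Eq /= lerDl sumr_ge0// => ? _; exact: gauge_ge0.
by rewrite /B; lra.
Qed.

End Isometries.

(** * The lower bound for denominators *)

Section SmallDenominators.
Variables (R : realType) (s : scalars) (n : nat).
Hypothesis n_gt0 : (0 < n)%N.
Local Notation k := (scal R s).
Local Notation G := (PU R s n).
Local Notation pt := ('cV[k]_n * k)%type.
Local Notation mat := 'M[k]_(1 + n + 1).
Implicit Types (g h : G) (p q : pt) (A D H : unitary R s n).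
Local Notation N := ((1 + n + 1)%:R : R).

Local Notation simpM := (mulmx0, mul0mx, mulmx1, mul1mx, addr0, add0r, mulNmx,
  mulmxN, oppr0, opprK).

(** On the lattice these blocks stay bounded, unlike the translation part, so they can be coloured
    with finitely many colours. *)
Definition diag_blocks (X : mat) : mat :=
  block_mx (block_mx (ulsubmx (ulsubmx X)) 0 0 (drsubmx (ulsubmx X))) 0 0 (drsubmx X).

Lemma diag_blocksE a x b v W y c z d :
  diag_blocks (b3 a x b v W y c z d) = b3 a 0 0 0 W 0 0 0 d :> mat.
Proof.
by rewrite /diag_blocks /b3 !block_mxKul !block_mxKdr row_mx0 col_mx0.
Qed.

Lemma projM A B : proj (A * B)%g = (proj A * proj B)%g.
Proof. by rewrite -proj_mul. Qed.

Lemma projV A : proj A^-1%g = (proj A)^-1%g.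
Proof. by rewrite -proj_inv. Qed.

Lemma mbound_scalar_conj (b c : k) (e : R) (M : 'M[k]_1) : mbound e M ->
  knorm b * knorm c = 1 -> mbound e (b%:M *m M *m ctrmx (c%:M : 'M[k]_1)).
Proof.
move=> HM bc i j; rewrite !ord1 ctrmx_scalar mxE big_ord_recl big_ord0 addr0.
rewrite mxE big_ord_recl big_ord0 addr0 !mxE !eqxx !mulr1n !knormM knorm_conj.
by rewrite mulrAC bc mul1r.
Qed.

Lemma N_ge1 : 1 <= N. Proof. by rewrite ler1n addn1. Qed.
Lemma nN : n%:R <= N. Proof. by rewrite ler_nat -addnA addnC -addnA leq_addr. Qed.

(* [H] is a quotient of two elements whose rotational parts are close. *)
Lemma isom_small_rotation (Z : set G) (e : R) : 0 < e -> subgroup Z ->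
  Z `<=` @isom R s n -> infinite_set Z ->
  exists H, [/\ Z (proj H), proj H <> 1%g &
    exists a v W c y d, mx_of H = b3 a 0 0 v W 0 c y d /\
      [/\ mbound e (a - 1%:M), mbound e (W - 1%:M) & mbound e (d - 1%:M)]].
Proof.
move=> e0 sZ iZ infZ; have N0 : 0 < N := lt_le_trans ltr01 N_ge1.
pose d := e / N; have d0 : 0 < d by rewrite divr_gt0.
have [F [col colP]] := @grid_colouring R s (1 + n + 1) (1 + n + 1) 1 d d0.
have low h : Z h -> exists a v W c y (u : k),
    mx_of (repr h) = b3 a 0 0 v W 0 c y u%:M /\
    [/\ ctrmx u%:M *m a = 1%:M, a *m ctrmx u%:M = 1%:M,
        ctrmx W *m W = 1%:M & W *m ctrmx W = 1%:M] /\
    [/\ knorm u = 1, mbound 1 a & mbound 1 W].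
  move=> /iZ ih; have [u [u0 _ ju E]] := act_repr h (I : bd None).
  have h0 := ih.1; rewrite h0 in E.
  have u1 : knorm u = 1 by rewrite -ju; have [] := isom_jac n_gt0 ih.
  have [a [v [W [c [y [Eh [e1 e2 e3 e4]]]]]]] := unitary_lower u0 E.
  exists a, v, W, c, y, u; do !split=> //; last exact: orthogonal_mbound.
  move=> i j; rewrite !ord1; have := congr1 (fun M : 'M[k]_1 => knorm (M 0 0)) e1.
  rewrite ctrmx_scalar mul_scalar_mx !mxE eqxx mulr1n knormM knorm_conj u1 mul1r.
  by rewrite knorm1 => ->.
pose f h := col (diag_blocks (mx_of (repr h))).
have [h1 [h2 [Z1 Z2 h12 Ef]]] := pigeonhole f infZ.
have [a1 [v1 [W1 [c1 [y1 [u1 [E1 [_ [nu1 ba1 bW1]]]]]]]]] := low _ Z1.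
have [a2 [v2 [W2 [c2 [y2 [u2 [E2 [[i1 i2 i3 i4] [nu2 ba2 bW2]]]]]]]]] := low _ Z2.
have [[ka _ _] [[_ kW _] [_ _ kd]]] : [/\ mbound d (a1 - a2), True & True] /\
   [/\ True, mbound d (W1 - W2) & True] /\
   [/\ True, True & mbound d (u1%:M - u2%:M : 'M[k]_1)].
  have db (a : 'M[k]_1) W (u : k) : mbound 1 a -> mbound 1 W -> knorm u = 1 ->
      mbound 1 (b3 a 0 0 0 W 0 0 0 u%:M : mat).
    move=> ba bW nu.
    have z0 m l : mbound 1 (0 : 'M[k]_(m, l)) := mbound0 s ler01.
    have bu : mbound 1 (u%:M : 'M[k]_1) by apply: mbound_scalar; rewrite nu.
    exact: (b3_mbound ba (z0 _ _) (z0 _ _) (z0 _ _) bW (z0 _ _) (z0 _ _) (z0 _ _) bu).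
  have := colP _ _ (db _ _ _ ba1 bW1 nu1) (db _ _ _ ba2 bW2 nu2).
  rewrite -(diag_blocksE a1 0 0 v1 W1 0 c1 y1 u1%:M) -E1.
  rewrite -(diag_blocksE a2 0 0 v2 W2 0 c2 y2 u2%:M) -E2 => /(_ Ef).
  rewrite E1 E2 !diag_blocksE b3B => /b3_mboundE[[k1 _ _] [[_ k2 _] [_ _ k3]]].
  by split; [|split]; split.
have nu2' : knorm u2 <= 1 by rewrite nu2.
have dN m : (m%:R <= N -> m%:R * (d * 1) <= e :> R).
  by move=> mN; rewrite mulr1 /d mulrCA ler_piMr ?(ltW e0)// ler_pdivrMr// mul1r.
exists (repr h1 * (repr h2)^-1)%g; split.
- by rewrite projM projV !proj_repr; exact: sZ.2.
- rewrite projM projV !proj_repr => h; apply: h12.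
  by rewrite -[h2]mul1g -h -mulgA mulVg mulg1.
rewrite mx_of_mul (b3_inv E2) E1 b3M !ctrmx0 !simpM.
do 6 eexists; split; first by [].
split.
- have -> : a1 *m ctrmx u2%:M - 1%:M = (a1 - a2) *m ctrmx u2%:M.
    by rewrite mulmxBl i2.
  apply: mboundW (mbound_mul ka (mbound_ctrmx (mbound_scalar nu2'))).
  exact/dN/N_ge1.
- have -> : W1 *m ctrmx W2 - 1%:M = (W1 - W2) *m ctrmx W2.
    by rewrite mulmxBl i4.
  apply: mboundW (mbound_mul kW (mbound_ctrmx bW2)).
  exact/dN/nN.
- have -> : u1%:M *m ctrmx a2 - 1%:M = (u1%:M - u2%:M) *m ctrmx a2.
    by rewrite mulmxBl -[X in _ = _ - X]ctrmxK ctrmxM ctrmxK i2 ctrmx1.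
  apply: mboundW (mbound_mul kd (mbound_ctrmx ba2)).
  exact/dN/N_ge1.
Qed.

(** Conjugation by a translation changes the translation part only, so a rotation close to the
    identity stays so when a point is moved to 0. *)
Lemma tau_conj_lower (p : pt) (hp : boundary p) H a v W c y d :
  mx_of H = b3 a 0 0 v W 0 c y d ->
  exists v' c' y', mx_of ((tau hp)^-1 * H * tau hp)%g = b3 a 0 0 v' W 0 c' y' d.
Proof.
move=> E; have T : mx_of (tau hp) = tau_mx p by [].
rewrite !mx_of_mul (b3_inv T) T E /tau_mx !b3M !ctrmx0 !ctrmx1 !simpM.
by do 3 eexists.
Qed.

(* If the denominator [jac g None] is small, [D] is a large dilation composed
   with the inversion, and conjugation by [D] shrinks the translation part. *)
Lemma antidiagonal_conj_bound D H (b c : k) U a v W w y d (x C : R) :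
  mx_of D = b3 0 0 b%:M 0 U 0 c%:M 0 0 ->
  [/\ ctrmx U *m U = 1%:M, U *m ctrmx U = 1%:M,
        (b%:M : 'M[k]_1) *m ctrmx c%:M = 1%:M &
        (c%:M : 'M[k]_1) *m ctrmx b%:M = 1%:M] ->
  mx_of H = b3 a 0 0 v W 0 w y d -> 0 <= x -> 0 <= C -> mbound C (mx_of H) ->
  mbound x (a - 1%:M) -> mbound x (W - 1%:M) -> mbound x (d - 1%:M) ->
  knorm b <= 1 -> N * C * knorm b <= x ->
  mbound (N ^+ 2 * x) (mx_of (D * H * D^-1)%g - 1%:M).
Proof.
move=> ED [u1 u2 bc cb] EH x0 C0 bH ba bW bd b1 bx.
have nb0 := knorm_ge0 b; have N1 := N_ge1; have nle := nN.
have nc : knorm b * knorm c = 1.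
  have := congr1 (fun M : 'M[k]_1 => knorm (M 0 0)) bc.
  by rewrite ctrmx_scalar mul_scalar_mx !mxE eqxx !mulr1n knormM knorm_conj knorm1.
have xN : x <= N ^+ 2 * x by rewrite ler_peMl// exprn_ege1.
have Nx : 0 <= N ^+ 2 * x by rewrite mulr_ge0// exprn_ge0.
have small (t : R) : t <= N * C * knorm b -> t <= N ^+ 2 * x.
  by move=> tb; apply: le_trans tb _; exact: le_trans bx _.
have [_ [[bv _ _] [bw by' _]]] := b3_mboundE (eq_ind _ (mbound C) bH _ EH).
have bb : mbound (knorm b) (b%:M : 'M[k]_1) by apply: mbound_scalar.
have bU := orthogonal_mbound u1.
rewrite !mx_of_mul (b3_inv ED) ED EH !b3M !ctrmx0 !simpM b3_1 b3B !subr0.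
have z0 m l : mbound (N ^+ 2 * x) (0 : 'M[k]_(m, l)) := mbound0 s Nx.
(* Conjugation by the antidiagonal [D] reverses the order of the diagonal blocks and keeps them near
   the identity, while each surviving off-diagonal block picks up a factor of norm [knorm b]. *)
apply: (b3_mbound _ _ _ (z0 _ _) _ _ (z0 _ _) (z0 _ _)).
- have -> : b%:M *m d *m ctrmx c%:M - 1%:M = b%:M *m (d - 1%:M) *m ctrmx (c%:M : 'M[k]_1).
    by rewrite mulmxBr mulmxBl mulmx1 bc.
  exact/mbound_scalar_conj/nc/(mboundW xN).
- apply: mboundW (mbound_mul (mbound_mul bb by') (mbound_ctrmx bU)); apply: small.
  by rewrite mul1r mulr1 -mulrA ler_pM// ?mulr_ge0// mulrC.
- apply: mboundW (mbound_mul (mbound_mul bb bw) (mbound_ctrmx bb)); apply: small.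
  by rewrite !mul1r ler_wpM2r// ler_wpM2r// (le_trans b1).
- have -> : U *m W *m ctrmx U - 1%:M = U *m (W - 1%:M) *m ctrmx U.
    by rewrite mulmxBr mulmxBl mulmx1 u2.
  apply: mboundW (mbound_mul (mbound_mul bU bW) (mbound_ctrmx bU)).
  rewrite mul1r mulr1 expr2 -mulrA ler_pM ?mulr_ge0//.
  by rewrite ler_pM.
- apply: mboundW (mbound_mul (mbound_mul bU bv) (mbound_ctrmx bb)); apply: small.
  by rewrite !mul1r -mulrA mulrA ler_wpM2r// ler_wpM2r.
- have -> : c%:M *m a *m ctrmx b%:M - 1%:M = c%:M *m (a - 1%:M) *m ctrmx (b%:M : 'M[k]_1).
    by rewrite mulmxBr mulmxBl mulmx1 cb.
  by apply: mbound_scalar_conj; [exact: (mboundW xN)|rewrite mulrC].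
Qed.

Section Group.
Variables (Gam Z : set G) (K : set pt).
Hypotheses (sGam : subgroup Gam) (dGam : discrete Gam) (ZGam : Z `<=` Gam)
  (sZ : subgroup Z) (iZ : Z `<=` @isom R s n)
  (bK : forall p, K p -> boundary p /\ gauge p <= 1)
  (cov : @boundary R s n `<=` \bigcup_(a in Z) act_image a K).

Lemma normalise_cusps g : Gam g -> act g None <> None ->
  exists g', [/\ Gam g', jac g' None = jac g None,
    exists2 p, K p & act g' None = Some p &
    exists2 p, K p & act g' (Some p) = None].
Proof.
move=> gG; case E : (act g None) => [p|//] _.
have bp : boundary p by have := bd_act g (I : bd None); rewrite E.
case E' : (act g^-1%g None) => [q|]; last first.
  by have := actVK g (I : bd None); rewrite E' E.
have bq : boundary q by have := bd_act g^-1%g (I : bd None); rewrite E'.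
have [a Za [x Kx Ex]] := cov bp; have [b Zb [y Ky Ey]] := cov bq.
have [bx _] := bK Kx; have [by' _] := bK Ky.
have b0 := (iZ Zb).1; have a0 := (iZ Za).1.
have bN : bd (None : option pt) by [].
exists (a^-1 * g * b)%g; split.
- by do !apply: subgroupM => //; [apply: subgroupV => //|]; exact: ZGam.
- rewrite jacM// b0 jacM// (isom_jac n_gt0 (iZ Zb)).1 mulr1 E.
  by rewrite (isom_jac n_gt0 (iZ (subgroupV sZ Za))).2 ?mul1r.
- by exists x => //; rewrite actM// b0 actM// E -Ex actK.
- exists y => //; rewrite (actM _ _ (by' : bd (Some y))) Ey.
  by rewrite (actM _ _ (bq : bd (Some q))) -E' (actVK _ bN) (act_stabV a0).
Qed.

(** An analogue of Shimizu's lemma. As [H] is chosen before [g], its translation part has a fixed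
    bound, and the denominator of [g] alone decides how close the conjugate is to the identity. A
    trivial conjugate would make [H] trivial. *)
Lemma denominators_bounded_below :
  exists2 kap, 0 < kap & forall g, Gam g -> act g None <> None -> kap <= jac g None.
Proof.
have [e e0 He] := dGam; have N1 := N_ge1; have N0 : 0 < N := lt_le_trans ltr01 N1.
(* The final conjugate differs from the identity by at most [4 * N ^+ 4 * x], which is [e / 2]; the
   4 comes from two translations with entries bounded by 2. *)
pose x := e / (8 * N ^+ 4); have x0 : 0 < x by rewrite divr_gt0// mulr_gt0// exprn_gt0.
have [H [ZH H1 [a [v [W [c [y [d [EH [ba bW bd']]]]]]]]]] :=
  isom_small_rotation x0 sZ iZ (isom_infinite n_gt0 sZ iZ bK cov).
have [M M0 bM] := mbound_ex (mx_of H).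
(* Bound for [H] conjugated by the translation to any point of [K]. *)
pose C := N * (N * (2 * M) * 2).
have C0 : 0 <= C by rewrite /C !mulr_ge0// ltW.
pose kap := Num.min 1 (x / (N * (C + 1))).
have kap0 : 0 < kap.
  by rewrite lt_min ltr01/= divr_gt0// mulr_gt0// ltr_wpDl.
exists kap => // g0 G0 g00.
have [g [gG <- [p' Kp' Ep'] [p Kp Ep]]] := normalise_cusps G0 g00.
rewrite leNgt; apply/negP => gk; apply: H1.
have [bp p1] := bK Kp; have [bp' p1'] := bK Kp'.
have [b [b0 _ jb Eb]] := act_repr g (I : bd None); rewrite Ep' in Eb.
have [c' [c0 _ jc Ec]] := act_repr g (bp : bd (Some p)); rewrite Ep in Ec.
(* [g] with the image and the preimage of infinity both moved to 0. *)
pose D := ((tau bp')^-1 * repr g * tau bp)%g.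
have [D1 D2] : mx_of D *m phi None = phi (Some 0) *m b%:M /\
    mx_of D *m phi (Some 0) = phi None *m c'%:M.
  have T1 : mx_of (tau bp')^-1%g *m phi (Some p') = phi (Some 0).
    by rewrite -(tau_0 bp') mulmxA -mx_of_mul mulVg mul1mx.
  have T2 : mx_of (tau bp')^-1%g *m phi None = phi None.
    by rewrite -{1}(tau_None bp') mulmxA -mx_of_mul mulVg mul1mx.
  rewrite !mx_of_mul; move: (mx_of (tau bp')^-1%g) T1 T2 => T T1 T2.
  by rewrite -!mulmxA tau_None tau_0 Eb Ec !mulmxA T1 T2.
have [U [ED HU]] := unitary_antidiagonal b0 c0 D1 D2.
have [v' [w' [y' EH']]] := tau_conj_lower bp EH.
set H' := ((tau bp)^-1 * H * tau bp)%g in EH'.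
have bH' : mbound C (mx_of H').
  rewrite !mx_of_mul; apply: mbound_mul (tau_bound bp p1).1.
  exact: mbound_mul (tau_bound bp p1).2 bM.
have nb : knorm b < kap by rewrite -jb.
have nb1 : knorm b <= 1 by apply: le_trans (ltW nb) _; rewrite ge_min lexx.
have bx : N * C * knorm b <= x.
  have : knorm b <= x / (N * (C + 1)).
    by apply: le_trans (ltW nb) _; rewrite ge_min lexx orbT.
  rewrite ler_pdivlMr ?mulr_gt0 ?ltr_wpDl// mulrC; apply: le_trans.
  by rewrite ler_wpM2r ?knorm_ge0// ler_wpM2l ?(ltW N0)// lerDl.
have := antidiagonal_conj_bound ED HU EH' (ltW x0) C0 bH' ba bW bd' nb1 bx.
set X := (D * H' * D^-1)%g => bX.
have EX : (repr g * H * (repr g)^-1 = tau bp' * X * (tau bp')^-1)%g.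
  by rewrite /X /D /H' !invgM invgK !mulgA mulgV mul1g !mulgK.
have : proj (repr g * H * (repr g)^-1)%g = 1%g.
  apply: He => [i j|]; last first.
    rewrite !projM projV proj_repr; apply: subgroupM => //; last exact: subgroupV.
    by apply: subgroupM => //; exact: ZGam.
  have EM : mx_of (repr g * H * (repr g)^-1)%g - 1%:M =
      mx_of (tau bp') *m (mx_of X - 1%:M) *m mx_of (tau bp')^-1%g.
    by rewrite EX mulmxBr mulmxBl mulmx1 -!mx_of_mul mulgV.
  have -> : mx_of (repr g * H * (repr g)^-1)%g i j - (1%:M : mat) i j =
      (mx_of (tau bp') *m (mx_of X - 1%:M) *m mx_of (tau bp')^-1%g) i j.
    by rewrite -EM [RHS]mxE; congr (_ + _); rewrite [RHS]mxE.
  apply: le_lt_trans (mbound_mul (mbound_mul (tau_bound bp' p1').1 bX)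
    (tau_bound bp' p1').2 i j) _.
  have -> : N * (N * (2 * (N ^+ 2 * x)) * 2) = e / 2.
    by rewrite /x; field; rewrite gt_eqF.
  by rewrite ltr_pdivrMr// ltr_pMr// ltr1n.
rewrite !projM projV proj_repr => h.
have : (g^-1 * (g * proj H * g^-1) * g)%g = 1%g by rewrite h mulg1 mulVg.
by rewrite !mulgA mulVg mul1g mulgVK.
Qed.

End Group.

End SmallDenominators.

Section Countable.
Variables (R : realType) (s : scalars) (n : nat).
Local Notation k := (scal R s).
Local Notation G := (PU R s n).
Local Notation mat := 'M[k]_(1 + n + 1).
Local Notation N := ((1 + n + 1)%:R : R).

Lemma formJ_mbound : mbound 1 (formJ R s n).
Proof.
have z0 m l : mbound 1 (0 : 'M[k]_(m, l)) := mbound0 s ler01.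
have bN : mbound 1 (- 1%:M : 'M[k]_1) := mbound_opp (@mbound1 R s 1).
rewrite b3_formJ.
exact: (b3_mbound (z0 _ _) (z0 _ _) bN (z0 _ _) (@mbound1 R s n) (z0 _ _) bN (z0 _ _) (z0 _ _)).
Qed.

(** Only finitely many elements have entries bounded by [m]: two distinct ones of the same colour
    would have a quotient too close to the identity. The formula for the inverse through [formJ]
    bounds the inverse along with the matrix. *)
Lemma discrete_countable (Gam : set G) : subgroup Gam -> discrete Gam -> countable Gam.
Proof.
move=> sG [e e0 He]; have N1 := N_ge1 R n; have N0 : 0 < N := lt_le_trans ltr01 N1.
pose Gm (m : nat) := Gam `&` [set g | mbound m%:R (mx_of (repr g))].
have -> : Gam = \bigcup_m Gm m.
  apply/seteqP; split=> [g Gg|g [m _ []]//].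
  have [B B0 bB] := mbound_ex (mx_of (repr g)).
  exists (Num.truncn B).+1 => //; split=> //.
  by apply: mboundW bB; rewrite ltW// truncnS_gt.
apply: bigcup_countable => // m _; apply: finite_set_countable.
apply: contrapT => inf.
pose B := N * (N * (1 * m%:R) * 1) : R.
have B0 : 0 <= B by rewrite !mulr_ge0// ltW.
pose d := e / (2 * (N * (B + 1))).
have B10 : 0 < B + 1 by rewrite ltr_wpDl.
have d0 : 0 < d by rewrite divr_gt0// !mulr_gt0.
have [F [col colP]] := @grid_colouring R s (1 + n + 1) (1 + n + 1) m%:R d d0.
have [g [h [[Gg bg] [Gh bh] gh E]]] := pigeonhole (fun g : G => col (mx_of (repr g))) inf.
have bd := colP _ _ bh bg (esym E).
have bV : mbound B (mx_of (repr g)^-1%g).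
  rewrite mx_of_inv; apply: mbound_mul formJ_mbound.
  exact: mbound_mul formJ_mbound (mbound_ctrmx bg).
apply: gh; have : proj ((repr g)^-1 * repr h)%g = 1%g.
  apply: He => [i j|]; last first.
    by rewrite projM projV !proj_repr; apply: subgroupM => //; exact: subgroupV.
  have EM : mx_of ((repr g)^-1 * repr h)%g - 1%:M =
      mx_of (repr g)^-1%g *m (mx_of (repr h) - mx_of (repr g)).
    by rewrite mulmxBr -!mx_of_mul mulVg.
  have -> : mx_of ((repr g)^-1 * repr h)%g i j - (1%:M : mat) i j =
      (mx_of (repr g)^-1%g *m (mx_of (repr h) - mx_of (repr g))) i j.
    by rewrite -EM [RHS]mxE; congr (_ + _); rewrite [RHS]mxE.
  apply: le_lt_trans (mbound_mul bV bd i j) _.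
  have -> : N * (B * d) = (e / 2) * (B / (B + 1)).
    by rewrite /d; field; rewrite !gt_eqF.
  apply: (@le_lt_trans _ _ (e / 2)).
    by rewrite ler_piMr ?divr_ge0 ?(ltW e0)// ler_pdivrMr// mul1r lerDl.
  by rewrite ltr_pdivrMr// ltr_pMr// ltr1n.
rewrite projM projV !proj_repr => h1.
by rewrite -[h](mulVKg g) h1 mulg1.
Qed.

End Countable.

(** * Dynamics and convergence *)

Section CuspForm.
Variables (R : realType) (s : scalars) (n : nat).
Local Notation k := (scal R s).
Local Notation G := (PU R s n).
Local Notation pt := ('cV[k]_n * k)%type.
Implicit Types (g h : G) (x y : pt) (P : option pt).

(* [|<phi(P), v>|] for the vector [v] obtained by applying [g] to the vector of
   infinity. *)
Definition hn P g : R := nn P (act g None) * jac g None.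

Lemma hn_ge0 P g : 0 <= hn P g.
Proof. by rewrite mulr_ge0 ?nn_ge0// ltW// jac_gt0. Qed.

Lemma hn_act g P h : bd P -> hn (act g P) (g * h)%g * jac g P = hn P h.
Proof.
move=> bP; have bh := bd_act h (I : bd None).
rewrite /hn actM// jacM// -[in RHS](nn_act g bP bh) //.
by ring.
Qed.

Lemma hn_None_fin g : act g None <> None -> hn None g = jac g None.
Proof. by rewrite /hn; case: (act g None) => // p _; rewrite nn_None_fin mul1r. Qed.

Lemma hn1 x : hn (Some x) 1%g = 1.
Proof. by rewrite /hn act1 jac1 mulr1 nnC nn_None_fin. Qed.

Lemma hn_None1 : hn None (1%g : G) = 0.
Proof. by rewrite /hn act1 nn_None mul0r. Qed.

(** The triangle inequality in a form that includes infinity. For finite [P] the square roots are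
    distances and the last factor is 1; for infinite [P] the pairings with [x] and [y] are 1 and the
    correction vanishes. *)
Lemma sqrt_nn_triangle x y P : boundary x -> boundary y -> bd P ->
  Num.sqrt (nn (Some y) P) <=
  Num.sqrt (nn (Some x) P) + dist x y * Num.sqrt (nn None P).
Proof.
move=> bx by' ; case: P => [p|] /= bp; last first.
  by rewrite [nn (Some y) _]nnC [nn (Some x) _]nnC !nn_None_fin nn_None sqrtr0 mulr0 addr0.
rewrite nn_None_fin !nn_fin// !sqrtr_sqr sqrtr1 mulr1.
rewrite !ger0_norm ?dist_ge0// addrC (distC bx by').
exact: dist_triangle.
Qed.

Lemma sqrt_hn_triangle x y g : boundary x -> boundary y ->
  Num.sqrt (hn (Some y) g) <=
  Num.sqrt (hn (Some x) g) + dist x y * Num.sqrt (hn None g).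
Proof.
move=> bx by'; have bP := bd_act g (I : bd None).
rewrite /hn !sqrtrM ?nn_ge0// mulrA -mulrDl ler_wpM2r ?sqrtr_ge0//.
exact: sqrt_nn_triangle.
Qed.

End CuspForm.

Section Dynamics.
Variables (R : realType) (s : scalars) (n : nat).
Hypothesis n_gt0 : (0 < n)%N.
Local Notation k := (scal R s).
Local Notation G := (PU R s n).
Local Notation pt := ('cV[k]_n * k)%type.
Variable C : iwasawa_cf R s n.
Local Notation iota := (cf_inv C).
Local Notation Z := (cf_lattice C).
Local Notation K := (cf_domain C).
Local Notation T := (cf_shift C).
Local Notation Gam := (modular_group C).
Implicit Types (g h : G) (x y : pt) (P : option pt).

Lemma iota_0 : act iota (Some 0) = None. Proof. by have [] := cf_invP C. Qed.
Lemma iota_None : act iota None = Some 0. Proof. by have [] := cf_invP C. Qed.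
Lemma iotaV_None : act iota^-1%g None = Some 0.
Proof. by rewrite -iota_0 actK//; exact: boundary0. Qed.
Lemma iota_fin x : boundary x -> x != 0 ->
  exists q, [/\ boundary q, act iota (Some x) = Some q & gauge q = (gauge x)^-1].
Proof.
move=> bx x0; have [_ _ /(_ x (or_intror bx) x0) [q Eq [gq _]]] := cf_invP C.
by exists q; split=> //; have := bd_act iota (bx : bd (Some x)); rewrite Eq.
Qed.

Lemma gauge_neq0 x : boundary x -> x != 0 -> 0 < gauge x.
Proof.
move=> bx x0; rewrite lt_def gauge_ge0 andbT; apply/eqP => /gauge_eq0 h.
by move: x0; rewrite h// eqxx.
Qed.

Lemma jac_iota_aux x : boundary x -> x != 0 ->
  jac iota (Some x) * jac iota None = gauge x ^+ 2 /\
  jac iota (Some x) * jac iota (Some 0) = gauge x ^+ 2.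
Proof.
move=> bx x0; have [q [bq Eq gq]] := iota_fin bx x0.
have gx := gauge_neq0 bx x0; have b0 : boundary (0 : pt) := boundary0 _ _ _.
split.
  have := @nn_act _ _ _ iota (Some x) None bx I.
  rewrite Eq iota_None nn_fin// distC// dist0 gq nnC nn_None_fin -mulrA => h.
  by apply: (mulfI (_ : (gauge x)^-1 ^+ 2 != 0));
    rewrite ?h -?exprMn ?mulVf ?gt_eqF ?expr1n// exprn_gt0// invr_gt0.
have := @nn_act _ _ _ iota (Some x) (Some 0) bx b0.
by rewrite Eq iota_0 nnC nn_None_fin mul1r nn_fin// distC// dist0.
Qed.

(** The rule for gauges determines the products of [jac] at [x] with [jac] at infinity and at 0, so
    the latter two agree. As [iota] exchanges 0 and infinity, their product is 1. *)
Lemma jac_iota : [/\ jac iota None = 1, jac iota (Some 0) = 1 &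
  forall x, boundary x -> x != 0 -> jac iota (Some x) = gauge x ^+ 2].
Proof.
have b0 : boundary (0 : pt) := boundary0 _ _ _.
have [p [bp p1]] := far_point s n_gt0 (ler01 : 0 <= 1 :> R).
have p0 : p != 0.
  apply: contraTneq p1 => ->; rewrite -ltNge.
  by rewrite -dist0 /dist oppr0 hmul0p /gauge vsqnorm0 kre0 normr0 addr0 kreal0
    kim0 addr0 knorm0 sqrtr0 ltr01.
have [h1 h2] := jac_iota_aux bp p0.
have E : jac iota None = jac iota (Some 0).
  by apply: (mulfI (lt0r_neq0 (jac_gt0 iota (bp : bd (Some p))))); rewrite h1 h2.
have := @nn_act _ _ _ iota None (Some 0) I b0.
rewrite iota_0 iota_None nnC nn_None_fin mul1r -E -expr2 => /eqP.
rewrite sqrp_eq1 ?ltW ?jac_gt0// => /eqP E1.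
rewrite E1; split=> //.
by move=> x bx x0; have [] := jac_iota_aux bx x0; rewrite E1 mulr1.
Qed.

Lemma Z_sub : subgroup Z. Proof. by have [] := cf_latticeP C. Qed.
Lemma Z_isom : Z `<=` @isom R s n. Proof. by have [] := cf_latticeP C. Qed.
Lemma Gam_sub : subgroup Gam.
Proof.
split=> [H [[]]//|g h Gg Gh H [sH HH]]; apply: sH.2.
  exact: Gg.
exact: Gh.
Qed.

Lemma Z_Gam : Z `<=` Gam. Proof. by move=> g Zg H [_]; apply; right. Qed.
Lemma iota_Gam : Gam iota. Proof. by move=> H [_]; apply; left. Qed.
Lemma K_boundary x : K x -> boundary x.
Proof. by have [[KB _] _ _] := cf_domainP C; exact: KB. Qed.
Lemma K_cover : @boundary R s n = \bigcup_(a in Z) act_image a K.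
Proof. by have [] := cf_domainP C. Qed.

Lemma hn_isom a h : Z a -> hn None (a * h)%g = hn None h.
Proof.
move=> /Z_isom ia; rewrite -[RHS](@hn_act _ _ _ a None h I) ia.1.
by rewrite (isom_jac n_gt0 ia).1 mulr1.
Qed.

Lemma hn_iota h : hn None (iota * h)%g = hn (Some 0) h.
Proof.
rewrite -(@hn_act _ _ _ iota (Some 0) h); last exact: boundary0.
by rewrite iota_0; have [_ -> _] := jac_iota; rewrite mulr1.
Qed.

Lemma cf_step x : K x -> x != 0 ->
  [/\ Z (cf_digit C x), K (T x),
    act ((cf_digit C x)^-1 * iota)%g (Some x) = Some (T x) &
    jac ((cf_digit C x)^-1 * iota)%g (Some x) = gauge x ^+ 2].
Proof.
move=> Kx x0; have bx := K_boundary Kx; have [q [bq Eq gq]] := iota_fin bx x0.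
rewrite /cf_shift (negbTE x0) /cf_digit Eq /=.
have [Zd [y Ky Ey]] := @cf_roundP _ _ _ C q bq.
split=> //; first by rewrite Ey.
  by rewrite actM// Eq Ey.
rewrite jacM// Eq; have [_ _ ->//] := jac_iota.
by rewrite (isom_jac n_gt0 (Z_isom (subgroupV Z_sub Zd))).2// mul1r.
Qed.

Definition cf_prod x i : R := \prod_(j < i) gauge (iter j T x).

Lemma cf_iter x i : K x -> ~ cf_finite C x -> K (iter i T x) /\ iter i T x != 0.
Proof.
move=> Kx fx; have nz j : iter j T x != 0 by apply/eqP => h; apply: fx; exists j.
split=> //; elim: i => //= i IH; by have [] := cf_step IH (nz i).
Qed.

Lemma cf_prod_gt0 x i : K x -> ~ cf_finite C x -> 0 < cf_prod x i.
Proof.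
move=> Kx fx; apply: prodr_gt0 => j _; have [Kj j0] := cf_iter j Kx fx.
by apply: gauge_neq0 => //; exact: K_boundary.
Qed.

Lemma cf_mx_spec x i : K x -> ~ cf_finite C x ->
  [/\ Gam (cf_mx C x i), act (cf_mx C x i) (Some (iter i T x)) = Some x,
      act (cf_mx C x i)^-1%g (Some x) = Some (iter i T x) &
      jac (cf_mx C x i)^-1%g (Some x) = cf_prod x i ^+ 2].
Proof.
move=> Kx fx; have bx := K_boundary Kx.
suff [G1 E J] : [/\ Gam (cf_mx C x i),
      act (cf_mx C x i)^-1%g (Some x) = Some (iter i T x) &
      jac (cf_mx C x i)^-1%g (Some x) = cf_prod x i ^+ 2].
  by split=> //; rewrite -E actVK.
elim: i => [|i [G1 E J]] /=.
  split; [exact: (Gam_sub).1|by rewrite invg1 act1|].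
  by rewrite invg1 jac1 /cf_prod big_ord0 expr1n.
have [Ki i0] := cf_iter i Kx fx; have [Zd _ E1 J1] := cf_step Ki i0.
rewrite !invgM invgK !mulgA; split.
- apply: (subgroupM Gam_sub); last exact: Z_Gam.
  by apply: (subgroupM Gam_sub) => //; exact: (subgroupV Gam_sub iota_Gam).
- by rewrite actM// E E1.
- by rewrite jacM// E J1 J /cf_prod big_ord_recr /= exprMn mulrC.
Qed.

(* The recursion behind all Diophantine estimates. *)
Lemma hn_cf_step x i g : K x -> ~ cf_finite C x ->
  Num.sqrt (hn None ((cf_mx C x i.+1)^-1 * g)%g) <=
  gauge (iter i T x) * Num.sqrt (hn None ((cf_mx C x i)^-1 * g)%g) +
  Num.sqrt (hn (Some x) g) / cf_prod x i.
Proof.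
move=> Kx fx; have bx := K_boundary Kx; have pi0 := cf_prod_gt0 i Kx fx.
have [Ki i0] := cf_iter i Kx fx; have [Zd _ _ _] := cf_step Ki i0.
have [_ _ E J] := cf_mx_spec i Kx fx.
rewrite /= !invgM invgK -!mulgA hn_isom ?hn_iota; last first.
  exact: subgroupV Z_sub Zd.
(* With the digit and [iota] removed, the left side is a value at 0. Passing from 0 to [iter i T x]
   costs the gauge of that point times the value at infinity. *)
have := sqrt_hn_triangle ((cf_mx C x i)^-1 * g)%g (K_boundary Ki) (boundary0 _ _ _).
move/le_trans; apply; rewrite addrC distC//; [|exact: K_boundary|exact: boundary0].
rewrite dist0 lerD2l.
have := hn_act (cf_mx C x i)^-1%g g (bx : bd (Some x)).
rewrite E J => <-; rewrite [in leRHS]sqrtrM ?hn_ge0// sqrtr_sqr gtr0_norm//.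
by rewrite mulfK// gt_eqF.
Qed.

Section Proper.
Variables (r kap : R).
Hypotheses (r0 : 0 <= r) (r1 : r < 1) (Kr : forall x, K x -> gauge x <= r).
Hypotheses (kap0 : 0 < kap)
  (Hkap : forall g, Gam g -> act g None <> None -> kap <= jac g None).

Lemma cf_prod_le x i : K x -> ~ cf_finite C x -> cf_prod x i <= r ^+ i.
Proof.
move=> Kx fx; rewrite -[i in leRHS]card_ord -prodr_const; apply: ler_prod => j _.
by rewrite gauge_ge0 Kr//; have [] := cf_iter j Kx fx.
Qed.

(** Iterating [hn_cf_step] accumulates errors. One more step multiplies the old error by the next
    gauge, while the new error is the old one divided by the current gauge. The ratio is a product
    of two gauges, at most [r ^+ 2], and the errors sum like a geometric series. *)
Lemma hn_cf_le x i g : K x -> ~ cf_finite C x ->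
  Num.sqrt (hn None ((cf_mx C x i.+1)^-1 * g)%g) <=
  cf_prod x i.+1 * Num.sqrt (hn None g) +
  Num.sqrt (hn (Some x) g) / cf_prod x i / (1 - r ^+ 2).
Proof.
move=> Kx fx; set tau := Num.sqrt (hn (Some x) g).
have tau0 : 0 <= tau by exact: sqrtr_ge0.
have r21 : 0 < 1 - r ^+ 2 by rewrite subr_gt0 expr_lt1.
elim: i => [|i IH].
  apply: le_trans (hn_cf_step 0 g Kx fx) _; rewrite /= invg1 mul1g.
  rewrite /cf_prod big_ord_recl !big_ord0 mulr1 divr1 lerD2l.
  by rewrite ler_pdivlMr// ler_piMr// gerBl sqr_ge0.
apply: le_trans (hn_cf_step i.+1 g Kx fx) _; rewrite -/tau.
have [Ki i0] := cf_iter i Kx fx; have [Ki1 i10] := cf_iter i.+1 Kx fx.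
have g0 : 0 < gauge (iter i T x) by apply: gauge_neq0 => //; exact: K_boundary.
have g10 := gauge_ge0 (iter i.+1 T x).
apply: le_trans (lerD (ler_wpM2l g10 IH) (lexx _)) _.
rewrite mulrDr -addrA mulrA [gauge _ * cf_prod _ _]mulrC.
have -> : cf_prod x i.+1 * gauge (iter i.+1 T x) = cf_prod x i.+2.
  by rewrite [in RHS]/cf_prod big_ord_recr.
rewrite lerD2l.
have pE : cf_prod x i.+1 = cf_prod x i * gauge (iter i T x).
  by rewrite /cf_prod big_ord_recr.
have p1 := cf_prod_gt0 i.+1 Kx fx; have p := cf_prod_gt0 i Kx fx.
have -> : gauge (iter i.+1 T x) * (tau / cf_prod x i / (1 - r ^+ 2)) =
    (tau / cf_prod x i.+1 / (1 - r ^+ 2)) *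
    (gauge (iter i.+1 T x) * gauge (iter i T x)).
  by rewrite pE; field; rewrite !gt_eqF.
have -> : tau / cf_prod x i.+1 = tau / cf_prod x i.+1 / (1 - r ^+ 2) * (1 - r ^+ 2).
  by rewrite mulfVK// gt_eqF.
have t0 : 0 <= tau / cf_prod x i.+1 / (1 - r ^+ 2).
  by rewrite !divr_ge0// ltW.
rewrite mulfVK ?gt_eqF// -[X in _ + X <= _](mulfVK (_ : 1 - r ^+ 2 != 0)) ?gt_eqF//.
rewrite -mulrDr ler_piMr// -lerBrDr opprB addrC subrK expr2.
by apply: ler_pM; rewrite ?gauge_ge0// Kr.
Qed.

(** The index shifts by one because digits fix infinity and [iota^-1] sends infinity to 0. *)
Lemma cf_convergentE x i : K x -> ~ cf_finite C x ->
  cf_convergent C x i = act (cf_mx C x i.+1) None.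
Proof.
move=> Kx fx; have [Ki i0] := cf_iter i Kx fx; have [Zd _ _ _] := cf_step Ki i0.
have d0 := (Z_isom Zd).1.
by rewrite /= actM// d0 actM// iotaV_None.
Qed.

(* A stabiliser of infinity that is not an isometry would conjugate [iota] to
   elements with arbitrarily small denominators. *)
Lemma stab_jac_ge1 g : Gam g -> act g None = None -> 1 <= jac g None.
Proof.
move=> Gg g0; rewrite leNgt; apply/negP => j1.
have bN : bd (None : option pt) := I.
have jg0 : 0 < jac g None := jac_gt0 g bN.
have b0 : boundary (0 : pt) := boundary0 _ _ _.
(* Each conjugation by [g] multiplies the denominator by [jac g None ^+ 2]; that of [iota] is 1. *)
have Hm m : exists h, [/\ Gam h, act h None <> None & jac h None = (jac g None ^+ 2) ^+ m].
  elim: m => [|m [h [Gh h0 jh]]].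
    by exists iota; split; [exact: iota_Gam|rewrite iota_None|rewrite expr0; have [] := jac_iota].
  exists (g^-1 * h * g)%g; split.
  - exact: subgroupM Gam_sub (subgroupM Gam_sub (subgroupV Gam_sub Gg) Gh) Gg.
  - rewrite (actM _ g bN) g0 (actM g^-1%g h bN) => E; apply: h0.
    by apply: (act_inj (bd_act h bN) bN (g := g^-1%g)); rewrite E (act_stabV g0).
  rewrite (jacM _ g bN) g0 (jacM g^-1%g h bN) jh.
  case E : (act h None) h0 => [q|//] _.
  have bq : boundary q by have := bd_act h (I : bd None); rewrite E.
  suff -> : jac g^-1%g (Some q) = jac g None by rewrite mulrAC -expr2 -exprS.
  have [q' bq' Eq'] := act_stab_fin (act_stabV g0) bq.
  have := @nn_act _ _ _ g^-1%g None (Some q) I bq.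
  rewrite Eq' (act_stabV g0) !nn_None_fin mul1r -{1}g0 jacV// => E1.
  by apply: (mulfI (_ : (jac g None)^-1 != 0)); rewrite ?E1 ?mulVf ?invr_eq0 ?gt_eqF.
have j2 : `|jac g None ^+ 2| < 1.
  by rewrite ger0_norm ?sqr_ge0// expr_lt1// ltW.
have /cvgrPdist_lt /(_ _ kap0) [m _ /(_ m (leqnn m))] := cvg_expr j2.
have [h [Gh h0 <-]] := Hm m; rewrite sub0r normrN (ger0_norm (ltW (jac_gt0 h bN))).
by rewrite ltNge Hkap.
Qed.

(** Transported to the tail of [x], the form becomes the pairing with infinity, which is 1; the
    cocycle then gives the squared product of gauges. This is less than 1, whereas [stab_jac_ge1]
    would make it at least 1 if the cusp were infinity. *)
Lemma cf_mx_dist x i : K x -> ~ cf_finite C x -> exists q, [/\ boundary q,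
  act (cf_mx C x i.+1) None = Some q &
  dist x q ^+ 2 * jac (cf_mx C x i.+1) None = cf_prod x i.+1 ^+ 2].
Proof.
move=> Kx fx; have bx := K_boundary Kx.
have [GM E1 E2 J] := cf_mx_spec i.+1 Kx fx.
set M := cf_mx C x i.+1 in GM E1 E2 J *.
have p0 := cf_prod_gt0 i.+1 Kx fx.
have H : hn (Some x) M = cf_prod x i.+1 ^+ 2.
  have := @hn_act _ _ _ M^-1%g (Some x) M bx.
  by rewrite mulVg E2 hn1 mul1r J.
have [fin|inf] := pselect (act M None = None).
  have := stab_jac_ge1 GM fin.
  move: H; rewrite /hn fin nnC nn_None_fin mul1r => ->; rewrite leNgt expr_lt1 ?(ltW p0)//.
  have /(_ i.+1) := @cf_prod_le x _ Kx fx => h.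
  by rewrite (le_lt_trans h) ?exprn_ilt1.
move: H; rewrite /hn; case E : (act M None) => [q|] //.
have bq : boundary q by have := bd_act M (I : bd None); rewrite E.
by rewrite nn_fin// => H; exists q.
Qed.

Lemma cf_dist_le x i : K x -> ~ cf_finite C x -> exists q, [/\ boundary q,
  act (cf_mx C x i.+1) None = Some q & dist x q <= cf_prod x i.+1 / Num.sqrt kap].
Proof.
move=> Kx fx; have [q [bq E D]] := cf_mx_dist i Kx fx; exists q; split=> //.
have [GM _ _ _] := cf_mx_spec i.+1 Kx fx.
have p0 := cf_prod_gt0 i.+1 Kx fx.
rewrite ler_pdivlMr ?sqrtr_gt0// -ler_sqr ?nnegrE ?mulr_ge0 ?sqrtr_ge0 ?dist_ge0 ?(ltW p0)//.
rewrite exprMn (sqr_sqrtr (ltW kap0)) -D ler_wpM2l ?sqr_ge0//.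
by apply: Hkap; rewrite // E.
Qed.

Lemma cf_prod_cvg x (e : R) : K x -> ~ cf_finite C x -> 0 < e ->
  \forall i \near \oo, cf_prod x i.+1 < e.
Proof.
move=> Kx fx e0; have rn : `|r| < 1 by rewrite ger0_norm.
have /cvgrPdist_lt /(_ _ e0) [m _ Hm] := cvg_expr rn.
exists m => // i /= mi; apply: le_lt_trans (cf_prod_le i.+1 Kx fx) _.
have := Hm i.+1 (leqW mi); rewrite sub0r normrN ger0_norm// exprn_ge0//.
Qed.

Lemma cf_converges_all x : K x -> cf_converges C x.
Proof.
move=> Kx; have [fx|fx] := pselect (cf_finite C x); [by left|right=> e e0].
have bx := K_boundary Kx.
have ek : 0 < e * Num.sqrt kap by rewrite mulr_gt0// sqrtr_gt0.
near=> i; have [q [bq E D]] := cf_dist_le i Kx fx; exists q.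
  by rewrite cf_convergentE.
rewrite distC//; apply: le_lt_trans D _; rewrite ltr_pdivrMr ?sqrtr_gt0//.
by near: i; exact: cf_prod_cvg.
Unshelve. all: by end_near. Qed.

End Proper.

Lemma cf_proper_radius : cf_proper C ->
  exists r, [/\ 0 <= r, r < 1 & forall x, K x -> gauge x <= r].
Proof.
rewrite /cf_proper => sup1; set S := ereal_sup _ in sup1.
have [[x0 Kx0]|K0] := pselect (exists x, K x); last first.
  by exists 0; split=> // x Kx; case: K0; exists x.
have ub x : K x -> ((gauge x)%:E <= S)%E.
  by move=> Kx; apply: ereal_sup_ubound; exists x.
have Sf : S \is a fin_num.
  rewrite fin_numE; apply/andP; split.
    by apply/eqP => h; have := ub _ Kx0; rewrite h leeNy_eq.
  by apply/eqP => h; move: sup1; rewrite h.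
have ub' x : K x -> gauge x <= fine S by move=> /ub; rewrite -lee_fin fineK.
exists (fine S); split=> //; first exact: le_trans (gauge_ge0 x0) (ub' _ Kx0).
by rewrite -lte_fin fineK.
Qed.

Lemma cf_discrete_denominators : cf_discrete C -> cf_proper C ->
  exists2 kap, 0 < kap & forall g, Gam g -> act g None <> None -> kap <= jac g None.
Proof.
move=> dG /cf_proper_radius[r [r0 r1 Kr]].
have [Zs Zi _ _] := cf_latticeP C.
apply: (denominators_bounded_below n_gt0 Gam_sub dG Z_Gam Zs Zi (K := K)).
  by move=> p Kp; split; [exact: K_boundary|exact: le_trans (Kr _ Kp) (ltW r1)].
by rewrite -K_cover.
Qed.

End Dynamics.

(** * Lebesgue measure on the boundary *)

Section WeightedCover.
Variables (R : realType) (I : eqType).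
Local Notation vol a b J := (\prod_(j <- J) Num.max 0 (b j - a j)).

Lemma vol_ge0 (a b : I -> R) J : 0 <= vol a b J.
Proof. by apply: prodr_ge0 => j _; rewrite le_max lexx. Qed.

Local Open Scope ereal_scope.

Lemma weighted_cover_1d (w : nat -> R) (W x y : R) (A B : nat -> R) :
  (forall i, (0 <= w i)%R) ->
  (forall t, (x <= t <= y)%R ->
    W%:E <= \sum_(i <oo) (w i * (A i <= t <= B i)%R%:R)%:E) ->
  (W * Num.max 0 (y - x))%:E <= \sum_(i <oo) (w i * Num.max 0 (B i - A i))%:E.
Proof.
move=> w0 H; have [yx|xy] := ltP y x.
  rewrite (max_idPl _) ?mulr0; last by rewrite subr_le0 ltW.
  by apply: nneseries_ge0 => i _ _; rewrite lee_fin mulr_ge0// le_max lexx.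
pose D := `[x, y]%classic : set R.
have len (a b : R) : lebesgue_measure (`[a, b]%classic : set R) = (Num.max 0 (b - a))%:E.
  rewrite lebesgue_measure_itv /= lte_fin; case: ltP => ab.
    by rewrite (max_idPr _) ?subr_ge0 ?ltW// EFinB.
  by rewrite (max_idPl _)// subr_le0.
have lenD : lebesgue_measure D = (Num.max 0 (y - x))%:E by exact: len.
have mD : measurable (D : set R) by exact: measurable_itv.
have cstD : \int[lebesgue_measure]_(t in D) (cst W%:E) t = (W * Num.max 0 (y - x))%:E.
  by rewrite integral_cst//; exact: (congr1 (fun z => W%:E * z) lenD).
rewrite -cstD.
pose f (i : nat) (t : measurableTypeR R) : \bar R := (w i)%:E * (\1_(`[A i, B i]%classic : set R) t)%:E.
have fE i t : f i t = (w i * (A i <= t <= B i)%R%:R)%:E.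
  rewrite /f indicE -EFinM; congr (_ * _)%:E; congr (_%:R).
  by rewrite mem_setE in_itv.
have f0 i t : 0 <= f i t by rewrite fE lee_fin mulr_ge0.
have mf i : measurable_fun (D : set (measurableTypeR R)) (f i).
  apply: measurable_funeM; apply/measurable_EFinP.
  exact: measurable_indic.
apply: (@le_trans _ _ (\int[lebesgue_measure]_(t in D) \sum_(i <oo) f i t)).
  have [W0|W0] := leP 0%R W; last first.
    apply: (@le_trans _ _ 0).
      by rewrite cstD lee_fin mulr_le0_ge0 ?le_max ?lexx ?(ltW W0).
    by apply: integral_ge0 => t _; apply: nneseries_ge0.
  apply: ge0_le_integral => //.
  - by apply: ge0_emeasurable_sum => [i t _ _|i _] //; exact: mf.
  - move=> t; rewrite /D /= in_itv /= => xty; apply: le_trans (H t xty) _.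
    by apply: lee_nneseries => // i _; rewrite ?fE// lee_fin mulr_ge0.
rewrite integral_nneseries//; apply: lee_nneseries => i _.
  by move=> _; apply: integral_ge0.
rewrite ge0_integralZl//; last first.
- by rewrite lee_fin.
- by apply/measurable_EFinP; exact: measurable_indic.
rewrite integral_indic// EFinM lee_wpmul2l ?lee_fin//.
have le_len : lebesgue_measure (`[A i, B i] `&` D) <= lebesgue_measure (`[A i, B i]%classic : set R).
  by apply: le_measure; rewrite ?inE//; exact: measurableI.
by apply: le_trans le_len _; rewrite len.
Qed.

(** With all weights 1, a box has at most the total volume of the boxes covering it. The weights
    drive the induction on coordinates: with coordinate [j] frozen at [t], the indicator of the
    slice joins the weight, and [weighted_cover_1d] then integrates over [t]. *)
Lemma weighted_cover (J : seq I) (w : nat -> R) (W : R) (a b : I -> R)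
    (A B : nat -> I -> R) :
  uniq J -> (forall i, (0 <= w i)%R) ->
  (forall v : I -> R, (forall j, j \in J -> (a j <= v j <= b j)%R) ->
    W%:E <= \sum_(i <oo) (w i * (all (fun j => A i j <= v j <= B i j)%R J)%:R)%:E) ->
  (W * vol a b J)%:E <= \sum_(i <oo) (w i * vol (A i) (B i) J)%:E.
Proof.
elim: J w W => [|j J IH] w W /=.
  move=> _ w0 /(_ a) H; rewrite big_nil mulr1; apply: le_trans (H _) _ => //.
  by under [leRHS]eq_eseriesr do rewrite big_nil.
move=> /andP[jJ uJ] w0 H; rewrite big_cons mulrCA mulrC.
under [leRHS]eq_eseriesr do rewrite big_cons mulrCA mulrC.
apply: weighted_cover_1d => [i|t xty]; first by rewrite mulr_ge0 ?vol_ge0.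
under eq_eseriesr do rewrite mulrAC.
apply: IH => // [i|v Hv]; first by rewrite mulr_ge0.
pose v' i := if i == j then t else v i.
have v'J i : i \in J -> v' i = v i.
  by rewrite /v'; case: eqP => // -> ij; rewrite ij in jJ.
apply: le_trans (H v' _) _.
  move=> i; rewrite inE => /orP[/eqP ->|iJ]; first by rewrite /v' eqxx.
  by rewrite v'J// Hv.
apply: lee_nneseries => i _; first by rewrite lee_fin mulr_ge0.
rewrite lee_fin -mulrA -natrM mulnb.
have -> : v' j = t by rewrite /v' eqxx.
have -> : all (fun j' => A i j' <= v' j' <= B i j')%R J =
    all (fun j' => A i j' <= v j' <= B i j')%R J.
  by apply: eq_in_all => j' /v'J ->.
by [].
Qed.

End WeightedCover.

Section Coordinates.
Variables (R : realType) (s : scalars) (n : nat).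
Local Notation k := (scal R s).
Local Notation pt := ('cV[k]_n * k)%type.
Local Notation idx := (('I_n * 'I_(kdim s)) + 'I_(kdim s))%type.
Implicit Types (p q a b : pt) (v : idx -> R).

(* The index [inr 0] of the real part of the last coordinate is excluded. *)
Definition vidx (j : idx) : bool := if j is inr l then (0 < l)%N else true.

Definition co p (j : idx) : R :=
  match j with
  | inl u => (kcoords (p.1 u.1 0))`_(u.2)
  | inr l => (kcoords p.2)`_l
  end.

Definition kofc (f : nat -> R) : k :=
  match s return scal R s with
  | RealScalars => f 0%N
  | ComplexScalars => Complex (f 0%N) (f 1%N)
  | QuaternionScalars => Quaternion (f 0%N) (f 1%N) (f 2%N) (f 3%N)
  end.

Lemma kofcK (f : nat -> R) l : (l < kdim s)%N -> (kcoords (kofc f))`_l = f l.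
Proof. by rewrite /kofc; case: (s) l => [[|l]|[|[|l]]|[|[|[|[|l]]]]]. Qed.

Lemma ord_kdim (f : 'I_(kdim s) -> R) : exists g : nat -> R, forall l, g (val l) = f l.
Proof.
have l0 : 'I_(kdim s) by case: (s); exists 0%N.
exists (fun l => f (insubd l0 l)) => l; congr f; apply: val_inj.
by rewrite val_insubd ltn_ord.
Qed.

Lemma mkpt_ex v : exists p, boundary p /\ forall j, vidx j -> co p j = v j.
Proof.
have [g Hg] := choice (fun i : 'I_n => ord_kdim (fun l => v (inl (i, l)))).
have [h Hh] := ord_kdim (fun l => v (inr l)).
exists (\col_i kofc (g i), kofc (fun l => if l is 0 then 0 else h l)); split.
  by rewrite /boundary /= /kre kofcK//; case: (s).
case=> [[i l]|l] /= hl; first by rewrite mxE kofcK// Hg.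
by rewrite kofcK// -Hh /=; case: (nat_of_ord l) hl.
Qed.

Definition mkpt v : pt := projT1 (cid (mkpt_ex v)).
Lemma mkpt_boundary v : boundary (mkpt v).
Proof. by rewrite /mkpt; case: cid => p /= []. Qed.
Lemma co_mkpt v j : vidx j -> co (mkpt v) j = v j.
Proof. by rewrite /mkpt; case: cid => p /= [_ H] /H. Qed.

Lemma boxE a b p : box a b p <->
  boundary p /\ forall j, vidx j -> co a j <= co p j <= co b j.
Proof.
split=> [[bp [H1 H2]]|[bp H]].
  by split=> // -[u|l] hl; [exact: (H1 u.1 u.2)|exact: (H2 l hl)].
split=> //; split=> [i l|l hl]; [exact: (H (inl (i, l)))|exact: (H (inr l))].
Qed.

Lemma box_volumeE a b :
  box_volume a b = \prod_(j | vidx j) Num.max 0 (co b j - co a j).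
Proof.
rewrite /box_volume big_sumType/=; congr (_ * _).
by rewrite pair_bigA.
Qed.

Lemma box_volume_ge0 a b : 0 <= box_volume a b.
Proof. by rewrite box_volumeE prodr_ge0// => j _; rewrite le_max lexx. Qed.

Lemma coD p q j : co (p + q) j = co p j + co q j.
Proof. by case: j => [u|l]; rewrite /= ?mxE kcoordsD. Qed.

End Coordinates.

Section OuterMeasure.
Variables (R : realType) (s : scalars) (n : nat).
Local Notation k := (scal R s).
Local Notation pt := ('cV[k]_n * k)%type.
Local Notation idx := (('I_n * 'I_(kdim s)) + 'I_(kdim s))%type.
Local Notation leb := (@leb R s n).
Implicit Types (p q a b : pt) (v : idx -> R) (A B : set pt).
Local Open Scope ereal_scope.

Lemma leb_ge0 A : 0 <= leb A.
Proof.
apply: le_ereal_inf_tmp => _ [a [b [_ ->]]].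
by apply: nneseries_ge0 => i _ _; rewrite lee_fin box_volume_ge0.
Qed.

Lemma leb_le_cover A (a b : nat -> pt) : A `<=` \bigcup_i box (a i) (b i) ->
  leb A <= \sum_(i <oo) (box_volume (a i) (b i))%:E.
Proof. by move=> H; apply: ereal_inf_lbound; exists a, b. Qed.

Lemma leb_le A B : A `<=` B -> leb A <= leb B.
Proof.
move=> AB; apply: le_ereal_inf_tmp => _ [a [b [Bc ->]]].
by apply: leb_le_cover; exact: subset_trans Bc.
Qed.

Lemma leb_approx A (e : R) : (0 < e)%R -> leb A < +oo ->
  exists a b : nat -> pt, A `<=` \bigcup_i box (a i) (b i) /\
    \sum_(i <oo) (box_volume (a i) (b i))%:E <= leb A + e%:E.
Proof.
move=> e0 Aoo; have lf : leb A \is a fin_num.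
  by rewrite ge0_fin_numE// leb_ge0.
have [_ [a [b [Ac ->]]] H] := lb_ereal_inf_adherent e0 lf.
by exists a, b; split=> //; exact: ltW.
Qed.

Lemma leb_le_cover2 A (a b : nat -> nat -> pt) :
  A `<=` \bigcup_i \bigcup_j box (a i j) (b i j) ->
  leb A <= \sum_(i <oo) \sum_(j <oo) (box_volume (a i j) (b i j))%:E.
Proof.
move=> H; have /card_esym/card_set_bijP[f fb] := card_nat2.
apply: (@le_trans _ _ (\sum_(i <oo) (box_volume (a (f i).1 (f i).2) (b (f i).1 (f i).2))%:E)).
  apply: leb_le_cover => x /H[i _ [j _ Hx]].
  by have [_ _ /(_ (i, j) I)[m _ Em]] := fb; exists m => //; rewrite Em.
have v0 i j : 0 <= (box_volume (a i j) (b i j))%:E by rewrite lee_fin box_volume_ge0.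
rewrite nneseries_esumT//.
rewrite -(@reindex_esum R _ _ setT setT f
  (fun u => (box_volume (a u.1 u.2) (b u.1 u.2))%:E) fb).
rewrite [leRHS]nneseries_esumT; last by move=> i; exact: nneseries_ge0.
rewrite (eq_esum (fun i _ => nneseries_esumT (v0 i))) esum_esum//.
by rewrite (_ : _ `*`` _ = setT)// -subTset => -[].
Qed.

Lemma leb_subadditive : sigma_subadditive leb.
Proof.
move=> F; have [[i Fi]|nF] := pselect (exists i, leb (F i) = +oo).
  rewrite (eseries_pinfty _ _ Fi) ?leey// => m _.
  by rewrite -ltNye (lt_le_trans _ (leb_ge0 _)).
apply/lee_addgt0Pr => e e0.
apply: le_trans (epsilon_trick xpredT (fun i => leb_ge0 (F i)) (ltW e0)).
have H i : {ab : (nat -> pt) * (nat -> pt) | F i `<=` \bigcup_j box (ab.1 j) (ab.2 j) /\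
    \sum_(j <oo) (box_volume (ab.1 j) (ab.2 j))%:E <= leb (F i) + (e / (2 ^ i.+1)%:R)%:E}.
  apply: cid; have e20 : (0 < e / (2 ^ i.+1)%:R)%R by rewrite divr_gt0// ltr0n expn_gt0.
  have [|a [b Hab]] := @leb_approx (F i) _ e20; last by exists (a, b).
  by rewrite ltey; apply/eqP => h; apply: nF; exists i.
apply: le_trans (leb_le_cover2 (a := fun i => (projT1 (H i)).1)
  (b := fun i => (projT1 (H i)).2) _) _.
  move=> x [i _ Fx]; exists i => //.
  by have [/= + _] := projT2 (H i); apply.
apply: lee_nneseries => i _; last by have [] := projT2 (H i).
by move=> _; apply: nneseries_ge0 => j _ _; rewrite lee_fin box_volume_ge0.
Qed.

Hypothesis n_gt0 : (0 < n)%N.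

Lemma vidx_inh : exists j : idx, vidx j.
Proof.
have l0 : 'I_(kdim s) by case: (s); exists 0%N.
by exists (inl (Ordinal n_gt0, l0)).
Qed.

Lemma box_volume_self a : box_volume a a = 0%R.
Proof.
have [j vj] := vidx_inh.
by rewrite box_volumeE (bigD1 j)//= subrr (max_idPl _)// mul0r.
Qed.

Lemma leb_box_le a b : leb (box a b) <= (box_volume a b)%:E.
Proof.
(* The padding boxes are degenerate; they have volume 0 because there is at least one coordinate. *)
apply: le_trans (@leb_le_cover _ (fun=> a) (fun i => if i is 0 then b else a) _) _.
  by move=> x Hx; exists 0%N.
rewrite nneseries_recl//; last by move=> i _; rewrite lee_fin box_volume_ge0.
rewrite eseries_cond/= eseries0 ?adde0// => -[|i]//= _ _.
by rewrite box_volume_self.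
Qed.

Lemma leb0 : leb set0 = 0.
Proof.
apply/eqP; rewrite eq_le leb_ge0 andbT.
apply: (le_trans (leb_le (sub0set (box (0 : pt)%R 0%R)))).
by apply: le_trans (leb_box_le _ _) _; rewrite box_volume_self.
Qed.

Lemma leb_box_ge a b : (box_volume a b)%:E <= leb (box a b).
Proof.
apply: le_ereal_inf_tmp => _ [A [B [cov ->]]].
pose J : seq idx := [seq j <- enum {: idx} | vidx j].
have volE (x y : pt) : box_volume x y = (\prod_(j <- J) Num.max 0 (co y j - co x j))%R.
  by rewrite box_volumeE big_filter big_enum_cond.
rewrite volE -[X in X%:E]mul1r.
apply: le_trans (@weighted_cover R idx J (fun=> 1%R) 1 (co a) (co b)
  (fun i => co (A i)) (fun i => co (B i)) _ _ _) _ => //.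
- by rewrite filter_uniq// enum_uniq.
- move=> v Hv; have bx : box a b (mkpt v).
    apply/boxE; split=> [|j vj]; first exact: mkpt_boundary.
    by rewrite co_mkpt// Hv// mem_filter vj mem_enum.
  have [i _ /boxE[_ Hi]] := cov _ bx.
  rewrite (@nneseriesD1 _ _ i)//.
  rewrite (_ : all _ _ = true) ?mul1r; last first.
    apply/allP => j; rewrite mem_filter => /andP[vj _].
    by have := Hi j vj; rewrite co_mkpt.
  by rewrite leeDl// nneseries_ge0// => l _ _; rewrite lee_fin mulr_ge0.
- by apply: lee_nneseries => i _; rewrite mul1r -volE// lee_fin box_volume_ge0.
Qed.

Definition lebO : {outer_measure set pt -> \bar R} :=
  HB.pack (leb : set pt -> \bar R)
    (isOuterMeasure.Build R pt leb leb0 leb_ge0 leb_le leb_subadditive).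

Lemma lebU2 A B : leb (A `|` B) <= leb A + leb B.
Proof. exact: (@outer_measureU2 _ _ lebO). Qed.

End OuterMeasure.

(** Continuity at 0 of a polynomial in [t]. *)
Lemma prod_perturb (R : realType) (I : finType) (P : pred I) (T S : I -> R) (e : R) :
  0 < e -> exists2 d, 0 < d & forall t, 0 <= t <= d ->
    \prod_(j | P j) (T j + t * S j) <= \prod_(j | P j) T j + e.
Proof.
move=> e0; pose q : {poly R} := \prod_(j | P j) ((T j)%:P + (S j) *: 'X).
have qE t : q.[t] = \prod_(j | P j) (T j + t * S j).
  rewrite /q horner_prod; apply: eq_bigr => j _.
  by rewrite hornerD hornerC hornerZ hornerX mulrC.
have /cvgrPdist_lt /(_ _ e0) /nbhs_ballP [d /= d0 Hd] := @continuous_horner R q 0.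
exists (d / 2); first by rewrite divr_gt0.
move=> t /andP[t0 td]; have /Hd : ball (0 : R) d t.
  rewrite /ball /= sub0r normrN ger0_norm//; apply: le_lt_trans td _.
  by rewrite ltr_pdivrMr// ltr_pMr// ltr1n.
rewrite !qE distrC => /ltW; rewrite ler_norml => /andP[_].
have -> : \prod_(j | P j) (T j + 0 * S j) = \prod_(j | P j) T j.
  by apply: eq_bigr => j _; rewrite mul0r addr0.
by rewrite lerBlDl.
Qed.

(** * Translation invariance of the measure *)

Section Translation.
Variables (R : realType) (s : scalars) (n : nat).
Hypothesis n_gt0 : (0 < n)%N.
Local Notation k := (scal R s).
Local Notation pt := ('cV[k]_n * k)%type.
Local Notation uidx := ('I_n * 'I_(kdim s))%type.
Local Notation idx := (uidx + 'I_(kdim s))%type.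
Local Notation leb := (@leb R s n).
Implicit Types (q a b : pt) (v : idx -> R) (A B : set pt) (c : uidx -> R).

Arguments co : simpl never.

Section Shear.
Variable p : pt.
Hypothesis bp : boundary p.

(** Left translation is an ordinary translation up to this shear of the vertical coordinates, which
    depends on the horizontal ones only. *)
Definition shear q l : R := (kcoords (kim (sesqui p.1 q.1) *+ 2))`_l.

Lemma co_hmul_inl q u : co (hmul p q) (inl u) = co p (inl u) + co q (inl u).
Proof. by rewrite /co /= mxE kcoordsD. Qed.

Lemma co_hmul_inr q l : co (hmul p q) (inr l) = co p (inr l) + co q (inr l) + shear q l.
Proof. by rewrite /co /= (kcoordsD (p.2 + q.2)) (kcoordsD p.2). Qed.

Lemma shear_lipschitz : exists2 C, 0 <= C & forall q q' l,
  `|shear q l - shear q' l| <= C * \sum_u `|co q (inl u) - co q' (inl u)|.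
Proof.
pose B := \sum_i knorm (p.1 i 0).
have B0 : 0 <= B by apply: sumr_ge0 => i _; exact: knorm_ge0.
exists (8 * B); first by rewrite mulr_ge0.
move=> q q' l; rewrite /shear -kcoordsB -mulrnBl -kimN -kimD -sesquiNr -sesquiDr.
apply: le_trans (knorm_coord _ _) _; rewrite mulr2n.
apply: le_trans (ler_knormD _ _) _.
set y := sesqui _ _.
have h1 : knorm (kim y) <= 2 * knorm y.
  rewrite /kim; apply: le_trans (ler_knormB _ _) _.
  rewrite knorm_kreal; have := knorm_coord y 0; rewrite -/(kre y); lra.
have h2 : knorm y <= B * (2 * \sum_u `|co q (inl u) - co q' (inl u)|).
  apply: le_trans (ler_knorm_sum _ _ _) _; rewrite mulr_suml; apply: ler_sum => i _.
  rewrite knormM knorm_conj ler_wpM2l ?knorm_ge0//.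
  apply: knorm_le_coords => m; rewrite !mxE kcoordsB.
  rewrite (bigD1 (i, m))//= lerDl; apply: sumr_ge0 => *; exact: normr_ge0.
lra.
Qed.

(** Volume of a box after each vertical side is lengthened by the horizontal sides weighted with
    [c]. Translation invariance is the limit [c = 0], approached by repeated halving. *)
Definition shear_bound c a b : R := \prod_(j | vidx j)
  ((co b j - co a j) +
   (if j is inr _ then \sum_u c u * (co b (inl u) - co a (inl u)) else 0)).

Definition box_le a b := forall j, vidx j -> co a j <= co b j.

Definition shear_bounded c := forall a b, box_le a b ->
  (leb (hmul p @` box a b) <= (shear_bound c a b)%:E)%E.

(** The image is enclosed in a single box; the shear may lengthen a vertical side at both ends,
    whence [2 * C]. *)
Lemma shear_bounded_ex : exists2 C, 0 <= C & shear_bounded (fun=> C).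
Proof.
have [C C0 HC] := shear_lipschitz.
exists (2 * C); first by rewrite mulr_ge0.
move=> a b ab; pose S := \sum_u C * (co b (inl u) - co a (inl u)).
pose lo (j : idx) : R := match j with inl u => co p (inl u) + co a (inl u)
  | inr l => co p (inr l) + co a (inr l) + shear a l - S end.
pose hi (j : idx) : R := match j with inl u => co p (inl u) + co b (inl u)
  | inr l => co p (inr l) + co b (inr l) + shear a l + S end.
have S0 : 0 <= S by apply: sumr_ge0 => u _; rewrite mulr_ge0// subr_ge0 ab.
have sub : hmul p @` box a b `<=` box (mkpt lo) (mkpt hi).
  move=> _ [q /boxE[bq Hq] <-]; apply/boxE; split; first exact: boundary_hmul.
  move=> j vj; rewrite !co_mkpt//; have := Hq _ vj.
  case: j vj => [u|l] vj; first by rewrite co_hmul_inl /= !lerD2l.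
  rewrite co_hmul_inr /lo /hi => /andP[h1 h2].
  have : `|shear q l - shear a l| <= S.
    apply: le_trans (HC _ _ _) _; rewrite mulr_sumr; apply: ler_sum => u _.
    have /andP[h3 h4] := Hq (inl u) isT.
    by rewrite ler_wpM2l// ger0_norm ?subr_ge0// lerD2r.
  by rewrite ler_norml; lra.
apply: le_trans (leb_le sub) _; apply: le_trans (leb_box_le n_gt0 _ _) _.
rewrite lee_fin box_volumeE /shear_bound; apply: ler_prod => j vj.
rewrite le_max lexx/= !co_mkpt// ge_max; have := ab j vj.
have -> : \sum_u 2 * C * (co b (inl u) - co a (inl u)) = S + S.
  by rewrite /S -big_split/=; apply: eq_bigr => u _; ring.
by case: j vj => [u|l] vj; rewrite /lo /hi => h; apply/andP; split; lra.
Qed.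

(** Cut the box at the midpoint of coordinate [u0]. Each piece is half as wide there, so its bound
    with weight [c] is half the bound of the whole box with [c u0] halved, and the two pieces add
    up. *)
Lemma shear_bounded_halve c u0 : (forall u, 0 <= c u) -> shear_bounded c ->
  shear_bounded (fun u => if u == u0 then c u / 2 else c u).
Proof.
move=> c0 H a b ab; set c' := fun u => _.
pose m := (co a (inl u0) + co b (inl u0)) / 2.
pose b1 := mkpt (fun j : idx => if j == inl u0 then m else co b j).
pose a2 := mkpt (fun j : idx => if j == inl u0 then m else co a j).
have ab0 := ab (inl u0) isT.
have l1 : box_le a b1.
  move=> j vj; rewrite co_mkpt//; case: eqP => [->|_]; last exact: ab.
  by rewrite /m; lra.
have l2 : box_le a2 b.
  move=> j vj; rewrite co_mkpt//; case: eqP => [->|_]; last exact: ab.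
  by rewrite /m; lra.
have E a' b' : (forall j, vidx j -> co b' j - co a' j =
      if j == inl u0 then (co b j - co a j) / 2 else co b j - co a j) ->
    shear_bound c a' b' = shear_bound c' a b / 2.
  move=> w; rewrite /shear_bound (bigD1 (inl u0))//= [in RHS](bigD1 (inl u0))//=.
  rewrite !addr0 w// eqxx mulrAC; congr (_ * _ * _); apply: eq_bigr => j /andP[vj ju].
  rewrite w// (negbTE ju); case: j vj ju => // l _ _; congr (_ + _).
  apply: eq_bigr => u _; rewrite w// /c' -[inl u == inl u0]/(u == u0).
  by case: eqP => _ //; rewrite mulrA mulrAC.
have sub : hmul p @` box a b `<=` hmul p @` box a b1 `|` hmul p @` box a2 b.
  move=> _ [q /boxE[bq Hq] <-]; have [qm|mq] := leP (co q (inl u0)) m; [left|right].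
    exists q => //; apply/boxE; split=> // j vj; have := Hq j vj.
    by rewrite co_mkpt//; case: eqP => [->|//] /andP[-> _].
  exists q => //; apply/boxE; split=> // j vj; have := Hq j vj.
  by rewrite co_mkpt//; case: eqP => [->|//] /andP[_ ->]; rewrite (ltW mq).
apply: le_trans (leb_le sub) _; apply: le_trans (lebU2 n_gt0 _ _) _.
apply: le_trans (leeD (H _ _ l1) (H _ _ l2)) _; rewrite -EFinD lee_fin !E.
- by rewrite -splitr.
- move=> j vj; rewrite co_mkpt//; case: eqP => [->|//]; rewrite /m; lra.
- move=> j vj; rewrite co_mkpt//; case: eqP => [->|//]; rewrite /m; lra.
Qed.

Lemma shear_bounded_half (C : R) : 0 <= C -> shear_bounded (fun=> C) ->
  shear_bounded (fun=> C / 2).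
Proof.
move=> C0 H.
suff Hr (r : seq uidx) : uniq r -> shear_bounded (fun u => if u \in r then C / 2 else C).
  have := Hr (enum {: uidx}) (enum_uniq _); congr shear_bounded.
  by apply/funext => u; rewrite mem_enum.
elim: r => [//|u r IH] /= /andP[ur /IH Hr].
have := shear_bounded_halve u _ Hr.
have -> : (fun w => if w == u then (if w \in r then C / 2 else C) / 2
    else if w \in r then C / 2 else C) = (fun w => if w \in u :: r then C / 2 else C).
  apply/funext => w; rewrite inE; case: eqP => //= ->.
  by rewrite (negbTE ur).
by apply=> w; case: ifP => _ //; rewrite divr_ge0.
Qed.

Lemma leb_hmul_box a b : (leb (hmul p @` box a b) <= (box_volume a b)%:E)%E.
Proof.
have [ab|nab] := pselect (box_le a b); last first.
  have -> : box a b = set0.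
    apply/seteqP; split=> // q /boxE[_ Hq]; case: nab => j /Hq /andP[].
    exact: le_trans.
  by rewrite image_set0 leb0// lee_fin box_volume_ge0.
have [C C0 HC] := shear_bounded_ex.
have Hm m : shear_bounded (fun=> C / 2 ^+ m).
  elim: m => [|m IH]; first by rewrite expr0 divr1.
  rewrite exprSr invfM mulrA; apply: shear_bounded_half => //.
  by rewrite divr_ge0// exprn_ge0.
apply/lee_addgt0Pr => e e0.
pose T j := co b j - co a j.
pose S (j : idx) := if j is inr _ then \sum_u T (inl u) else 0.
have [d d0 Hd] := prod_perturb (@vidx s n) T S e0.
have [m md] : exists m, C / 2 ^+ m <= d.
  have h2 : `|2^-1 : R| < 1 by rewrite ger0_norm ?invr_ge0// invf_lt1// ltr1n.
  have dC : 0 < d / (C + 1) by rewrite divr_gt0// ltr_wpDl.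
  have /cvgrPdist_lt /(_ _ dC) [m _ /(_ m (leqnn m))] := cvg_expr h2.
  rewrite sub0r normrN ger0_norm ?exprn_ge0 ?invr_ge0// => h; exists m.
  move: h; rewrite ltr_pdivlMr ?ltr_wpDl// exprVn mulrC => /ltW; apply: le_trans.
  by rewrite ler_wpM2r ?invr_ge0 ?exprn_ge0// lerDl.
apply: le_trans (Hm m _ _ ab) _; rewrite -EFinD lee_fin.
have -> : box_volume a b = \prod_(j | vidx j) T j.
  by rewrite box_volumeE; apply: eq_bigr => j vj; rewrite (max_idPr _)// subr_ge0 ab.
apply: le_trans (Hd (C / 2 ^+ m) _).
  rewrite /shear_bound; apply: ler_prod => j vj; rewrite -/(T j).
  have hS : (if j is inr _ then \sum_u C / 2 ^+ m * (co b (inl u) - co a (inl u)) else 0) =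
     C / 2 ^+ m * S j.
    by case: (j) => [u|l]; rewrite /S ?mulr0// mulr_sumr.
  rewrite hS lexx andbT addr_ge0 ?subr_ge0 ?ab// mulr_ge0 ?divr_ge0 ?exprn_ge0//.
  by rewrite /S; case: (j) => // l; apply: sumr_ge0 => u _; rewrite subr_ge0 ab.
by rewrite md divr_ge0// exprn_ge0.
Qed.

End Shear.

Lemma leb_hmul_le p A : boundary p -> (leb (hmul p @` A) <= leb A)%E.
Proof.
move=> bp; apply: le_ereal_inf_tmp => _ [a [b [Ac ->]]].
apply: le_trans (leb_le (B := \bigcup_i (hmul p @` box (a i) (b i))) _) _.
  by move=> _ [q /Ac[i _ Hq] <-]; exists i => //; exists q.
apply: le_trans (@leb_subadditive R s n _) _.
apply: lee_nneseries => i _; first by move=> _; exact: leb_ge0.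
exact: leb_hmul_box.
Qed.

Lemma leb_hmul p A : boundary p -> leb (hmul p @` A) = leb A.
Proof.
move=> bp; apply/eqP; rewrite eq_le leb_hmul_le//=.
have := leb_hmul_le (hmul p @` A) (boundaryN bp).
rewrite image_comp (_ : (hmul (- p) \o hmul p) @` A = A)//.
rewrite -[RHS](image_id A); apply: eq_imagel => q _ /=; exact: hmulKp.
Qed.

End Translation.

(** * Measurable sets and the volume of balls *)

Section Caratheodory.
Variables (R : realType) (s : scalars) (n : nat).
Hypothesis n_gt0 : (0 < n)%N.
Local Notation k := (scal R s).
Local Notation pt := ('cV[k]_n * k)%type.
Local Notation uidx := ('I_n * 'I_(kdim s))%type.
Local Notation idx := (uidx + 'I_(kdim s))%type.
Local Notation leb := (@leb R s n).
Local Notation lebO := (@lebO R s n n_gt0).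
Implicit Types (p q a b : pt) (v : idx -> R) (A B : set pt).

Lemma caratheodory_le A :
  (forall X, leb (X `&` A) + leb (X `&` ~` A) <= leb X)%E -> leb.-caratheodory A.
Proof. exact: (@le_caratheodory_measurable _ _ lebO). Qed.

(** A test set not contained in the boundary has infinite outer measure. *)
Lemma caratheodory_boundary : leb.-caratheodory (@boundary R s n).
Proof.
apply: caratheodory_le => X.
have [XB|XB] := pselect (X `<=` @boundary R s n).
  have -> : X `&` ~` @boundary R s n = set0.
    by apply/seteqP; split=> [x [Xx nb]|x []]; exfalso; apply: nb; exact: XB.
  by rewrite (setIidl XB) (@leb0 R s n n_gt0) adde0.
suff -> : leb X = +oo%E by exact: leey.
apply/eqP; rewrite -leye_eq; apply: le_ereal_inf_tmp => m [a [b [cov _]]].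
by exfalso; apply: XB => x /cov[i _ []].
Qed.

Lemma max0_split (x y c : R) :
  Num.max 0 (Num.min y c - x) + Num.max 0 (y - Num.max x c) = Num.max 0 (y - x).
Proof.
case: (leP y c) => ?; case: (leP x c) => ?; case: (leP 0 (y - x)) => ?;
  try case: (leP 0 (y - c)) => ?; try case: (leP 0 (c - x)) => ?; try lra.
Qed.

(** The hyperplane cuts every covering box into two boxes whose volumes add up to the original
    one. *)
Lemma caratheodory_halfspace j c : vidx j ->
  leb.-caratheodory [set p : pt | co p j <= c].
Proof.
move=> vj; apply: caratheodory_le => X; set H := [set p | _].
apply: le_ereal_inf_tmp => _ [a [b [cov ->]]].
pose b1 i := mkpt (fun l : idx => if l == j then Num.min (co (b i) j) c else co (b i) l).
pose a2 i := mkpt (fun l : idx => if l == j then Num.max (co (a i) j) c else co (a i) l).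
have H1 : (leb (X `&` H) <= \sum_(i <oo) (box_volume (a i) (b1 i))%:E)%E.
  apply: leb_le_cover => p [/cov[i _ /boxE[bp Hp]] Hc]; exists i => //.
  apply/boxE; split=> // l vl; have := Hp l vl; rewrite co_mkpt//.
  case: eqP => [->|//] /andP[-> h] /=; by rewrite le_min h Hc.
have H2 : (leb (X `&` ~` H) <= \sum_(i <oo) (box_volume (a2 i) (b i))%:E)%E.
  apply: leb_le_cover => p [/cov[i _ /boxE[bp Hp]] Hc]; exists i => //.
  apply/boxE; split=> // l vl; have := Hp l vl; rewrite co_mkpt//.
  case: eqP => [->|//] /andP[h ->] /=; rewrite andbT ge_max h/=.
  by apply/ltW; rewrite ltNge; apply/negP.
apply: le_trans (leeD H1 H2) _; rewrite -nneseriesD; first last.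
- by move=> i _ _; rewrite lee_fin box_volume_ge0.
- by move=> i _ _; rewrite lee_fin box_volume_ge0.
apply: lee_nneseries => i _.
  by move=> _; rewrite -EFinD lee_fin addr_ge0// box_volume_ge0.
rewrite -EFinD lee_fin !box_volumeE (bigD1 j)//= [X in _ + X](bigD1 j)//=.
rewrite [leRHS](bigD1 j)//= !co_mkpt// !eqxx -[X in _ <= X * _](max0_split _ _ c) mulrDl.
rewrite lerD// ler_wpM2l ?le_max ?lexx//; rewrite le_eqVlt; apply/orP; left;
  apply/eqP/eq_bigr => l /andP[vl lj]; by rewrite co_mkpt// (negbTE lj).
Qed.

Definition hpt : Type := pt.
HB.instance Definition _ := Choice.on hpt.
HB.instance Definition _ := isPointed.Build hpt (0 : pt).

Let T := caratheodory_type (lebO : set hpt -> \bar R).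

Lemma measurable_co j : vidx j -> measurable_fun [set: T] (fun p : T => co (p : pt) j : R).
Proof.
move=> vj; apply: (measurability _ (RGenOInfty.measurableE R)).
move=> _ [_ [x ->] <-]; rewrite setTI.
rewrite (_ : _ @^-1` _ = ~` [set p : pt | co p j <= x]); last first.
  by apply/seteqP; split=> p /=; rewrite in_itv /= andbT ltNge; [move/negP|move=> h; apply/negP].
apply: (@caratheodory_measurable_setC _ _ lebO).
exact: caratheodory_halfspace.
Qed.

Definition hball p (r : R) : set pt := [set q | boundary q /\ dist p q < r].

Lemma gauge4_co p : boundary p -> gauge p ^+ 4 =
  (\sum_u co p (inl u) ^+ 2) ^+ 2 + \sum_(l < kdim s | (0 < l)%N) co p (inr l) ^+ 2.
Proof.
move=> bp; rewrite gauge_boundary4//; congr (_ ^+ 2 + _).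
  by rewrite /vsqnorm (eq_bigr _ (fun i _ => knorm_coords _)) pair_bigA.
rewrite knorm_coords [RHS]big_mkcond; apply: eq_bigr => l _.
case: ifPn => //; rewrite -eqn0Ngt => /eqP l0.
by rewrite l0 -/(kre p.2) (bp : kre p.2 = 0) expr0n.
Qed.

Lemma hball0E (r : R) : 0 < r -> hball 0 r = @boundary R s n `&`
  [set p : pt | (\sum_u co p (inl u) ^+ 2) ^+ 2 +
     \sum_(l < kdim s | (0 < l)%N) co p (inr l) ^+ 2 < r ^+ 4].
Proof.
move=> r0; have E p : boundary p -> (gauge p ^+ 4 < r ^+ 4) = (dist 0 p < r).
  by move=> bp; rewrite dist0 ltr_pXn2r ?nnegrE ?gauge_ge0// ltW.
by apply/seteqP; split=> p [bp] h; split=> //; move: h; rewrite /= -gauge4_co// E.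
Qed.

Lemma hball_image p (r : R) : boundary p -> hball p r = hmul p @` hball 0 r.
Proof.
move=> bp; apply/seteqP; split=> [q [bq pq]|_ [q [bq pq] <-]].
  exists (hmul (- p) q); last exact: hmulpK.
  by split; [exact: boundary_hmul (boundaryN bp) bq|rewrite dist0].
split; first exact: boundary_hmul.
by rewrite /dist hmulKp -dist0.
Qed.

Lemma caratheodory_hmul p A : boundary p -> leb.-caratheodory A ->
  leb.-caratheodory (hmul p @` A).
Proof.
move=> bp mA; apply: caratheodory_le => X.
have bN := boundaryN bp.
rewrite -(leb_hmul n_gt0 (X `&` _) bN) -(leb_hmul n_gt0 (X `&` ~` _) bN).
rewrite -(leb_hmul n_gt0 X bN) (mA (hmul (- p) @` X)).
apply: leeD; apply: leb_le => _ [q [Xq Hq] <-]; split; try by exists q.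
  by case: Hq => q' Aq' <-; rewrite hmulKp.
by move=> h; apply: Hq; exists (hmul (- p) q) => //; exact: hmulpK.
Qed.

(** The fourth power of the gauge is a polynomial in the coordinates, which settles balls about 0;
    translation does the rest. *)
Lemma caratheodory_hball p (r : R) : boundary p -> leb.-caratheodory (hball p r).
Proof.
move=> bp; have [r0|r0] := ltP 0 r; last first.
  rewrite (_ : hball p r = set0); first exact: (@caratheodory_measurable_set0 _ _ lebO).
  apply/seteqP; split=> // q [_]; rewrite ltNge.
  by rewrite (le_trans r0)// dist_ge0.
rewrite hball_image//; apply: caratheodory_hmul => //; rewrite hball0E//.
apply: (@caratheodory_measurable_setI _ _ lebO); first exact: caratheodory_boundary.
pose f1 (u : uidx) (p : T) : R := co (p : pt) (inl u) ^+ 2.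
pose f2 (l : 'I_(kdim s)) (p : T) : R := if (0 < l)%N then co (p : pt) (inr l) ^+ 2 else 0.
pose F (p : T) : R := (\sum_u f1 u p) ^+ 2 + \sum_l f2 l p.
have mF : measurable_fun [set: T] F.
  have m1 : measurable_fun [set: T] (fun p : T => \sum_u f1 u p).
    apply: (@measurable_sum _ T R setT _ _ f1) => u.
    exact: (measurable_funX 2 (@measurable_co (inl u) isT)).
  have m2 : measurable_fun [set: T] (fun p : T => \sum_l f2 l p).
    apply: (@measurable_sum _ T R setT _ _ f2) => l.
    rewrite /f2; have [l0|l0] := boolP (0 < l)%N; last exact: measurable_cst.
    have h := measurable_funX 2 (measurable_co (l0 : vidx (inr l))); exact: h.
  exact: (measurable_funD (measurable_funX 2 m1) m2).
have := mF measurableT `]-oo, (r ^+ 4)[%classic (measurable_itv _).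
rewrite setTI (_ : F @^-1` _ = [set q : pt | (\sum_u co q (inl u) ^+ 2) ^+ 2 +
  \sum_(l < kdim s | (0 < l)%N) co q (inr l) ^+ 2 < r ^+ 4]) //.
by apply/seteqP; split=> q; rewrite /= in_itv /= /F /f1 /f2 -big_mkcond.
Qed.

(** Weights of the dilations: horizontal coordinates scale like the gauge, vertical ones like its
    square. [hdim] is the homogeneous dimension. *)
Definition hdeg (j : idx) : nat := if j is inr _ then 2 else 1.
Definition hdim : nat := \sum_(j : idx | vidx j) hdeg j.

Lemma hdim_gt0 : (0 < hdim)%N.
Proof.
have [j vj] := vidx_inh s n_gt0.
by rewrite /hdim (bigD1 j)//= addn_gt0; case: j vj.
Qed.

Lemma co_gauge p j : boundary p -> `|co p j| <= gauge p ^+ hdeg j.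
Proof.
move=> bp; have g0 := gauge_ge0 p; case: j => [u|l].
  rewrite expr1; apply: le_trans (knorm_coord _ _) _.
  apply: le_trans (vsqnorm_le_gauge bp).
  rewrite -[leLHS]ger0_norm ?knorm_ge0// -sqrtr_sqr ler_wsqrtr//.
  by rewrite /vsqnorm (bigD1 u.1)//= lerDl sumr_ge0// => i _; exact: sqr_ge0.
apply: le_trans (knorm_coord _ _) _.
rewrite -ler_sqr ?nnegrE ?knorm_ge0 ?exprn_ge0// -exprM -[(_ * _)%N]/4%N.
by rewrite gauge_boundary4// lerDr sqr_ge0.
Qed.

Lemma hball_sub_box (r : R) : 0 <= r ->
  hball 0 r `<=` box (mkpt (fun j => - r ^+ hdeg j)) (mkpt (fun j => r ^+ hdeg j)).
Proof.
move=> r0 p [bp]; rewrite dist0 => pr; apply/boxE; split=> // j vj.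
rewrite !co_mkpt// -ler_norml; apply: le_trans (co_gauge j bp) _.
by rewrite lerXn2r ?nnegrE ?gauge_ge0// ltW.
Qed.

(** Small enough for a box with half-sides [cbox * r ^+ hdeg j] to satisfy ‖z‖² <= r²/4 and ‖t‖ <=
    r²/2, so that the fourth power of the gauge is at most 5/16 of [r ^+ 4]. *)
Definition cbox : R := (4 * n.+1%:R)^-1.

Lemma box_sub_hball (r : R) : 0 < r ->
  box (mkpt (fun j => - (cbox * r ^+ hdeg j))) (mkpt (fun j => cbox * r ^+ hdeg j))
  `<=` hball 0 r.
Proof.
move=> r0 p /boxE[bp Hp]; split=> //; rewrite dist0.
have c0 : 0 < cbox by rewrite invr_gt0 mulr_gt0.
have c1 : cbox * n.+1%:R = 4^-1 by rewrite /cbox invfM mulfVK.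
have c4 : cbox <= 4^-1 by rewrite -c1 ler_peMr ?(ltW c0)// ler1n.
have Hc j : vidx j -> `|co p j| <= cbox * r ^+ hdeg j.
  by move=> vj; have := Hp j vj; rewrite !co_mkpt// ler_norml.
have h1 : vsqnorm p.1 <= r ^+ 2 / 4.
  apply: (@le_trans _ _ (\sum_(i < n) (2 * (cbox * r)) ^+ 2)).
    apply: ler_sum => i _; rewrite ler_sqr ?nnegrE ?knorm_ge0 ?mulr_ge0// ?(ltW c0) ?(ltW r0)//.
    by apply: knorm_le_coords => l; exact: (Hc (inl (i, l))).
  rewrite sumr_const card_ord -[X in X <= _]mulr_natl.
  have -> : n%:R * (2 * (cbox * r)) ^+ 2 = r ^+ 2 * (4 * (cbox * n%:R) * cbox) by ring.
  rewrite ler_wpM2l ?sqr_ge0//.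
  have cn : cbox * n%:R <= 4^-1 by rewrite -c1 ler_pM2l// ler_nat.
  apply: (@le_trans _ _ (4 * 4^-1 * 4^-1)); last by rewrite mulfV// mul1r.
  by rewrite ler_pM ?mulr_ge0 ?(ltW c0)// ler_wpM2l.
have h2 : knorm p.2 <= r ^+ 2 / 2.
  have -> : r ^+ 2 / 2 = 2 * (r ^+ 2 / 4) by field.
  apply: knorm_le_coords => l; have [l0|l0] := posnP l.
    by rewrite l0 -/(kre p.2) (bp : kre p.2 = 0) normr0 divr_ge0 ?sqr_ge0.
  apply: le_trans (Hc (inr l) l0) _; rewrite mulrC ler_wpM2l// sqr_ge0//.
rewrite -(@ltr_pXn2r _ 4) ?nnegrE ?gauge_ge0 ?(ltW r0)// gauge_boundary4//.
have r4 : 0 < r ^+ 4 by rewrite exprn_gt0.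
have E1 : vsqnorm p.1 ^+ 2 <= r ^+ 4 / 16.
  have -> : r ^+ 4 / 16 = (r ^+ 2 / 4) ^+ 2 by field.
  by rewrite ler_sqr ?nnegrE ?vsqnorm_ge0// divr_ge0 ?sqr_ge0.
have E2 : knorm p.2 ^+ 2 <= r ^+ 4 / 4.
  have -> : r ^+ 4 / 4 = (r ^+ 2 / 2) ^+ 2 by field.
  by rewrite ler_sqr ?nnegrE ?knorm_ge0// divr_ge0 ?sqr_ge0.
lra.
Qed.

Definition hball_ub : R := \prod_(j : idx | vidx j) 2.
Definition hball_lb : R := \prod_(j : idx | vidx j) (2 * cbox).

Lemma hball_ub_gt0 : 0 < hball_ub. Proof. by apply: prodr_gt0. Qed.
Lemma hball_lb_gt0 : 0 < hball_lb.
Proof. by apply: prodr_gt0 => j _; rewrite mulr_gt0// invr_gt0 mulr_gt0. Qed.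

Lemma box_volume_hdeg (c r : R) : 0 <= c -> 0 <= r ->
  box_volume (mkpt (fun j => - (c * r ^+ hdeg j))) (mkpt (fun j : idx => c * r ^+ hdeg j)) =
  (\prod_(j : idx | vidx j) (2 * c)) * r ^+ hdim.
Proof.
move=> c0 r0; rewrite box_volumeE /hdim expr_sum -big_split/=; apply: eq_bigr => j vj.
rewrite !co_mkpt// opprK (max_idPr _) ?addr_ge0 ?mulr_ge0 ?exprn_ge0//; ring.
Qed.

Lemma leb_hball_le p (r : R) : boundary p -> 0 <= r ->
  (leb (hball p r) <= (hball_ub * r ^+ hdim)%:E)%E.
Proof.
move=> bp r0; rewrite hball_image// leb_hmul//.
apply: le_trans (leb_le (hball_sub_box r0)) _; apply: le_trans (leb_box_le n_gt0 _ _) _.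
have := box_volume_hdeg ler01 r0.
under eq_fun do rewrite mul1r; under [in X in box_volume _ X]eq_fun do rewrite mul1r.
by move=> ->; rewrite mulr1.
Qed.

Lemma leb_hball_ge p (r : R) : boundary p -> 0 <= r ->
  ((hball_lb * r ^+ hdim)%:E <= leb (hball p r))%E.
Proof.
move=> bp; rewrite le_eqVlt => /orP[/eqP <-|r0].
  by rewrite expr0n (gtn_eqF hdim_gt0) mulr0 leb_ge0.
rewrite hball_image// leb_hmul//.
apply: le_trans (leb_le (box_sub_hball r0)).
have c0 : 0 <= cbox by rewrite invr_ge0 mulr_ge0.
by rewrite -box_volume_hdeg ?(ltW r0)//; exact: leb_box_ge.
Qed.

End Caratheodory.

(** * The Vitali covering lemma and its consequences *)

Section Covering.
Variables (R : realType) (s : scalars) (n : nat).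
Hypothesis n_gt0 : (0 < n)%N.
Local Notation k := (scal R s).
Local Notation pt := ('cV[k]_n * k)%type.
Local Notation uidx := ('I_n * 'I_(kdim s))%type.
Local Notation idx := (uidx + 'I_(kdim s))%type.
Local Notation leb := (@leb R s n).
Local Notation lebO := (@lebO R s n n_gt0).
Local Notation ub := (hball_ub R s n).
Local Notation lb := (hball_lb R s n).
Local Notation Q := (hdim s n).
Implicit Types (p q x y : pt) (A B U D : set pt).

Lemma gauge0 : gauge (0 : pt) = 0.
Proof.
by rewrite /gauge vsqnorm0 kre0 normr0 addr0 kreal0 kim0 addr0 knorm0 sqrtr0.
Qed.

Lemma co0 j : co (0 : pt) j = 0.
Proof. by apply: (addrI (co (0 : pt) j)); rewrite -coD !addr0. Qed.

(** Coordinates are continuous for the Cygan metric, with a modulus that depends on [x] through the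
    shear. Enlarged boxes are thus metric neighbourhoods. *)
Lemma hball_coordinates x (d : R) : boundary x -> 0 < d ->
  exists2 r, 0 < r & forall y, hball x r y -> forall j, vidx j -> `|co y j - co x j| <= d.
Proof.
move=> bx d0; have [C C0 HC] := shear_lipschitz x.
pose N : R := \sum_(u : uidx) 1.
have N0 : 0 <= N by apply: sumr_ge0.
pose M := 1 + C * N; have M0 : 0 < M by rewrite ltr_pwDl// mulr_ge0.
exists (Num.min 1 (d / M)); first by rewrite lt_min ltr01 divr_gt0.
move=> y [by' xy] j vj; pose h := hmul (- x) y.
have bh : boundary h by apply: boundary_hmul => //; exact: boundaryN.
have yE : y = hmul x h by rewrite hmulpK.
have hr : gauge h < Num.min 1 (d / M) by [].
have g0 := gauge_ge0 h.
have g1 : gauge h <= 1 by apply: le_trans (ltW hr) _; rewrite ge_min lexx.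
have gd : gauge h * M <= d.
  by rewrite -ler_pdivlMr//; apply: le_trans (ltW hr) _; rewrite ge_min lexx orbT.
have hg j' : `|co h j'| <= gauge h.
  apply: le_trans (co_gauge j' bh) _; case: j' => [u|l]; first by rewrite expr1.
  by rewrite /= expr2 ler_piMr.
have dM : gauge h <= d.
  by apply: le_trans gd; rewrite ler_peMr// /M lerDl mulr_ge0.
case: j vj => [u|l] vj; rewrite yE.
  by rewrite co_hmul_inl addrAC subrr add0r; exact: le_trans (hg _) dM.
rewrite co_hmul_inr (_ : _ - _ = co h (inr l) + shear x h l); last by ring.
apply: le_trans (ler_normD _ _) _.
have s0 : shear x 0 l = 0.
  rewrite /shear /sesqui big1; first by rewrite kim0 mul0rn kcoords0.
  by move=> i _; rewrite mxE mulr0.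
have := HC h 0 l; rewrite s0 subr0 => sh.
have : \sum_(u : uidx) `|co h (inl u) - co (0 : pt) (inl u)| <= N * gauge h.
  rewrite /N mulr_suml; apply: ler_sum => u _.
  by rewrite co0 subr0 mul1r; exact: (hg (inl u)).
move=> /(ler_wpM2l C0); have := hg (inr l); move: gd; rewrite /M; lra.
Qed.

Lemma box_enlarge (a b : pt) (e : R) : 0 < e -> exists a' b' : pt,
  box_volume a' b' <= box_volume a b + e /\
  forall x, box a b x -> exists2 r, 0 < r & hball x r `<=` box a' b'.
Proof.
move=> e0; have [ab|nab] := pselect (box_le a b); last first.
  exists a, b; split=> [|x /boxE[_ Hx]]; first by rewrite lerDl ltW.
  by case: nab => j /Hx /andP[]; exact: le_trans.
pose T j := co b j - co a j.
have [d d0 Hd] := prod_perturb (@vidx s n) T (fun=> 2) e0.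
exists (mkpt (fun j => co a j - d)), (mkpt (fun j => co b j + d)); split.
  have -> : box_volume a b = \prod_(j | vidx j) T j.
    by rewrite box_volumeE; apply: eq_bigr => j vj; rewrite (max_idPr _)// subr_ge0 ab.
  apply: le_trans (Hd d _); last by rewrite (ltW d0) lexx.
  rewrite box_volumeE; apply: ler_prod => j vj; rewrite !co_mkpt// le_max lexx/=.
  have := ab j vj; rewrite ge_max /T => h; apply/andP; split; lra.
move=> x /boxE[bx Hx]; have [r r0 Hr] := hball_coordinates bx d0.
exists r => // y xy; apply/boxE; split; first by case: xy.
move=> j vj; rewrite !co_mkpt//; have := Hr y xy j vj; have := Hx j vj.
by rewrite ler_norml => /andP[? ?] /andP[? ?]; apply/andP; split; lra.
Qed.

Lemma leb_outer_regular A (e : R) : (leb A < +oo)%E -> 0 < e ->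
  exists U, [/\ A `<=` U, (leb U <= leb A + e%:E)%E &
    forall x, A x -> exists2 r, 0 < r & hball x r `<=` U].
Proof.
move=> Aoo e0; have e20 : 0 < e / 2 by rewrite divr_gt0.
have [a [b [cov Hab]]] := leb_approx e20 Aoo.
have H i : {ab : pt * pt |
    box_volume ab.1 ab.2 <= box_volume (a i) (b i) + e / 2 / (2 ^ i.+1)%:R /\
    forall x, box (a i) (b i) x -> exists2 r, 0 < r & hball x r `<=` box ab.1 ab.2}.
  apply: cid; have ei : 0 < e / 2 / (2 ^ i.+1)%:R by rewrite divr_gt0// ltr0n expn_gt0.
  by have [a' [b' Hab']] := box_enlarge (a i) (b i) ei; exists (a', b').
pose U := \bigcup_i box (projT1 (H i)).1 (projT1 (H i)).2.
have HU x : A x -> exists2 r, 0 < r & hball x r `<=` U.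
  move=> /cov[i _ Hx]; have [_ /(_ x Hx)[r r0 Hr]] := projT2 (H i).
  by exists r => // y /Hr; exists i.
exists U; split=> //.
  move=> x Ax; have [r r0 Hr] := HU x Ax; apply: Hr.
  have bx : boundary x by have [i _ /boxE[]] := cov x Ax.
  by split=> //; rewrite /dist hmulNp gauge0.
apply: le_trans (leb_le_cover (fun x Ux => Ux)) _.
apply: (@le_trans _ _ (\sum_(i <oo) ((box_volume (a i) (b i))%:E + (e / 2 / (2 ^ i.+1)%:R)%:E))%E).
  apply: lee_nneseries => i _; first by move=> _; rewrite lee_fin box_volume_ge0.
  by rewrite -EFinD lee_fin; have [] := projT2 (H i).
apply: le_trans (epsilon_trick xpredT _ (ltW e20)) _.
  by move=> i; rewrite lee_fin box_volume_ge0.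
apply: le_trans (leeD2r _ Hab) _.
by rewrite -addeA -EFinD -splitr.
Qed.

Lemma leb_sum_disjoint (E : nat -> set pt) U m : (forall i, leb.-caratheodory (E i)) ->
  trivIset setT E -> (forall i, E i `<=` U) ->
  (\sum_(i < m) leb (E i) <= leb U)%E.
Proof.
move=> mE tE EU.
have := @caratheodory_additive _ _ lebO E mE tE m U => /= H.
apply: le_trans (leb_le (@subIsetl _ U (\big[setU/set0]_(i < m) E i))).
by rewrite H; apply: lee_sum => i _; rewrite (setIidr (EU i)).
Qed.

(* Greedy selection: at each step take a ball disjoint from the previous ones
   whose radius is at least half of the best possible one. Only the centres of
   the balls of the family need to be covered. *)
Lemma vitali_covering (F : set (pt * R)) U : (leb U < +oo)%E ->
  (forall b, F b -> [/\ boundary b.1, 0 < b.2, b.2 <= 1 & hball b.1 b.2 `<=` U]) ->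
  exists e : nat -> pt * R, [/\ forall i, e i = (0, 0) \/ F (e i),
    trivIset setT (fun i => hball (e i).1 (e i).2) &
    forall b, F b -> exists i, F (e i) /\ dist (e i).1 b.1 < 3 * (e i).2].
Proof.
move=> Uoo HF.
pose disj (b c : pt * R) := hball b.1 b.2 `&` hball c.1 c.2 = set0.
pose good (S : seq (pt * R)) b := F b /\ forall c, c \in S -> disj b c.
have pickP S : exists b, ((exists b', good S b') -> good S b /\
      forall b', good S b' -> b'.2 < 2 * b.2) /\
    (~ (exists b', good S b') -> b = (0, 0)).
  (* When no ball is left the value is [(0, 0)], whose ball is empty. *)
  have [[b0 gb0]|ng] := pselect (exists b', good S b'); last first.
    by exists (0, 0); split.
  pose E := [set r : R | exists2 b, good S b & r = b.2].
  have hE : has_sup E.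
    split; first by exists b0.2; exists b0.
    by exists 1 => _ [b [/HF[_ _ b1 _] _] ->].
  have s0 : 0 < sup E.
    have [/HF[_ b00 _ _] _] := gb0; apply: lt_le_trans b00 _.
    by apply: ub_le_sup; [exact: hE.2|exists b0].
  have [_ [b gb ->] Hb] := @sup_adherent _ E (sup E / 2) (divr_gt0 s0 (ltr0Sn R 1)) hE.
  exists b; split=> [_|]; last by case; exists b0.
  split=> // b' gb'; have : b'.2 <= sup E by apply: ub_le_sup; [exact: hE.2|exists b'].
  by move: Hb; lra.
have [pick Hpick] := choice pickP.
pose L := fix L i := if i is j.+1 then pick (L j) :: L j else [::].
pose e i := pick (L i).
have eF i : e i = (0, 0) \/ F (e i).
  have [H1 H2] := Hpick (L i).
  have [g|ng] := pselect (exists b', good (L i) b'); last by left; exact: H2.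
  by right; have [[]] := H1 g.
have Lmem i j : (i < j)%N -> e i \in L j.
  elim: j => // j IH; rewrite ltnS leq_eqVlt => /orP[/eqP <-|/IH].
    by rewrite inE eqxx.
  by rewrite /= inE => ->; rewrite orbT.
have hball00 : hball (0 : pt) 0 = set0.
  by apply/seteqP; split=> // q [_]; rewrite ltNge dist_ge0.
have disjE i j : (i < j)%N -> disj (e j) (e i).
  move=> ij; have [H1 H2] := Hpick (L j).
  have [g|ng] := pselect (exists b', good (L j) b').
    have [[_ gd] _] := H1 g; exact: gd (Lmem _ _ ij).
  by rewrite /disj /e (H2 ng) /= hball00 set0I.
have tE : trivIset setT (fun i => hball (e i).1 (e i).2).
  apply/trivIsetP => i j _ _; rewrite neq_ltn => /orP[ij|ji].
    by rewrite setIC; exact: disjE.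
  exact: disjE.
exists e; split=> // b Fb; have [bb b0 b1 bU] := HF b Fb.
have bdE i : boundary (e i).1.
  by case: (eF i) => [->|/HF[]//]; exact: boundary0.
have eU i : hball (e i).1 (e i).2 `<=` U.
  by case: (eF i) => [->|/HF[]//]; rewrite hball00.
(* A ball that is never excluded would keep all chosen radii above half of its own, and infinitely
   many disjoint balls of measure at least [c] do not fit into [U]. *)
have [m Hm] : exists m, ~ good (L m) b.
  apply: contrapT => H; have gb m : good (L m) b by apply: contrapT => ?; apply: H; exists m.
  pose c := lb * (b.2 / 2) ^+ Q.
  have c0 : 0 < c by rewrite mulr_gt0 ?hball_lb_gt0// exprn_gt0// divr_gt0.
  have ce i : (c%:E <= leb (hball (e i).1 (e i).2))%E.
    have [/(_ (ex_intro _ b (gb i)))[[/HF[_ e0 _ _] _] /(_ b (gb i)) be] _] := Hpick (L i).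
    apply: le_trans (leb_hball_ge n_gt0 (bdE i) (ltW e0)).
    rewrite lee_fin ler_pM2l ?hball_lb_gt0// lerXn2r ?nnegrE ?divr_ge0 ?(ltW e0) ?(ltW b0)//.
    by rewrite ler_pdivrMr// mulrC ltW.
  have Uf : leb U \is a fin_num by rewrite ge0_fin_numE// leb_ge0.
  pose m := (Num.truncn (fine (leb U) / c)).+1.
  have := @leb_sum_disjoint _ U m (fun i => caratheodory_hball n_gt0 (e i).2 (bdE i)) tE eU.
  apply/negP; rewrite -ltNge.
  apply: (@lt_le_trans _ _ (\sum_(i < m) c%:E)%E); last by apply: lee_sum => i _.
  rewrite sumEFin sumr_const card_ord -(fineK Uf) lte_fin -[X in _ < X]mulr_natl.
  by rewrite -ltr_pdivrMr// truncnS_gt.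
have exm : exists m, ~~ `[< good (L m) b >] by exists m; apply/asboolPn.
(* At its first exclusion [b] meets the ball just chosen, whose radius exceeds half that of [b]; the
   centres are less than three such radii apart. *)
case: (ex_minnP exm) => -[|j] /asboolPn nj minj.
  by exfalso; apply: nj; split.
have gj : good (L j) b.
  by apply: contrapT => /asboolPn /minj; rewrite ltnn.
have [/(_ (ex_intro _ b gj))[[Fe _] /(_ b gj) be] _] := Hpick (L j).
exists j; split=> //; have [_ e0 _ _] := HF _ Fe.
have nd : ~ disj b (e j).
  move=> d; apply: nj; split=> // c; rewrite /= inE => /orP[/eqP ->//|].
  exact: gj.2.
have [q [[bq bq1] [_ bq2]]] : exists q, (hball b.1 b.2 `&` hball (e j).1 (e j).2) q.
  by apply: contrapT => H; apply: nd; apply/seteqP; split=> // q Hq; apply: H; exists q.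
have := dist_triangle (bdE j) bq bb; rewrite (distC bq bb).
by move: be; rewrite -/(e j); lra.
Qed.

Lemma leb_sigma_subadditive (F : nat -> set pt) A :
  A `<=` \bigcup_i F i -> (leb A <= \sum_(i <oo) leb (F i))%E.
Proof. by move=> AF; apply: le_trans (leb_le AF) _; exact: leb_subadditive. Qed.

Lemma sum_disjoint_hball (e : nat -> pt * R) U (c : R) : 0 <= c ->
  (forall i, boundary (e i).1 /\ 0 <= (e i).2) ->
  (forall i, hball (e i).1 (e i).2 `<=` U) ->
  trivIset setT (fun i => hball (e i).1 (e i).2) ->
  (\sum_(i <oo) (c * (e i).2 ^+ Q)%:E <= (c / lb)%:E * leb U)%E.
Proof.
move=> c0 He eU tE; have lb0 := hball_lb_gt0 R s n.
have v0 i : (0 <= (c * (e i).2 ^+ Q)%:E)%E.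
  by rewrite lee_fin mulr_ge0// exprn_ge0//; have [] := He i.
apply: lime_le; first exact: is_cvg_nneseries.
apply: nearW => m; rewrite big_mkord.
apply: (@le_trans _ _ (\sum_(i < m) (c / lb)%:E * leb (hball (e i).1 (e i).2))%E).
  apply: lee_sum => i _; have [bi ri] := He i.
  apply: le_trans (lee_wpmul2l _ (leb_hball_ge n_gt0 bi ri)).
    by rewrite -EFinM lee_fin mulrA divfK// gt_eqF.
  by rewrite lee_fin divr_ge0// ltW.
rewrite -ge0_sume_distrr; last by move=> i _; exact: leb_ge0.
rewrite lee_wpmul2l ?lee_fin ?divr_ge0 ?(ltW lb0)//.
apply: (leb_sum_disjoint m _ tE eU) => i.
by apply: caratheodory_hball; have [] := He i.
Qed.

(* A vanishing criterion playing the role of the Lebesgue density theorem. *)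
Lemma porous_null A (sg : R) : A `<=` @boundary R s n -> (leb A < +oo)%E -> 0 < sg ->
  (forall x, A x -> forall r0, 0 < r0 -> exists r, [/\ 0 < r, r < r0 &
    exists D, [/\ leb.-caratheodory D, D `<=` hball x r, D `&` A = set0 &
      ((sg * r ^+ Q)%:E <= leb D)%E]]) ->
  leb A = 0%E.
Proof.
move=> AB Aoo sg0 por; apply: contrapT => /eqP A0.
have Ag0 : (0 < leb A)%E by rewrite lt_def A0 leb_ge0.
have Af : leb A \is a fin_num by rewrite ge0_fin_numE// leb_ge0.
pose mA := fine (leb A); have mA0 : 0 < mA.
  by rewrite -lte_fin fineK.
have ub0 := hball_ub_gt0 R s n; have lb0 := hball_lb_gt0 R s n.
(* The tripled balls cover [A], so [leb A] is at most [K] times the sum of the [r ^+ Q], and the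
   holes take at least [sg / K * leb A] out of [U]. The excess [e0] allowed to [U] is half of
   that. *)
pose K := ub * 3 ^+ Q; have K0 : 0 < K by rewrite mulr_gt0// exprn_gt0.
pose e0 := sg / K * mA / 2; have e00 : 0 < e0 by rewrite divr_gt0// mulr_gt0// divr_gt0.
have [U [AU Ue Ur]] := leb_outer_regular Aoo e00.
have Uoo : (leb U < +oo)%E by apply: le_lt_trans Ue _; rewrite lte_add_pinfty ?ltry.
pose W (b : pt * R) D := [/\ leb.-caratheodory D, D `<=` hball b.1 b.2, D `&` A = set0 &
      ((sg * b.2 ^+ Q)%:E <= leb D)%E].
pose F := [set b : pt * R | [/\ A b.1, 0 < b.2, b.2 <= 1 & hball b.1 b.2 `<=` U] /\
  exists D, W b D].
have [|e [eF tE cov]] := @vitali_covering F U Uoo.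
  by move=> b [[Ab b0 b1 bU] _]; split=> //; exact: AB.
have he i : boundary (e i).1 /\ 0 <= (e i).2.
  case: (eF i) => [->|[[/AB ? /ltW ? _ _] _]] //; split => //; exact: boundary0.
have hball00 : hball (0 : pt) 0 = set0.
  by apply/seteqP; split=> // q [_]; rewrite ltNge dist_ge0.
have HD i : {D | W (e i) D}.
  apply: cid; case: (eF i) => [->|[_ //]]; exists set0; split=> //.
  - exact: (@caratheodory_measurable_set0 _ _ lebO).
  - by rewrite set0I.
  - by rewrite expr0n (gtn_eqF (hdim_gt0 s n_gt0)) mulr0 leb_ge0.
pose D i := projT1 (HD i).
have DW i : W (e i) (D i) := projT2 (HD i).
have tD : trivIset setT D.
  apply/trivIsetP => i j _ _ ij; apply/seteqP; split=> // q [Di Dj].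
  have /trivIsetP /(_ i j I I ij) := tE; rewrite -subset0; apply; split.
    by have [_ /(_ _ Di)] := DW i.
  by have [_ /(_ _ Dj)] := DW j.
have DU i : D i `<=` U.
  move=> q Dq; have [_ /(_ _ Dq) qe _ _] := DW i; move: qe.
  by case: (eF i) => [->|[[_ _ _ H] _] /H//]; rewrite hball00.
have mD i : leb.-caratheodory (D i) by have [] := DW i.
have h1 : (leb A <= \sum_(i <oo) (K * (e i).2 ^+ Q)%:E)%E.
  apply: le_trans (@leb_sigma_subadditive (fun i => hball (e i).1 (3 * (e i).2)) A _) _.
    move=> x Ax; have [r r0 xr] := Ur x Ax.
    have r10 : 0 < Num.min 1 r by rewrite lt_min ltr01.
    have [t [t0 t1 [D' HD']]] := por x Ax _ r10.
    have [|i [Fe ex]] := cov (x, t).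
      split=> /=; last by exists D'.
      split=> //; first by apply: le_trans (ltW t1) _; rewrite ge_min lexx.
      apply: subset_trans xr => q [bq xq]; split=> //; apply: lt_trans xq _.
      by apply: lt_le_trans t1 _; rewrite ge_min lexx orbT.
    by exists i => //; split=> //; exact: AB.
  apply: lee_nneseries => i _; first by move=> _; exact: leb_ge0.
  have [bi ri] := he i; apply: le_trans (leb_hball_le n_gt0 bi (mulr_ge0 _ ri)) _ => //.
  by rewrite exprMn mulrA.
have h2 : (\sum_(i <oo) (sg * (e i).2 ^+ Q)%:E + leb A <= leb U)%E.
  have := @caratheodory_lime_le _ _ lebO D mD tD U => /=; apply: le_trans.
  apply: leeD.
    apply: lee_nneseries => i _.
      by move=> _; rewrite lee_fin mulr_ge0 ?(ltW sg0)// exprn_ge0//; have [] := he i.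
    by rewrite (setIidr (DU i)); have [] := DW i.
  apply: leb_le => x Ax; split; first exact: AU.
  move=> [i _ Dx]; have [_ _ DA _] := DW i.
  by have : (D i `&` A) x by []; rewrite DA.
have h3 : (\sum_(i <oo) (sg * (e i).2 ^+ Q)%:E =
    (sg / K)%:E * \sum_(i <oo) (K * (e i).2 ^+ Q)%:E)%E.
  rewrite -nneseriesZl; last first.
    by move=> i _; rewrite lee_fin mulr_ge0 ?(ltW K0)// exprn_ge0//; have [] := he i.
  by apply: eq_eseriesr => i _; rewrite -EFinM mulrA divfK// gt_eqF.
have h4 : ((sg / K)%:E * leb A + leb A <= leb A + e0%:E)%E.
  apply: le_trans Ue; apply: le_trans h2; rewrite h3 leeD2r//.
  by rewrite lee_wpmul2l// lee_fin divr_ge0 ?ltW.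
move: h4; rewrite -(fineK Af) -/mA -EFinM -!EFinD lee_fin /e0.
have : 0 < sg / K * mA by rewrite mulr_gt0// divr_gt0.
lra.
Qed.

Definition lip_const : R := ub * 3 ^+ Q / lb.

Lemma lip_const_gt0 : 0 < lip_const.
Proof. by rewrite divr_gt0 ?hball_lb_gt0// mulr_gt0 ?hball_ub_gt0// exprn_gt0. Qed.

(** Tripled Vitali balls in a slightly larger [U] cover [A]; each meets [A] in a set whose image
    lies in a ball with radius multiplied by [L]. Volume bounds for balls compare the sum with the
    measure of the disjoint balls. *)
Lemma leb_lipschitz (f : pt -> pt) A (L : R) : 0 < L -> A `<=` @boundary R s n ->
  (forall x, A x -> boundary (f x)) ->
  (forall x y, A x -> A y -> dist (f x) (f y) <= L * dist x y) ->
  (leb (f @` A) <= (lip_const * L ^+ Q)%:E * leb A)%E.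
Proof.
move=> L0 AB fB lip; set C := lip_const * L ^+ Q.
have ub0 := hball_ub_gt0 R s n; have lb0 := hball_lb_gt0 R s n.
have C0 : 0 < C by rewrite mulr_gt0 ?lip_const_gt0// exprn_gt0.
have [Aoo|] := eqVneq (leb A) +oo%E; first by rewrite Aoo gt0_muley ?lte_fin// leey.
rewrite -ltey => Aoo; apply/lee_addgt0Pr => e e0.
have eC : 0 < e / C by rewrite divr_gt0.
have [U [AU Ue Ur]] := leb_outer_regular Aoo eC.
have Uoo : (leb U < +oo)%E by apply: le_lt_trans Ue _; rewrite lte_add_pinfty ?ltry.
pose F := [set b : pt * R | [/\ A b.1, 0 < b.2, b.2 <= 1 & hball b.1 b.2 `<=` U]].
have [|c [cF tE cov]] := @vitali_covering F U Uoo.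
  by move=> b [Ab b0 b1 bU]; split=> //; exact: AB.
have hc i : boundary (c i).1 /\ 0 <= (c i).2.
  case: (cF i) => [->|[/AB ? /ltW ? _ _]] //; split => //; exact: boundary0.
have cU i : hball (c i).1 (c i).2 `<=` U.
  have [->|Fc] := cF i; last by case: Fc.
  by move=> q [_ h]; move: h; rewrite /= ltNge dist_ge0.
pose r i := L * (3 * (c i).2).
have r0 i : 0 <= r i by rewrite mulr_ge0 ?(ltW L0)// mulr_ge0//; have [] := hc i.
(* Entries centred outside [A] are padding of radius 0 and get an arbitrary centre. *)
pose x i := if pselect (A (c i).1) then f (c i).1 else 0.
have bx i : boundary (x i).
  rewrite /x; case: pselect => h /=; [exact: fB|exact: boundary0].
apply: le_trans (@leb_sigma_subadditive (fun i => hball (x i) (r i)) (f @` A) _) _.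
  move=> _ [y Ay <-]; have [t t0 yt] := Ur y Ay.
  have [|i [[Ac _ _ _] cy]] := cov (y, Num.min 1 t).
    split=> //=; first by rewrite lt_min ltr01.
      by rewrite ge_min lexx.
    apply: subset_trans yt => q [bq yq]; split=> //; apply: lt_le_trans yq _.
    by rewrite ge_min lexx orbT.
  exists i => //; split; first exact: fB.
  rewrite /x; case: pselect => // h /=; apply: le_lt_trans (lip _ _ Ac Ay) _.
  by rewrite ltr_pM2l.
apply: (@le_trans _ _ (\sum_(i <oo) (ub * (L * 3) ^+ Q * (c i).2 ^+ Q)%:E)%E).
  apply: lee_nneseries => i _; first by move=> _; exact: leb_ge0.
  apply: le_trans (leb_hball_le n_gt0 (bx i) (r0 i)) _.
  by rewrite /r mulrA exprMn mulrA.
have k0 : 0 <= ub * (L * 3) ^+ Q by rewrite mulr_ge0 ?(ltW ub0)// exprn_ge0 ?mulr_ge0 ?(ltW L0).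
apply: le_trans (sum_disjoint_hball k0 hc cU tE) _.
have -> : ub * (L * 3) ^+ Q / lb = C.
  by rewrite /C /lip_const exprMn [L ^+ _ * _]mulrC mulrA mulrAC.
apply: le_trans (lee_wpmul2l _ Ue) _; first by rewrite lee_fin ltW.
rewrite muleDr ?fin_num_adde_defl// -EFinM mulrCA divff ?mulr1//.
by rewrite gt_eqF.
Qed.

Lemma leb_subset0 A B : A `<=` B -> leb B = 0%E -> leb A = 0%E.
Proof.
by move=> AB B0; apply/eqP; rewrite eq_le leb_ge0 andbT -B0; exact: leb_le.
Qed.

Lemma leb_countable_bigcup0 (I : Type) (E : set I) (F : I -> set pt) :
  countable E -> (forall i, E i -> leb (F i) = 0%E) -> leb (\bigcup_(i in E) F i) = 0%E.
Proof.
move=> /countable_injP[f finj] F0; apply/eqP; rewrite eq_le leb_ge0 andbT.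
pose H m := [set x | exists i, [/\ E i, f i = m & F i x]].
apply: le_trans (@leb_sigma_subadditive H _ _) _.
  by move=> x [i Ei Fx]; exists (f i) => //; exists i.
rewrite eseries0// => m _ _; have [[i [Ei fi]]|nE] := pselect (exists i, E i /\ f i = m).
  apply: leb_subset0 (F0 i Ei) => x [j [Ej fj Fj]].
  by have <- : j = i by apply: finj; rewrite ?inE// fj fi.
apply: (@leb_subset0 _ set0); last exact: leb0.
by move=> x [i [Ei fi _]]; case: nE; exists i.
Qed.

Lemma leb_set1 p : boundary p -> leb [set p] = 0%E.
Proof.
move=> bp; apply: (@leb_subset0 _ (box p p)).
  by move=> _ ->; apply/boxE; split=> // j _; rewrite !lexx.
apply/eqP; rewrite eq_le leb_ge0 andbT.
by apply: le_trans (leb_box_le n_gt0 p p) _; rewrite box_volume_self.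
Qed.

End Covering.

(** * Diophantine approximation *)

Section NullSets.
Variables (R : realType) (s : scalars) (n : nat).
Hypothesis n_gt0 : (0 < n)%N.
Local Notation k := (scal R s).
Local Notation G := (PU R s n).
Local Notation pt := ('cV[k]_n * k)%type.
Local Notation leb := (@leb R s n).
Implicit Types (g h : G) (x y p q : pt) (A B : set pt).

Lemma dist_act g p q p' q' : boundary p -> boundary q ->
  act g (Some p) = Some p' -> act g (Some q) = Some q' ->
  dist p' q' * (Num.sqrt (jac g (Some p)) * Num.sqrt (jac g (Some q))) = dist p q.
Proof.
move=> bp bq E F.
have bp' : boundary p' by have := bd_act g (bp : bd (Some p)); rewrite E.
have bq' : boundary q' by have := bd_act g (bq : bd (Some q)); rewrite F.
have := @nn_act _ _ _ g (Some p) (Some q) bp bq; rewrite E F !nn_fin// => H.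
rewrite -[RHS]ger0_norm ?dist_ge0// -sqrtr_sqr -H.
rewrite -mulrA sqrtrM ?sqr_ge0// sqrtr_sqr ger0_norm ?dist_ge0//.
by rewrite sqrtrM// ltW// jac_gt0.
Qed.

(** By [dist_act] the map is Lipschitz where [jac] is bounded below, and countably many such pieces
    exhaust the set off the pole. *)
Lemma leb_act_image0 g A : A `<=` @boundary R s n -> leb A = 0%E ->
  leb (act_image g A) = 0%E.
Proof.
move=> AB A0; pose f p := finpt (act g (Some p)).
pose H (m : nat) := [set p | [/\ A p, act g (Some p) <> None & m.+1%:R^-1 <= jac g (Some p)]].
apply: (@leb_subset0 _ _ _ _ (\bigcup_m (f @` H m))).
  move=> q [p Ap E]; have j0 := jac_gt0 g (AB _ Ap : bd (Some p)).
  exists (Num.truncn (jac g (Some p))^-1) => //; exists p; last by rewrite /f E.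
  split=> //; first by rewrite E.
  by rewrite -[leRHS]invrK lef_pV2 ?posrE ?invr_gt0// ltW// truncnS_gt.
apply: (leb_countable_bigcup0 n_gt0); first exact: countableP.
move=> m _; apply/eqP; rewrite eq_le leb_ge0 andbT.
have HB : H m `<=` @boundary R s n by move=> p [/AB].
apply: le_trans (leb_lipschitz n_gt0 (L := m.+1%:R) _ HB _ _) _ => //.
- move=> p [Ap]; have := bd_act g (AB _ Ap : bd (Some p)); rewrite /f.
  by case: (act g (Some p)).
- move=> p q [Ap p0 jp] [Aq q0 jq]; rewrite /f.
  have bp := AB _ Ap; have bq := AB _ Aq.
  case E : (act g (Some p)) p0 => [p'|//] _; case F : (act g (Some q)) q0 => [q'|//] _ /=.
  rewrite -(dist_act bp bq E F) mulrCA ler_peMr ?dist_ge0//.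
  have m0 : 0 <= m.+1%:R^-1 :> R by rewrite invr_ge0.
  rewrite -[leLHS](mulfV (_ : m.+1%:R != 0))// ler_wpM2l//.
  rewrite -[leLHS](ger0_norm m0) -(sqrtr_sqr m.+1%:R^-1) expr2 sqrtrM//.
  by rewrite ler_pM ?sqrtr_ge0// ler_wsqrtr.
rewrite (_ : leb (H m) = 0%E) ?mule0//.
by apply: leb_subset0 A0 => p [].
Qed.

Lemma leb_finite_bounded A (r : R) : (forall x, A x -> boundary x /\ gauge x <= r) ->
  (leb A < +oo)%E.
Proof.
move=> H; have [A0|/set0P[x0 Ax0]] := eqVneq A set0.
  by rewrite A0 leb0.
have r0 : 0 <= r by apply: le_trans (H _ Ax0).2; exact: gauge_ge0.
apply: le_lt_trans (leb_le (B := hball 0 (r + 1)) _) _.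
  move=> x /H[bx xr]; split=> //; rewrite dist0; apply: le_lt_trans xr _.
  by rewrite ltrDl.
have b0 : boundary (0 : pt) := boundary0 _ _ _.
apply: le_lt_trans (leb_hball_le n_gt0 b0 _) _; last exact: ltry.
by rewrite addr_ge0.
Qed.

Lemma hn_inv g : hn None g^-1%g = hn None g.
Proof.
have := @hn_act _ _ _ g None g^-1%g I; rewrite mulgV => <-.
by rewrite /hn act1 jac1 mulr1 nnC.
Qed.

(** Separates cusps: for different ones the left side is the denominator of [g^-1 * h], which is
    bounded below. *)
Lemma hn_cusps g h p q : act g None = Some p -> act h None = Some q ->
  hn None (g^-1 * h)%g = dist p q ^+ 2 * jac g None * jac h None.
Proof.
move=> E F; have := @hn_act _ _ _ g None (g^-1 * h)%g I.
rewrite mulgA mulgV mul1g => <-; rewrite E /hn F.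
have bp : boundary p by have := bd_act g (I : bd None); rewrite E.
have bq : boundary q by have := bd_act h (I : bd None); rewrite F.
by rewrite nn_fin// mulrAC.
Qed.

End NullSets.

(** * Legendre and Dirichlet estimates *)

Section Approximation.
Variables (R : realType) (s : scalars) (n : nat).
Hypothesis n_gt0 : (0 < n)%N.
Local Notation k := (scal R s).
Local Notation G := (PU R s n).
Local Notation pt := ('cV[k]_n * k)%type.
Local Notation leb := (@leb R s n).
Variable C : iwasawa_cf R s n.
Local Notation K := (cf_domain C).
Local Notation T := (cf_shift C).
Local Notation Gam := (modular_group C).
Local Notation M := (cf_mx C).
Implicit Types (g h : G) (x y : pt).
Variables (r kap : R).
Hypotheses (r0 : 0 <= r) (r1 : r < 1) (Kr : forall x, K x -> gauge x <= r).
Hypotheses (kap0 : 0 < kap)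
  (Hkap : forall g, Gam g -> act g None <> None -> kap <= jac g None).

Lemma r21 : 0 < 1 - r ^+ 2. Proof. by rewrite subr_gt0 expr_lt1. Qed.

Lemma hn_None_small g : Gam g -> hn None g < kap -> act g None = None.
Proof.
move=> Gg hk; apply: contrapT => h; move: hk.
by rewrite hn_None_fin// ltNge Hkap.
Qed.

Definition legendre_const : R := (1 - r ^+ 2) * kap / 4.

Lemma legendre_const_gt0 : 0 < legendre_const.
Proof. by rewrite divr_gt0// mulr_gt0// r21. Qed.

(** Take the first index [j.+1] at which the product of gauges times [R0] drops below half the
    square root of [kap]. Minimality bounds the inverse of [cf_prod C x j], and the hypothesis then
    bounds the second term of [hn_cf_le] by the same half. So the inverse of [M x j.+1] times [g]
    has too small a form at infinity not to fix it. *)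
Lemma legendre x g : K x -> ~ cf_finite C x -> Gam g ->
  Num.sqrt (hn (Some x) g) * Num.sqrt (hn None g) < legendre_const ->
  exists i, act g None = act (M x i) None.
Proof.
move=> Kx fx Gg; set tau := Num.sqrt (hn (Some x) g); set R0 := Num.sqrt (hn None g) => H.
have tau0 : 0 <= tau by exact: sqrtr_ge0.
have R00 : 0 <= R0 by exact: sqrtr_ge0.
have sk0 : 0 < Num.sqrt kap by rewrite sqrtr_gt0.
have skk : Num.sqrt kap * Num.sqrt kap = kap by rewrite -expr2 sqr_sqrtr ?ltW.
have fin i : Num.sqrt (hn None ((M x i)^-1 * g)%g) < Num.sqrt kap -> act g None = act (M x i) None.
  rewrite (ltr_sqrt _ kap0) => hk; have [GM _ _ _] := cf_mx_spec n_gt0 i Kx fx.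
  have := hn_None_small (subgroupM (Gam_sub C) (subgroupV (Gam_sub C) GM) Gg) hk.
  rewrite (actM _ _ (I : bd None)) => E.
  by rewrite -[LHS](actVK (M x i) (bd_act g (I : bd None))) E.
have [m Hm] : exists m, cf_prod C x m * R0 < Num.sqrt kap / 2.
  have e0 : 0 < Num.sqrt kap / 2 / (R0 + 1) by rewrite !divr_gt0// ltr_wpDl.
  have [m _ /(_ m (leqnn m)) Hm] := cf_prod_cvg n_gt0 r0 r1 Kr Kx fx e0.
  exists m.+1; move: Hm; rewrite ltr_pdivlMr ?ltr_wpDl//; apply: le_lt_trans.
  by rewrite ler_wpM2l ?lerDl// ltW// cf_prod_gt0.
have exm : exists m, cf_prod C x m * R0 < Num.sqrt kap / 2 by exists m.
case: (ex_minnP exm) => -[|j] Hj minj.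
  exists 0%N; apply: fin; rewrite /= invg1 mul1g.
  move: Hj; rewrite /cf_prod big_ord0 mul1r => /lt_trans; apply.
  by rewrite ltr_pdivrMr// ltr_pMr// ltr1n.
exists j.+1; apply: fin.
have pj := cf_prod_gt0 n_gt0 j Kx fx.
have Hj' : Num.sqrt kap / 2 <= cf_prod C x j * R0.
  by rewrite leNgt; apply/negP => /minj; rewrite ltnn.
apply: le_lt_trans (hn_cf_le n_gt0 r0 r1 Kr j g Kx fx) _; rewrite -/tau -/R0.
have : tau / cf_prod C x j / (1 - r ^+ 2) <= Num.sqrt kap / 2.
  rewrite ler_pdivrMr ?r21// ler_pdivrMr//.
  rewrite -(ler_pM2l sk0); apply: (@le_trans _ _ (2 * (tau * R0) * cf_prod C x j)).
    have -> : 2 * (tau * R0) * cf_prod C x j = tau * (2 * (cf_prod C x j * R0)) by ring.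
    rewrite mulrC ler_wpM2l//; move: Hj'; lra.
  have -> : Num.sqrt kap * (Num.sqrt kap / 2 * (1 - r ^+ 2) * cf_prod C x j) =
    2 * legendre_const * cf_prod C x j.
    by rewrite /legendre_const -{3}skk; field.
  by rewrite ler_pM2r// ler_pM2l// ltW.
move: Hj; lra.
Qed.

Definition dirichlet_const : R := (1 - r ^+ 2)^-1.

Lemma dirichlet_const_ge1 : 1 <= dirichlet_const.
Proof. by rewrite /dirichlet_const invf_ge1 ?r21// gerBl sqr_ge0. Qed.

(** The case [g = 1] of [hn_cf_le]: infinity pairs to 0 with itself, so only the error term
    remains. *)
Lemma sqrt_denominator_le x i : K x -> ~ cf_finite C x ->
  Num.sqrt (hn None (M x i.+1)^-1%g) <= dirichlet_const / cf_prod C x i.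
Proof.
move=> Kx fx; have := hn_cf_le n_gt0 r0 r1 Kr i 1%g Kx fx.
by rewrite mulg1 hn1 hn_None1 sqrtr0 mulr0 add0r sqrtr1 div1r mulrC.
Qed.

Lemma cf_mx_jac x i : K x -> ~ cf_finite C x ->
  hn None (M x i.+1)^-1%g = jac (M x i.+1) None.
Proof.
move=> Kx fx; have [q [_ E _]] := cf_mx_dist n_gt0 r0 r1 Kr kap0 Hkap i Kx fx.
by rewrite hn_inv hn_None_fin// E.
Qed.

(** The quantity equals [cf_prod C x i.+1] times the square root of the denominator;
    [sqrt_denominator_le] leaves one gauge, at most 1, times the constant. *)
Lemma dirichlet x i : K x -> ~ cf_finite C x -> exists q, [/\ boundary q,
  act (M x i.+1) None = Some q & dist x q * jac (M x i.+1) None <= dirichlet_const].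
Proof.
move=> Kx fx; have [q [bq E D]] := cf_mx_dist n_gt0 r0 r1 Kr kap0 Hkap i Kx fx.
exists q; split=> //; have j0 := jac_gt0 (M x i.+1) (I : bd None).
have p0 := cf_prod_gt0 n_gt0 i Kx fx; have p1 := cf_prod_gt0 n_gt0 i.+1 Kx fx.
have [Ki _] := cf_iter n_gt0 i Kx fx.
have h := sqrt_denominator_le i Kx fx; rewrite cf_mx_jac// in h.
have -> : dist x q * jac (M x i.+1) None = cf_prod C x i.+1 * Num.sqrt (jac (M x i.+1) None).
  rewrite -[jac _ _ in LHS]sqr_sqrtr ?(ltW j0)// expr2 mulrA; congr (_ * _).
  rewrite -[RHS]ger0_norm ?(ltW p1)// -sqrtr_sqr -D sqrtrM ?sqr_ge0// sqrtr_sqr.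
  by rewrite ger0_norm ?dist_ge0.
apply: le_trans (ler_wpM2l (ltW p1) h) _.
rewrite [cf_prod C x i.+1]/cf_prod big_ord_recr/= -/(cf_prod C x i).
set D1 := dirichlet_const; set P := cf_prod C x i in p0 *.
have -> : P * gauge (iter i T x) * (D1 / P) = gauge (iter i T x) * D1.
  by field; rewrite gt_eqF.
by rewrite ler_piMl ?(le_trans _ dirichlet_const_ge1)// (le_trans (Kr Ki))// ltW.
Qed.

(** With bounded denominators, late convergents would be too close together to be different cusps,
    hence all equal to one [c]. Convergence would put [c] at distance 0 from [x], but [cf_mx_dist]
    keeps this distance positive. *)
Lemma denominators_unbounded x (t : R) : K x -> ~ cf_finite C x ->
  exists i, t <= jac (M x i.+1) None.
Proof.
move=> Kx fx; apply: contrapT => H.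
have bt i : jac (M x i.+1) None < t by rewrite ltNge; apply/negP => ?; apply: H; exists i.
have t0 : 0 < t by apply: lt_trans (bt 0%N); exact: jac_gt0.
have sk0 : 0 < Num.sqrt kap by rewrite sqrtr_gt0.
have bx := K_boundary Kx.
(* Makes the form between two late convergents at most [kap / 4]. *)
pose e := kap / (4 * t); have e0 : 0 < e by rewrite divr_gt0// mulr_gt0.
have [m _ Hm] := cf_prod_cvg n_gt0 r0 r1 Kr Kx fx e0.
have [c [bc Ec Dc]] := cf_dist_le n_gt0 r0 r1 Kr kap0 Hkap m Kx fx.
have same i : (m <= i)%N -> act (M x i.+1) None = Some c.
  move=> mi; have [c' [bc' Ec' Dc']] := cf_dist_le n_gt0 r0 r1 Kr kap0 Hkap i Kx fx.
  have [Gm _ _ _] := cf_mx_spec n_gt0 m.+1 Kx fx.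
  have [Gi _ _ _] := cf_mx_spec n_gt0 i.+1 Kx fx.
  rewrite -Ec -[RHS](actVK (M x i.+1)); last exact: bd_act.
  congr act; rewrite -actM//; apply/esym/hn_None_small.
    exact: (subgroupM (Gam_sub C) (subgroupV (Gam_sub C) Gi) Gm).
  rewrite (hn_cusps Ec' Ec).
  have dd : dist c' c < 2 * (e / Num.sqrt kap).
    apply: le_lt_trans (dist_triangle bc' bx bc) _; rewrite (distC bc' bx).
    have h1 : cf_prod C x m.+1 / Num.sqrt kap < e / Num.sqrt kap.
      by rewrite ltr_pM2r ?invr_gt0//; apply: Hm => /=.
    have h2 : cf_prod C x i.+1 / Num.sqrt kap < e / Num.sqrt kap.
      by rewrite ltr_pM2r ?invr_gt0//; apply: Hm => /=.
    lra.
  have d2 : dist c' c ^+ 2 <= (2 * (e / Num.sqrt kap)) ^+ 2.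
    have z0 : 0 <= 2 * (e / Num.sqrt kap) by rewrite mulr_ge0// divr_ge0// ltW.
    by rewrite ler_sqr ?nnegrE ?dist_ge0//; exact: ltW.
  have E4 : (2 * (e / Num.sqrt kap)) ^+ 2 * t * t = kap / 4.
    transitivity (kap ^+ 2 / (4 * Num.sqrt kap ^+ 2)).
      by rewrite /e; field; rewrite !gt_eqF.
    by rewrite sqr_sqrtr ?ltW//; field; rewrite gt_eqF.
  apply: (@le_lt_trans _ _ (kap / 4)); last by rewrite ltr_pdivrMr// ltr_pMr// ltr1n.
  have j1 := jac_gt0 (M x i.+1) (I : bd None).
  have j2 := jac_gt0 (M x m.+1) (I : bd None).
  have b1 := ltW (bt i); have b2 := ltW (bt m).
  have s0 := sqr_ge0 (dist c' c); rewrite -E4.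
  apply: ler_pM b2; [exact: mulr_ge0 s0 (ltW j1)|exact: ltW|].
  exact: ler_pM s0 (ltW j1) d2 b1.
have dxc : 0 < dist x c.
  have [c' [bc' Ec' D]] := cf_mx_dist n_gt0 r0 r1 Kr kap0 Hkap m Kx fx.
  move: Ec'; rewrite Ec => -[ec]; rewrite -ec in D.
  rewrite lt_def dist_ge0 andbT; apply/eqP => d0.
  move: D; rewrite d0 expr0n mul0r => /esym/eqP.
  by rewrite sqrf_eq0 gt_eqF// cf_prod_gt0.
have e'0 : 0 < dist x c * Num.sqrt kap by rewrite mulr_gt0.
have [m' _ Hm'] := cf_prod_cvg n_gt0 r0 r1 Kr Kx fx e'0.
have [c' [bc' Ec' D']] := cf_dist_le n_gt0 r0 r1 Kr kap0 Hkap (maxn m m') Kx fx.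
move: Ec'; rewrite same ?leq_maxl// => -[ec]; move: D'; rewrite -ec.
by rewrite leNgt ltr_pdivrMr// Hm'//= leq_maxr.
Qed.

Definition badly_approx (e t : R) : set pt := [set x | [/\ K x, ~ cf_finite C x &
  forall g c, Gam g -> act g None = Some c -> t <= jac g None -> e <= dist x c * jac g None]].

(** The set is porous. The ball of radius [e / q] about a convergent with large denominator [q]
    misses it, and by [dirichlet] this ball lies within [(dirichlet_const + e) / q] of [x]: a fixed
    proportion at arbitrarily small scales. *)
Lemma badly_approx_null (e t : R) : 0 < e -> leb (badly_approx e t) = 0%E.
Proof.
move=> e0; have c1 := dirichlet_const_ge1.
have c0 : 0 < dirichlet_const by apply: lt_le_trans c1.
have ce0 : 0 < dirichlet_const + e by rewrite addr_gt0.
pose sg := hball_lb R s n * (e / (dirichlet_const + e)) ^+ hdim s n.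
have sg0 : 0 < sg by rewrite mulr_gt0 ?hball_lb_gt0// exprn_gt0// divr_gt0.
apply: (porous_null n_gt0 _ _ sg0).
- by move=> x [Kx _ _]; exact: (K_boundary Kx).
- by apply: (@leb_finite_bounded _ _ _ n_gt0 _ r) => x [Kx _ _]; split; [exact: (K_boundary Kx)|exact: Kr].
move=> x [Kx fx Hx] r2 r20; have bx := K_boundary Kx.
(* The summand 1 makes the radius strictly smaller than [r2]. *)
have [i Hi] := denominators_unbounded (Num.max t ((dirichlet_const + e) / r2 + 1)) Kx fx.
have [c [bc Ec Dc]] := dirichlet i Kx fx.
have [GM _ _ _] := cf_mx_spec n_gt0 i.+1 Kx fx.
set q := jac (M x i.+1) None in Hi Dc.
have q0 : 0 < q by exact: jac_gt0.
move: Hi; rewrite ge_max => /andP[tq rq].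
exists ((dirichlet_const + e) / q); split; first by rewrite divr_gt0.
  rewrite ltr_pdivrMr// mulrC -ltr_pdivrMr//; apply: lt_le_trans rq.
  by rewrite ltrDl.
exists (hball c (e / q)); split.
- exact: caratheodory_hball.
- move=> y [by' cy]; split=> //; apply: le_lt_trans (dist_triangle bx bc by') _.
  rewrite mulrDl ler_ltD// ler_pdivlMr//.
- apply/seteqP; split=> // y [[by' cy] [Ky fy Hy]].
  have := Hy _ _ GM Ec tq; rewrite leNgt => /negP; apply.
  by rewrite distC// -ltr_pdivlMr.
apply: le_trans (leb_hball_ge n_gt0 bc _); last by rewrite divr_ge0 ?ltW.
by rewrite lee_fin /sg -mulrA -exprMn mulrA divfK// gt_eqF.
Qed.

End Approximation.

(** * Orbits of the modular group and tails of expansions *)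

Section Serret.
Variables (R : realType) (s : scalars) (n : nat).
Hypothesis n_gt0 : (0 < n)%N.
Local Notation k := (scal R s).
Local Notation G := (PU R s n).
Local Notation pt := ('cV[k]_n * k)%type.
Local Notation leb := (@leb R s n).
Local Notation boundary := (@boundary R s n).
Variable C : iwasawa_cf R s n.
Local Notation Z := (cf_lattice C).
Local Notation K := (cf_domain C).
Local Notation T := (cf_shift C).
Local Notation Gam := (modular_group C).
Local Notation M := (cf_mx C).
Implicit Types (g h : G) (x y p q : pt) (A B : set pt).
Variables (r kap : R).
Hypotheses (r0 : 0 <= r) (r1 : r < 1) (Kr : forall x, K x -> gauge x <= r).
Hypotheses (kap0 : 0 < kap)
  (Hkap : forall g, Gam g -> act g None <> None -> kap <= jac g None).
Hypotheses (discreteC : cf_discrete C) (completeC : cf_complete C).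

Definition saturation A : set pt := \bigcup_(g in Gam) act_image g A.

Lemma leb_saturation0 A : A `<=` boundary -> leb A = 0%E -> leb (saturation A) = 0%E.
Proof.
move=> AB A0; apply: (leb_countable_bigcup0 n_gt0).
  exact: discrete_countable (Gam_sub C) discreteC.
by move=> g _; exact: leb_act_image0.
Qed.

Lemma sub_saturation A : A `<=` saturation A.
Proof. by move=> x Ax; exists 1%g; [exact: (Gam_sub C).1|exists x => //; rewrite act1]. Qed.

Lemma act_saturation A g p q : A `<=` boundary -> Gam g ->
  act g (Some p) = Some q -> saturation A p -> saturation A q.
Proof.
move=> AB Gg E [h Gh [x Ax F]]; exists (g * h)%g; first exact: subgroupM (Gam_sub C) Gg Gh.
by exists x => //; rewrite actM ?F//; exact: AB.
Qed.

Definition cusps : set pt := [set p | exists2 g, Gam g & act g None = Some p].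

Lemma leb_cusps : leb cusps = 0%E.
Proof.
apply: (@leb_subset0 _ _ _ _ (\bigcup_(g in Gam) [set p | act g None = Some p])).
  by move=> p [g Gg E]; exists g.
apply: (leb_countable_bigcup0 n_gt0).
  exact: discrete_countable (Gam_sub C) discreteC.
move=> g _; have := bd_act g (I : bd None).
case: (act g None) => [p|] bp.
  by apply: (@leb_subset0 _ _ _ _ [set p]); [move=> q [->]|exact: leb_set1].
by rewrite (_ : [set _ | _] = set0) ?leb0//; apply/seteqP; split.
Qed.

(** 0 is the image of infinity under [iota], and each step of the shift moves the point by an
    element of the modular group. *)
Lemma cf_finite_cusp x : K x -> cf_finite C x -> cusps x.
Proof.
move=> Kx [j]; elim: j x Kx => [|i IH] x Kx.
  rewrite /= => ->; exists (cf_inv C); [exact: iota_Gam|exact: iota_None].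
rewrite iterSr; have [->|x0] := eqVneq x 0.
  by move=> _; exists (cf_inv C); [exact: iota_Gam|exact: iota_None].
have [Zd KT E _] := cf_step n_gt0 Kx x0.
move=> /(IH _ KT)[g Gg F].
set h := ((cf_digit C x)^-1 * cf_inv C)%g in E.
have Gh : Gam h.
  apply: (subgroupM (Gam_sub C)); last exact: iota_Gam.
  by apply: (subgroupV (Gam_sub C)); exact: Z_Gam.
exists (h^-1 * g)%g.
  exact: subgroupM (Gam_sub C) (subgroupV (Gam_sub C) Gh) Gg.
by rewrite actM// F -E actK//; exact: (K_boundary Kx).
Qed.

Definition overlap : set pt := K `&` \bigcup_(a in Z `\ 1%g) act_image a K.

Local Notation eps := (legendre_const r kap / 2).

(* Well-approximable points have cusps close enough to be convergents both of
   [x] and, once moved by [g], of [y]. *)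
Lemma serret x y g : K x -> ~ cf_finite C x -> K y -> ~ cf_finite C y ->
  Gam g -> act g (Some x) = Some y ->
  (forall m : nat, ~ badly_approx C eps m%:R x) ->
  (forall j, ~ overlap (iter j T y)) ->
  exists i j, iter i T x = iter j T y.
Proof.
move=> Kx fx Ky fy Gg E wx oy; have bx := K_boundary Kx; have by' := K_boundary Ky.
have e0 : 0 < eps by rewrite divr_gt0// legendre_const_gt0.
(* The pole of [g]; [al] and [be] measure [x] and infinity against it. *)
set P := act g^-1%g None; have bP : bd P := bd_act g^-1%g (I : bd None).
have gP : act g P = None by rewrite actVK.
have jx := jac_gt0 g (bx : bd (Some x)); have jP := jac_gt0 g bP.
pose al := Num.sqrt (nn (Some x) P); pose be := Num.sqrt (nn None P).
have alE : nn (Some x) P = jac g (Some x) * jac g P.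
  by rewrite -(nn_act g (bx : bd (Some x)) bP) E gP nnC nn_None_fin mul1r.
have al0 : 0 < al by rewrite sqrtr_gt0 alE mulr_gt0.
have be0 : 0 <= be by exact: sqrtr_ge0.
(* A denominator of at least [m] forces [d * be <= al], so that replacing [x] by [c] at most doubles
   the factor seen from the pole. This is why [eps] is half of [legendre_const]. *)
pose m := (Num.truncn (eps * be / al)).+1.
have [h [c [Gh Ec mh dh]]] : exists h c, [/\ Gam h, act h None = Some c,
    m%:R <= jac h None & dist x c * jac h None < eps].
  apply: contrapT => H; apply: (wx m); split=> // h c Gh Ec mh.
  by rewrite leNgt; apply/negP => ?; apply: H; exists h, c.
have bc : boundary c by have := bd_act h (I : bd None); rewrite Ec.
set d := dist x c in dh; set q := jac h None in mh dh.
have q0 : 0 < q by exact: jac_gt0.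
have d0 : 0 <= d by exact: dist_ge0.
have hx : Num.sqrt (hn (Some x) h) = d * Num.sqrt q.
  by rewrite /hn Ec nn_fin// sqrtrM ?sqr_ge0// sqrtr_sqr ger0_norm.
have qq : Num.sqrt q * Num.sqrt q = q by rewrite -expr2 sqr_sqrtr// ltW.
have hN : Num.sqrt (hn None h) = Num.sqrt q by rewrite hn_None_fin ?Ec.
have small : Num.sqrt (hn (Some x) h) * Num.sqrt (hn None h) < eps.
  by rewrite hx hN -mulrA qq.
have half : eps < legendre_const r kap.
  by rewrite ltr_pdivrMr// ltr_pMr ?ltr1n// legendre_const_gt0.
have [i Ei] := legendre n_gt0 r0 r1 Kr kap0 Hkap Kx fx Gh (lt_trans small half).
have Ggh : Gam (g * h)%g := subgroupM (Gam_sub C) Gg Gh.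
have hP : Num.sqrt (hn P h) <= (al + d * be) * Num.sqrt q.
  rewrite /hn Ec -/q (sqrtrM _ (nn_ge0 _ _)) (ler_wpM2r (sqrtr_ge0 _))// nnC.
  exact: sqrt_nn_triangle.
have hgx : Num.sqrt (hn (Some y) (g * h)%g) * Num.sqrt (jac g (Some x)) = d * Num.sqrt q.
  by rewrite -hx -(@hn_act _ _ _ g (Some x) h bx) E [in RHS]sqrtrM ?hn_ge0.
have hgN : Num.sqrt (hn None (g * h)%g) * Num.sqrt (jac g P) = Num.sqrt (hn P h).
  by rewrite -(@hn_act _ _ _ g P h bP) gP [in RHS]sqrtrM ?hn_ge0.
have alE' : al = Num.sqrt (jac g (Some x)) * Num.sqrt (jac g P).
  by rewrite /al alE sqrtrM// ltW.
have dbe : d * be <= al.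
  rewrite -(ler_pM2r q0).
  have h1 : d * be * q <= eps * be by rewrite mulrAC ler_wpM2r// ltW.
  apply: le_trans h1 _; rewrite [al * q]mulrC -ler_pdivrMr//; apply: le_trans mh.
  by rewrite ltW// truncnS_gt.
have small' : Num.sqrt (hn (Some y) (g * h)%g) * Num.sqrt (hn None (g * h)%g) <
    legendre_const r kap.
  rewrite -(ltr_pM2r al0).
  have -> : Num.sqrt (hn (Some y) (g * h)%g) * Num.sqrt (hn None (g * h)%g) * al =
      d * Num.sqrt q * Num.sqrt (hn P h) by rewrite -hgx -hgN alE'; ring.
  have t0 : 0 <= d * Num.sqrt q by rewrite mulr_ge0// sqrtr_ge0.
  apply: le_lt_trans (ler_wpM2l t0 hP) _.
  have -> : d * Num.sqrt q * ((al + d * be) * Num.sqrt q) = d * q * (al + d * be).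
    by rewrite -{3}qq; ring.
  have h1 : d * q * (al + d * be) <= d * q * (al *+ 2).
    by rewrite ler_wpM2l ?mulr_ge0 ?(ltW q0)// mulr2n lerD2l.
  apply: le_lt_trans h1 _; rewrite mulrnAr -mulrnAl ltr_pM2r//.
  by move: dh; rewrite ltr_pdivlMr// mulr_natr.
have [j Ej] := legendre n_gt0 r0 r1 Kr kap0 Hkap Ky fy Ggh small'.
have [GMi Ai _ _] := cf_mx_spec n_gt0 i Kx fx.
have [GMj _ Aj _] := cf_mx_spec n_gt0 j Ky fy.
have [Ki _] := cf_iter n_gt0 i Kx fx; have [Kj _] := cf_iter n_gt0 j Ky fy.
have bi := K_boundary Ki.
(* [g] carries a convergent of [x] to a convergent of [y], so [f] fixes infinity and completeness
   puts it into the lattice. It maps one tail to the other inside [K], and off [overlap] this leaves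
   only the identity. *)
pose f := ((M y j)^-1 * (g * M x i))%g.
have f0 : act f None = None.
  rewrite /f (actM _ _ (I : bd None)) (actM g (M x i) (I : bd None)) -Ei.
  by rewrite -(actM g h (I : bd None)) Ej; exact: actK.
have Ef : act f (Some (iter i T x)) = Some (iter j T y).
  by rewrite /f (actM _ _ (bi : bd (Some _))) (actM _ _ (bi : bd (Some _))) Ai E.
have Zf : Z f.
  rewrite -completeC; split; last exact: f0.
  apply: (subgroupM (Gam_sub C)); first exact: (subgroupV (Gam_sub C) GMj).
  exact: subgroupM (Gam_sub C) Gg GMi.
exists i, j; have [f1|f1] := eqVneq f 1%g; first by move: Ef; rewrite f1 act1 => -[].
exfalso; apply: (oy j); split; first exact: Kj.
by exists f; [split; [exact: Zf|exact/eqP]|exists (iter i T x)].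
Qed.

Section Invariant.
Variable B : set pt.
Hypotheses (BK : B `<=` K) (TB : leb ((K `&` T @^-1` B) `+` B) = 0%E).

(** Saturating this null set makes its complement stable under the modular group, hence under the
    shift in [K]. *)
Definition bad : set pt := [set x | (K `&` T @^-1` B `+` B) x \/ overlap x \/
  cusps x \/ exists m : nat, badly_approx C eps m%:R x].

Lemma bad_boundary : bad `<=` boundary.
Proof.
move=> x [[[[Kx _] _]|[/BK Kx _]]|[[Kx _]|[[g _ E]|[m [Kx _ _]]]]]; try exact: (K_boundary Kx).
by have := bd_act g (I : bd None); rewrite E.
Qed.

Lemma leb_saturation_bad : leb (saturation bad) = 0%E.
Proof.
apply: leb_saturation0; first exact: bad_boundary.
have e0 : 0 < eps by rewrite divr_gt0// legendre_const_gt0.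
have ov : leb overlap = 0%E by have [] := cf_domainP C.
apply: (@leb_subset0 _ _ _ _ ((K `&` T @^-1` B `+` B) `|` (overlap `|`
  (cusps `|` \bigcup_m badly_approx C eps m%:R)))).
  by move=> x [h|[h|[h|[m h]]]]; [left|right; left|right; right; left|right; right; right; exists m].
have U A D : leb A = 0%E -> leb D = 0%E -> leb (A `|` D) = 0%E.
  move=> A0 D0; apply/eqP; rewrite eq_le leb_ge0 andbT.
  by apply: le_trans (lebU2 n_gt0 _ _) _; rewrite A0 D0 adde0.
apply: (U _ _ TB); apply: (U _ _ ov); apply: U leb_cusps _.
apply: (leb_countable_bigcup0 n_gt0); first exact: countableP.
by move=> m _; exact: (badly_approx_null n_gt0 r0 r1 Kr kap0 Hkap).
Qed.

Lemma good_infinite x : K x -> ~ saturation bad x -> ~ cf_finite C x.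
Proof.
move=> Kx gx fx; apply: gx; apply: sub_saturation.
by right; right; left; exact: cf_finite_cusp.
Qed.

Lemma good_act g p q : Gam g -> boundary p -> act g (Some p) = Some q ->
  ~ saturation bad p -> ~ saturation bad q.
Proof.
move=> Gg bp E gp bq; apply: gp.
apply: (act_saturation bad_boundary (subgroupV (Gam_sub C) Gg) _ bq).
by rewrite -E actK.
Qed.

Lemma good_iter x i : K x -> ~ saturation bad x -> ~ saturation bad (iter i T x).
Proof.
move=> Kx gx; have fx := good_infinite Kx gx.
have [GM _ E _] := cf_mx_spec n_gt0 i Kx fx.
exact: good_act (subgroupV (Gam_sub C) GM) (K_boundary Kx) E gx.
Qed.

Lemma good_invariant x i : K x -> ~ saturation bad x -> (B (iter i T x) <-> B x).
Proof.
move=> Kx gx; elim: i => //= i IH; rewrite -IH.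
have [Ki _] := cf_iter n_gt0 i Kx (good_infinite Kx gx).
have gi := good_iter (i := i) Kx gx.
have hB : ~ (K `&` T @^-1` B `+` B) (iter i T x).
  by move=> h; apply: gi; apply: sub_saturation; left.
by split=> h; apply: contrapT => nh; apply: hB; [left|right]; split=> // -[].
Qed.

Lemma good_orbit x y g : K x -> K y -> Gam g -> act g (Some x) = Some y ->
  ~ saturation bad x -> (B x <-> B y).
Proof.
move=> Kx Ky Gg E gx.
have gy := good_act Gg (K_boundary Kx) E gx.
have [i [j ij]] : exists i j, iter i T x = iter j T y.
  apply: (serret Kx (good_infinite Kx gx) Ky (good_infinite Ky gy) Gg E).
    by move=> m h; apply: gx; apply: sub_saturation; right; right; right; exists m.
  move=> j h; apply: (good_iter (i := j) Ky gy); apply: sub_saturation.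
  by right; left.
by rewrite -(good_invariant i Kx gx) ij good_invariant.
Qed.

End Invariant.
End Serret.

(** * Ergodicity *)

Section Density.
Variables (R : realType) (s : scalars) (n : nat).
Hypothesis n_gt0 : (0 < n)%N.
Local Notation k := (scal R s).
Local Notation pt := ('cV[k]_n * k)%type.
Local Notation leb := (@leb R s n).
Local Notation boundary := (@boundary R s n).
Local Notation Q := (hdim s n).
Local Notation N := ((1 + n + 1)%:R : R).
Implicit Types (x y p q : pt) (A B : set pt).

(** Points of [A] about which the complement keeps a proportion of order [1 / m.+1] at arbitrarily
    small radii form a porous set, hence a null set; these sets and [E] do not exhaust [A]. *)
Lemma density_point A E (r : R) : (forall x, A x -> boundary x /\ gauge x <= r) ->
  leb.-caratheodory A -> leb A <> 0%E -> leb E = 0%E ->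
  exists x, [/\ A x, ~ E x & forall m : nat, exists2 r0, 0 < r0 &
    forall rho, 0 < rho -> rho < r0 ->
      (leb (hball x rho `\` A) <= (rho ^+ Q / m.+1%:R)%:E)%E].
Proof.
move=> bA mA A0 E0.
pose D (m : nat) := [set x | A x /\ forall r0, 0 < r0 -> exists rho, [/\ 0 < rho, rho < r0 &
  ((m.+1%:R^-1 * rho ^+ Q)%:E <= leb (hball x rho `\` A))%E]].
have D0 m : leb (D m) = 0%E.
  have sg0 : 0 < m.+1%:R^-1 :> R by [].
  apply: (porous_null n_gt0 _ _ sg0).
  - by move=> x [/bA[]].
  - by apply: (@leb_finite_bounded _ _ _ n_gt0 _ r) => x [/bA].
  move=> x [Ax Hx] r0 r00; have [rho [h1 h2 h3]] := Hx _ r00.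
  exists rho; split=> //; exists (hball x rho `\` A); split=> //.
  - apply: (@caratheodory_measurable_setD _ _ (lebO R s n_gt0)) => //.
    by apply: caratheodory_hball => //; have [] := bA _ Ax.
  - by rewrite -subset0 => y [[_ nA] [Ay _]].
have [H|H] := pselect (A `<=` E `|` \bigcup_m D m).
  case: A0; apply: (leb_subset0 H); apply/eqP; rewrite eq_le leb_ge0 andbT.
  apply: le_trans (lebU2 n_gt0 _ _) _; rewrite E0 add0e.
  by rewrite (leb_countable_bigcup0 n_gt0)//; exact: countableP.
have /existsNP[x /not_implyP[Ax nx]] := H; exists x; split=> //.
  by move=> Ex; apply: nx; left.
move=> m; apply: contrapT => Hm; apply: nx; right; exists m => //; split=> // r0 r00.
apply: contrapT => h; apply: Hm; exists r0 => // rho h1 h2; rewrite leNgt; apply/negP => h3.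
by apply: h; exists rho; split=> //; rewrite mulrC ltW.
Qed.

Lemma phi_mbound p : boundary p -> gauge p <= 1 -> mbound (N * (2 * 1)) (phi (Some p)).
Proof.
move=> bp p1; rewrite -(tau_0 bp); apply: mbound_mul; first by have [] := tau_bound bp p1.
rewrite phi_0 /hvec => i j; rewrite !mxE.
by do 2?[case: splitP => ? _; rewrite ?mxE]; rewrite ?knorm0// (ord1 j) ?eqxx ?knorm1//;
  case: (_ == _); rewrite ?knorm1 ?knorm0.
Qed.

(** The lift of [p] is null, so the squared distance is the norm of the pairing of [phi (Some p)]
    with the difference of the lifts, which is small for lifts of the same colour. *)
Lemma ball_colouring (e : R) : 0 < e -> exists (F : finType) (col : pt -> F),
  forall p q, boundary p -> gauge p <= 1 -> boundary q -> gauge q <= 1 ->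
    col p = col q -> dist p q < e.
Proof.
move=> e0; have N0 : 0 < N by rewrite ltr0n addn1.
pose del := e ^+ 2 / (4 * N ^+ 3).
have del0 : 0 < del by rewrite divr_gt0 ?exprn_gt0// mulr_gt0// exprn_gt0.
have [F [col H]] := @grid_colouring R s (1 + n + 1) 1 (N * (2 * 1)) del del0.
exists F, (fun p => col (phi (Some p))) => p q bp p1 bq q1 E.
have Hd := H _ _ (phi_mbound bq q1) (phi_mbound bp p1) (esym E).
rewrite -ltr_sqr ?nnegrE ?dist_ge0 ?(ltW e0)// -nn_fin// /nn.
have -> : hform (phi (Some p)) (phi (Some q)) =
    (ctrmx (phi (Some p)) *m formJ R s n *m (phi (Some q) - phi (Some p))) 0 0.
  rewrite mulmxBr !mxE -/(hform (phi (Some p)) (phi (Some q))).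
  have := @bd_null R s n (Some p) bp; rewrite /hform => h.
  by rewrite /hform mxE in h *; rewrite mxE h subr0.
have /(_ 0 0) := mbound_mul (mbound_mul (mbound_ctrmx (phi_mbound bp p1))
  (@formJ_mbound R s n)) Hd.
move=> /le_lt_trans; apply.
have -> : N * (N * (N * (2 * 1) * 1) * del) = e ^+ 2 / 2.
  by rewrite /del; field; rewrite gt_eqF.
by rewrite ltr_pdivrMr// ltr_pMr ?exprn_gt0// ltr1n.
Qed.

End Density.

Lemma infinitely_often (F : finType) (col : nat -> F) :
  exists f, forall i, exists2 j, (i <= j)%N & col j = f.
Proof.
apply: contrapT => H.
have /choice[b Hb] f : exists i, forall j, (i <= j)%N -> col j <> f.
  apply: contrapT => Hf; apply: H; exists f => i; apply: contrapT => Hi.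
  by apply: Hf; exists i => j ij cj; apply: Hi; exists j.
apply: (Hb (col (\max_f b f)) (\max_f b f)) => //.
exact: (leq_bigmax (F := b) _).
Qed.

(** * Bounded distortion of the inverse branches *)

Section Ergodicity.
Variables (R : realType) (s : scalars) (n : nat).
Hypothesis n_gt0 : (0 < n)%N.
Local Notation k := (scal R s).
Local Notation G := (PU R s n).
Local Notation pt := ('cV[k]_n * k)%type.
Local Notation leb := (@leb R s n).
Local Notation boundary := (@boundary R s n).
Local Notation Q := (hdim s n).
Variable C : iwasawa_cf R s n.
Local Notation Z := (cf_lattice C).
Local Notation K := (cf_domain C).
Local Notation T := (cf_shift C).
Local Notation Gam := (modular_group C).
Local Notation M := (cf_mx C).
Implicit Types (g : G) (h x y p q : pt) (A B : set pt).
Variables (r kap : R).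
Hypotheses (r0 : 0 <= r) (r1 : r < 1) (Kr : forall x, K x -> gauge x <= r).
Hypotheses (kap0 : 0 < kap)
  (Hkap : forall g, Gam g -> act g None <> None -> kap <= jac g None).

(** Chosen to keep the oscillation in [cf_mx_distortion] within half of the central value. *)
Definition zoom_radius : R := (2 * dirichlet_const r)^-1.
Local Notation eta := zoom_radius.

Lemma zoom_radius_gt0 : 0 < eta.
Proof.
by rewrite invr_gt0 mulr_gt0// (lt_le_trans ltr01)// dirichlet_const_ge1.
Qed.

(** The square root of [jac (M x i.+1)] at [h] is the root of a form value at [h], hence Lipschitz
    in [h] with the root of a denominator as constant. At the tail of [x] it is the inverse of the
    product of gauges, and by [sqrt_denominator_le] it varies by at most half of that within
    [eta]. *)
Lemma cf_mx_distortion x i h : K x -> ~ cf_finite C x ->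
  hball (iter i.+1 T x) eta h ->
  exists p, [/\ boundary p, act (M x i.+1) (Some h) = Some p,
    (2 * cf_prod C x i.+1)^-1 <= Num.sqrt (jac (M x i.+1) (Some h)) &
    Num.sqrt (jac (M x i.+1) (Some h)) <= 3 / (2 * cf_prod C x i.+1)].
Proof.
move=> Kx fx [bh dh]; have bx := K_boundary Kx.
have [Ki i0] := cf_iter n_gt0 i Kx fx.
have [Ki1 i10] := cf_iter n_gt0 i.+1 Kx fx; have bi1 := K_boundary Ki1.
have [GM E1 E2 J] := cf_mx_spec n_gt0 i.+1 Kx fx.
set m := M x i.+1 in GM E1 E2 J *; set y := iter i.+1 T x in dh Ki1 bi1 E1 E2 i10.
have p1 := cf_prod_gt0 n_gt0 i.+1 Kx fx; have p0 := cf_prod_gt0 n_gt0 i Kx fx.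
have hy : Num.sqrt (hn (Some y) m^-1%g) = (cf_prod C x i.+1)^-1.
  have := @hn_act _ _ _ m^-1%g (Some x) 1%g bx; rewrite mulg1 E2 J hn1 => h1.
  have -> : hn (Some y) m^-1%g = (cf_prod C x i.+1)^-1 ^+ 2.
    by rewrite exprVn -[RHS]mul1r -h1 mulfK// sqrf_eq0 gt_eqF.
  by rewrite sqrtr_sqr ger0_norm// invr_ge0 ltW.
have hN : eta * Num.sqrt (hn None m^-1%g) <= (2 * cf_prod C x i.+1)^-1.
  have c0 : 0 < dirichlet_const r.
    by rewrite (lt_le_trans ltr01)// dirichlet_const_ge1.
  have h1 := sqrt_denominator_le n_gt0 r0 r1 Kr i Kx fx.
  apply: le_trans (ler_wpM2l (ltW zoom_radius_gt0) h1) _.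
  rewrite /zoom_radius; set D1 := dirichlet_const r in c0 *.
  have -> : (2 * D1)^-1 * (D1 / cf_prod C x i) = (2 * cf_prod C x i)^-1.
    by field; rewrite !gt_eqF.
  rewrite lef_pV2 ?posrE ?mulr_gt0// ler_pM2l//.
  rewrite /cf_prod big_ord_recr/= -/(cf_prod C x i) ler_piMr ?(ltW p0)//.
  by rewrite (le_trans (Kr Ki))// ltW.
set S := Num.sqrt (hn None m^-1%g) in hN.
have S0 : 0 <= S by exact: sqrtr_ge0.
have dS : dist y h * S <= (2 * cf_prod C x i.+1)^-1.
  by apply: le_trans hN; rewrite ler_wpM2r// ltW.
have up : Num.sqrt (hn (Some h) m^-1%g) <= 3 / (2 * cf_prod C x i.+1).
  apply: le_trans (sqrt_hn_triangle _ bi1 bh) _; rewrite hy -/S.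
  have -> : 3 / (2 * cf_prod C x i.+1) = (cf_prod C x i.+1)^-1 + (2 * cf_prod C x i.+1)^-1.
    by field; rewrite gt_eqF.
  by rewrite lerD2l.
have lo : (2 * cf_prod C x i.+1)^-1 <= Num.sqrt (hn (Some h) m^-1%g).
  have := sqrt_hn_triangle m^-1%g bh bi1; rewrite hy -/S (distC bh bi1).
  have -> : (cf_prod C x i.+1)^-1 = (2 * cf_prod C x i.+1)^-1 + (2 * cf_prod C x i.+1)^-1.
    by field; rewrite gt_eqF.
  move: dS; lra.
have hh := @hn_act _ _ _ m (Some h) m^-1%g bh; rewrite mulgV in hh.
have := bd_act m (bh : bd (Some h)).
case F : (act m (Some h)) hh => [p|] hh bp.
  exists p; rewrite hn1 mul1r in hh; split=> //; first by rewrite hh.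
  by rewrite hh.
(* At a pole of the branch the form vanishes, against the lower bound. *)
move: lo; rewrite -hh hn_None1 mul0r sqrtr0 => lo.
have : 0 < (2 * cf_prod C x i.+1)^-1 by rewrite invr_gt0 mulr_gt0.
by rewrite ltNge lo.
Qed.

Definition zoom_escape A x i : set pt := [set h | hball (iter i.+1 T x) eta h /\
  exists2 p, act (M x i.+1) (Some h) = Some p & ~ A p].

(** The branch maps the [eta]-ball into the ball of radius [4 * eta * P ^+ 2] about [x], and going
    back stretches distances by at most [9 / (4 * P ^+ 2)]. The product [9 * eta] does not depend on
    [i], so small density of the complement at [x] becomes small measure at a fixed scale. *)
Lemma zoom A x (e : R) : K x -> ~ cf_finite C x ->
  (forall m : nat, exists2 r0, 0 < r0 & forall rho, 0 < rho -> rho < r0 ->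
      (leb (hball x rho `\` A) <= (rho ^+ Q / m.+1%:R)%:E)%E) -> 0 < e ->
  exists i0, forall i, (i0 <= i)%N -> (leb (zoom_escape A x i) <= e%:E)%E.
Proof.
move=> Kx fx HA e0; have bx := K_boundary Kx; have eta0 := zoom_radius_gt0.
have lc0 := lip_const_gt0 R s n.
(* Makes the resulting bound, the numerator here divided by [m.+1], at most [e]. *)
pose m := Num.truncn (lip_const R s n * (9 * eta) ^+ Q / e).
have [rr rr0 Hr] := HA m.
pose t := Num.min 1 (rr / (4 * eta)).
have t0 : 0 < t by rewrite lt_min ltr01 divr_gt0// mulr_gt0.
have [i0 _ Hi0] := cf_prod_cvg n_gt0 r0 r1 Kr Kx fx t0.
exists i0 => i /Hi0 /=; rewrite lt_min => /andP[pt1 ptr].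
have p0 := cf_prod_gt0 n_gt0 i.+1 Kx fx.
set P := cf_prod C x i.+1 in p0 pt1 ptr *.
have [GM E1 E2 J] := cf_mx_spec n_gt0 i.+1 Kx fx.
have [Ki1 _] := cf_iter n_gt0 i.+1 Kx fx; have bi1 := K_boundary Ki1.
pose rho := 4 * eta * P ^+ 2.
have rho0 : 0 < rho by rewrite !mulr_gt0// exprn_gt0.
have rhor : rho < rr.
  apply: (@le_lt_trans _ _ (4 * eta * P)).
    by rewrite ler_pM2l ?mulr_gt0// expr2 ler_piMr// ltW.
  by rewrite mulrC -ltr_pdivlMr// mulr_gt0.
pose W := [set p | (hball x rho `\` A) p /\
  exists2 h, hball (iter i.+1 T x) eta h & act (M x i.+1) (Some h) = Some p].
pose f p := finpt (act (M x i.+1)^-1%g (Some p)).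
pose L : R := 9 / (4 * P ^+ 2).
have L0 : 0 < L by rewrite divr_gt0// mulr_gt0// exprn_gt0.
have fE h p : boundary h -> act (M x i.+1) (Some h) = Some p -> f p = h.
  by move=> bh E; rewrite /f -E actK.
have sub : zoom_escape A x i `<=` f @` W.
  move=> h [hh [p Ep nA]]; exists p; last by apply: fE => //; case: hh.
  have [p' [bp Ep' lo hi]] := cf_mx_distortion Kx fx hh.
  move: Ep'; rewrite Ep => -[pp]; rewrite -{p'}pp in bp.
  split; last by exists h.
  split=> //; split=> //.
  have hy : hball (iter i.+1 T x) eta (iter i.+1 T x).
    by split=> //; rewrite /dist hmulNp gauge0.
  have [x' [_ Ex' lo' _]] := cf_mx_distortion Kx fx hy.
  have D := dist_act bi1 (hh.1) E1 Ep.
  case: hh => bh dh; rewrite -/P in lo lo'.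
  have q0 : 0 < (2 * P)^-1 by rewrite invr_gt0 mulr_gt0.
  have D1 : dist x p * ((2 * P)^-1 * (2 * P)^-1) < eta.
    apply: le_lt_trans dh; rewrite -D ler_wpM2l ?dist_ge0//.
    by apply: ler_pM; rewrite ?(ltW q0).
  rewrite -(ltr_pM2r (mulr_gt0 q0 q0)); apply: lt_le_trans D1 _.
  by rewrite /rho le_eqVlt; apply/orP; left; apply/eqP; field; rewrite gt_eqF.
apply: le_trans (leb_le sub) _.
apply: le_trans (leb_lipschitz n_gt0 L0 _ _ _) _.
- by move=> p [[[]]].
- by move=> p [_ [h [bh _] E]]; rewrite (fE _ _ bh E).
- move=> p q [_ [h hh E]] [_ [h' hh' E']].
  rewrite (fE _ _ hh.1 E) (fE _ _ hh'.1 E') -(dist_act hh.1 hh'.1 E E') mulrC.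
  have [_ [_ _ _ hi]] := cf_mx_distortion Kx fx hh.
  have [_ [_ _ _ hi']] := cf_mx_distortion Kx fx hh'.
  rewrite ler_wpM2r ?dist_ge0//.
  have -> : L = 3 / (2 * P) * (3 / (2 * P)) by rewrite /L; field; rewrite gt_eqF.
  by apply: ler_pM; rewrite ?sqrtr_ge0.
have WW : (leb W <= (rho ^+ Q / m.+1%:R)%:E)%E.
  by apply: le_trans (Hr _ rho0 rhor); apply: leb_le => p [].
have LL : 0 <= lip_const R s n * L ^+ Q by rewrite mulr_ge0 ?(ltW lc0)// exprn_ge0// ltW.
apply: le_trans (lee_wpmul2l _ WW) _; first by rewrite lee_fin.
rewrite -EFinM lee_fin.
have Lrho : L * rho = 9 * eta by rewrite /L /rho; field; rewrite gt_eqF.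
have -> : lip_const R s n * L ^+ Q * (rho ^+ Q / m.+1%:R) =
    lip_const R s n * (9 * eta) ^+ Q / m.+1%:R.
  by rewrite -Lrho (exprMn _ L rho) mulrA [in RHS]mulrA.
rewrite ler_pdivrMr// [e * _]mulrC -ler_pdivrMr//.
exact: ltW (truncnS_gt _).
Qed.

End Ergodicity.

(** * From a null ball to a null complement *)

Section ErgodicTheorem.
Variables (R : realType) (s : scalars) (n : nat).
Hypothesis n_gt0 : (0 < n)%N.
Local Notation k := (scal R s).
Local Notation G := (PU R s n).
Local Notation pt := ('cV[k]_n * k)%type.
Local Notation leb := (@leb R s n).
Local Notation boundary := (@boundary R s n).
Variable C : iwasawa_cf R s n.
Local Notation Z := (cf_lattice C).
Local Notation K := (cf_domain C).
Local Notation T := (cf_shift C).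
Local Notation Gam := (modular_group C).
Local Notation M := (cf_mx C).
Implicit Types (g h : G) (x y p q : pt) (A B : set pt).
Variables (r kap : R).
Hypotheses (r0 : 0 <= r) (r1 : r < 1) (Kr : forall x, K x -> gauge x <= r).
Hypotheses (kap0 : 0 < kap)
  (Hkap : forall g, Gam g -> act g None <> None -> kap <= jac g None).
Hypotheses (discreteC : cf_discrete C) (completeC : cf_complete C).
Local Notation eta := (zoom_radius r).

Lemma far_translate b (L : R) : boundary b -> 0 <= L ->
  exists2 z, Z z & forall x, K x -> exists p, [/\ boundary p,
    act z (Some x) = Some p & L < dist p b].
Proof.
move=> bb L0; have g0 := gauge_ge0 b.
(* The 3 covers the diameter of [K], at most 2, with 1 to spare. *)
have far0 : 0 <= L + gauge b + 3 by rewrite !addr_ge0.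
have [p0 [bp0 hp0]] := far_point s n_gt0 far0.
have : (\bigcup_(a in Z) act_image a K) p0 by rewrite -K_cover.
move=> [z Zz [x0 Kx0 E0]]; exists z => // x Kx.
have bx := K_boundary Kx; have bx0 := K_boundary Kx0.
have [zN zd] := Z_isom Zz.
have [p bp E] := act_stab_fin zN bx; exists p; split=> //.
have := zd _ _ bx0 bx; rewrite E0 E /= => D.
have b0 : boundary (0 : pt) := boundary0 _ _ _.
have h1 : dist p0 p <= 2.
  rewrite D; apply: le_trans (dist_triangle bx0 b0 bx) _; rewrite distC// !dist0.
  by rewrite (_ : 2 = 1 + 1 :> R)// lerD// (le_trans (Kr _)) ?(ltW r1).
have h2 := dist_triangle b0 bb bp0; rewrite !dist0 in h2.
have h3 := dist_triangle bb bp bp0; rewrite (distC bb bp) (distC bp bp0) in h3.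
lra.
Qed.

(** A convergent [c] lies close to [y]. By covariance, the distance of the image of [p] to [c],
    times [dist p b], times the denominator is 1, where [b] is the pole. A translate of [K] far from
    [b] is thus squeezed into a small ball about [c]. *)
Lemma cusp_neighbourhood y (e : R) : K y -> ~ cf_finite C y -> 0 < e ->
  exists2 g, Gam g & forall x, K x -> exists p, [/\ act g (Some x) = Some p & hball y e p].
Proof.
move=> Ky fy e0; have by' := K_boundary Ky.
have sk0 : 0 < Num.sqrt kap by rewrite sqrtr_gt0.
have e2 : 0 < e / 2 * Num.sqrt kap by rewrite mulr_gt0// divr_gt0.
have [i _ /(_ i (leqnn i)) Hi] := cf_prod_cvg n_gt0 r0 r1 Kr Ky fy e2.
have [c [bc Ec Dc]] := cf_dist_le n_gt0 r0 r1 Kr kap0 Hkap i Ky fy.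
have {}Dc : dist y c < e / 2 by apply: le_lt_trans Dc _; rewrite ltr_pdivrMr.
have [GM _ _ _] := cf_mx_spec n_gt0 i.+1 Ky fy.
set g := M y i.+1 in Ec GM.
have [b bb Eb] : exists2 b, boundary b & act g (Some b) = None.
  have := bd_act g^-1%g (I : bd None); have := actVK g (I : bd None).
  case: (act g^-1%g None) => [b|] E bb; first by exists b.
  by move: Ec; rewrite E.
have q0 := jac_gt0 g (I : bd None); set q := jac g None in q0.
have L0 : 0 <= (e / 2 * q)^-1 by rewrite invr_ge0 mulr_ge0 ?divr_ge0 ?ltW.
have [z Zz Hz] := far_translate bb L0.
exists (g * z)%g; first exact: subgroupM (Gam_sub C) GM (Z_Gam Zz).
move=> x Kx; have bx := K_boundary Kx; have [p [bp E far]] := Hz x Kx.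
have dpb : 0 < dist p b by apply: le_lt_trans far.
rewrite actM// E.
have jp := jac_gt0 g (bp : bd (Some p)); have jb := jac_gt0 g (bb : bd (Some b)).
have qb : q * jac g (Some b) = 1.
  have := @nn_act _ _ _ g None (Some b) I bb.
  by rewrite Eb Ec nnC !nn_None_fin mul1r.
have := bd_act g (bp : bd (Some p)).
case F : (act g (Some p)) => [p'|] bp'; last first.
  have := @act_inj _ _ _ g (Some p) (Some b) bp bb; rewrite F Eb => /(_ erefl)[pb].
  by move: dpb; rewrite pb /dist hmulNp gauge0 ltxx.
exists p'; split=> //; split=> //.
have H1 := @nn_act _ _ _ g (Some p) (Some b) bp bb.
rewrite F Eb nnC nn_None_fin mul1r nn_fin// in H1.
have H2 := @nn_act _ _ _ g (Some p) None bp I.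
rewrite F Ec [RHS]nnC nn_None_fin nn_fin// -/q in H2.
have H3 : (dist p' c * (dist p b * q)) ^+ 2 = 1.
  rewrite !exprMn -H1 -H2; transitivity
    (dist p' c ^+ 2 * jac g (Some p) * q * (q * jac g (Some b))); first by ring.
  by rewrite qb mulr1.
have dq0 : 0 < dist p b * q by rewrite mulr_gt0.
have {}H3 : dist p' c * (dist p b * q) = 1.
  by apply/eqP; move/eqP: H3; rewrite sqrp_eq1// mulr_ge0 ?dist_ge0 ?(ltW dq0).
have pc : dist p' c < e / 2.
  rewrite -(ltr_pM2r dq0) H3 mulrCA -ltr_pdivrMr ?mulr_gt0 ?divr_gt0//.
  by rewrite div1r.
apply: le_lt_trans (dist_triangle by' bc bp') _; rewrite (distC bc bp').
move: Dc pc; lra.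
Qed.

Section NullComplement.
Variable B : set pt.
Hypotheses (BK : B `<=` K) (mB : lmeasurable B) (B0 : leb B <> 0%E)
  (TB : leb ((K `&` T @^-1` B) `+` B) = 0%E).
Local Notation N := (saturation C (bad C r kap B)).
Local Notation orbit := (saturation C (K `\` B)).

(** The branch image of [p] lies in the orbit of a point of [K] outside [B]; if it belonged to [B],
    this would contradict [good_orbit]. *)
Lemma orbit_escape x i p : K x -> ~ N x ->
  hball (iter i.+1 T x) eta p -> orbit p -> N p \/ zoom_escape C r B x i p.
Proof.
move=> Kx gx hp [g Gg [q [Kq nBq] E]].
have fx : ~ cf_finite C x := good_infinite n_gt0 Kx gx.
have [Np|Np] := pselect (N p); [by left|right; split=> //].
have bp := hp.1; have bq := K_boundary Kq.
have [p' [bp' E' _ _]] := cf_mx_distortion n_gt0 r0 r1 Kr Kx fx hp.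
have [GM _ _ _] := cf_mx_spec n_gt0 i.+1 Kx fx.
exists p' => // Bp'; apply: nBq.
have gq : ~ N q.
  apply: (good_act BK (subgroupV (Gam_sub C) Gg) bp _ Np).
  by rewrite -E actK.
have Gh : Gam (M x i.+1 * g)%g := subgroupM (Gam_sub C) GM Gg.
have Eq : act (M x i.+1 * g)%g (Some q) = Some p' by rewrite actM// E.
by apply/(good_orbit n_gt0 r0 r1 Kr kap0 Hkap completeC BK Kq (BK Bp') Gh Eq gq).
Qed.

(** Tails of the same colour are closer than [eta / 2], so the half-size ball about one tail lies in
    the full-size balls about arbitrarily late tails, where the escaping set is as small as desired.
    The ball thus stays fixed while [e] tends to 0. *)
Lemma null_ball : exists y, [/\ K y, ~ cf_finite C y &
  leb (orbit `&` hball y (eta / 2)) = 0%E].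
Proof.
have bB x : B x -> boundary x /\ gauge x <= r.
  by move=> /BK Kx; split; [exact: K_boundary Kx|exact: Kr].
have N0 : leb N = 0%E.
  exact: (leb_saturation_bad n_gt0 r0 r1 Kr kap0 Hkap discreteC BK TB).
have [x [Bx gx Hx]] := density_point n_gt0 bB mB.2 B0 N0.
have Kx := BK Bx.
have fx : ~ cf_finite C x := good_infinite n_gt0 Kx gx.
have e2 : 0 < eta / 2 by rewrite divr_gt0// zoom_radius_gt0.
have [F [col Hcol]] := @ball_colouring R s n _ e2.
have [f Hf] := infinitely_often (fun i => col (iter i.+1 T x)).
have Ki i : [/\ K (iter i.+1 T x), boundary (iter i.+1 T x) & gauge (iter i.+1 T x) <= 1].
  have [Ki _] := cf_iter n_gt0 i.+1 Kx fx; split=> //; first exact: K_boundary Ki.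
  exact: le_trans (Kr Ki) (ltW r1).
have [i _ ci] := Hf 0%N; have [Ky bY gy] := Ki i.
exists (iter i.+1 T x); split=> //.
  by move=> [j]; rewrite -iterD => h; apply: fx; exists (j + i.+1)%N.
apply/eqP; rewrite eq_le leb_ge0 andbT; apply/lee_addgt0Pr => e e0; rewrite add0e.
have [i0 Hi0] := zoom n_gt0 r0 r1 Kr Kx fx Hx e0.
have [j ij cj] := Hf i0; have [_ bj gj] := Ki j.
have dij : dist (iter j.+1 T x) (iter i.+1 T x) < eta / 2.
  exact: Hcol bj gj bY gy (etrans cj (esym ci)).
apply: le_trans (leb_le (B := N `|` zoom_escape C r B x j) _) _.
  move=> p [Op [bp dp]]; apply: (orbit_escape Kx gx _ Op); split; first exact: bp.
  by apply: le_lt_trans (dist_triangle bj bY bp) _; rewrite (splitr eta) ltrD.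
apply: le_trans (lebU2 n_gt0 _ _) _; rewrite N0 add0e.
exact: Hi0.
Qed.

Lemma leb_complement0 : leb (K `\` B) = 0%E.
Proof.
have [y [Ky fy Hy]] := null_ball.
have e2 : 0 < eta / 2 by rewrite divr_gt0// zoom_radius_gt0.
have [g Gg Hg] := cusp_neighbourhood Ky fy e2.
apply: (@leb_subset0 _ _ _ _ (act_image g^-1%g (orbit `&` hball y (eta / 2)))).
  move=> x [Kx nBx]; have [p [E hp]] := Hg x Kx; have bx := K_boundary Kx.
  exists p; last by rewrite -E actK.
  by split=> //; exists g => //; exists x.
by apply: leb_act_image0 => // p [_ []].
Qed.

End NullComplement.

Lemma ergodic : cf_ergodic C.
Proof.
move=> B BK mB TB; have [B0|B0] := pselect (leb B = 0%E); [by left|right].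
exact: leb_complement0.
Qed.

End ErgodicTheorem.

Theorem theorem1p2 (R : realType) (s : scalars) (n : nat) (n_ge1 : (1 <= n)%N)
    (C : iwasawa_cf R s n) :
  cf_discrete C -> cf_proper C ->
  cf_is_convergent C /\ (cf_complete C -> cf_ergodic C).
Proof.
move=> dC pC; have [r [r0 r1 Kr]] := cf_proper_radius pC.
have [kap kap0 Hkap] := cf_discrete_denominators n_ge1 dC pC.
split.
  rewrite /cf_is_convergent (_ : _ `&` _ = set0) ?leb0//.
  rewrite -subset0 => x [Kx]; apply.
  exact: (cf_converges_all n_ge1 r0 r1 Kr kap0 Hkap Kx).
move=> cC; exact: (ergodic n_ge1 r0 r1 Kr kap0 Hkap dC cC).
Qed.
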